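(* Let $a>0$, and consider the differential equation $$\frac{dY}{dz}=\left(\Lambda(z)+R(z)\right)Y$$ with $$\Lambda(z)=\Lambda_1(z)\oplus\dots\oplus\Lambda_\ell(z),\qquad \Lambda_i(z)=\sum_{k=0}^h\sigma_k\lambda_i^{(k)}z^{\sigma_k-1}I_{s_i},\qquad 1=\sigma_0>\sigma_1>\dots>\sigma_h>0,$$ $\lambda_i^{(k)}\in\mathbb C$, $s_i\in\mathbb N_{>0}$, $s_1+\dots+s_\ell=n$, $\ell\ge2$, where $\Lambda$ is generic, i.e. $\lambda_i^{(0)}\ne\lambda_j^{(0)}$ for all $1\le i\ne j\le\ell$, and with a perturbation term $R\in\mathscr O(\widetilde{\mathbb C}_a;\mathfrak{gl}(n,\mathbb C))$ satisfying the good decay condition on any open interval. Fix $j_o\in\{1,\dots,\ell\}$, and let $\tau_{\rho_0}<\tau_{\rho_1}<\dots<\tau_{\rho_{\mu_o-1}}$ be $\mu_o$ consecutive directions of the Stokes rays associated with the pairs $(i,j_o)$, $i\in\{1,\dots,\ell\}$, $i\ne j_o$. If $$\tau_{\rho_{\mu_o-1}}-\tau_{\rho_0}<\pi,$$ then, for any $k\in\mathbb Z$, there exist $s_{j_o}$ vector solutions $$y_\alpha^{(k)}\in\mathscr O(\widetilde{\mathbb C}_a;\mathbb C^n),\qquad\alpha=s_1+\dots+s_{j_o-1}+m,\quad m=1,\dots,s_{j_o},$$ each of which is uniquely characterized by the asymptotic behaviour $$y_\alpha^{(k)}(z)=(e_\alpha+o(1))\exp\left(\sum_{q=0}^h\lambda_{j_o}^{(q)}z^{\sigma_q}\right)$$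 for $z\to\infty$ in any closed subsector of the sector $$S_k^{(j_o)}:=\left\{z\in\widetilde{\mathbb C}_a\ \middle|\ \tau_{\rho_{\mu_o-1}}-\pi<\arg z-2k\pi<\tau_{\rho_0}+2\pi\right\}.$$
   Context: Notation. $\widetilde{\mathbb C^*}$ is the universal cover of $\mathbb C^*$; its points have modulus $|z|>0$ and argument $\arg z\in\mathbb R$, and $z^s=|z|^se^{\sqrt{-1}s\arg z}$. $\widetilde{\mathbb C}_a:=\{z\in\widetilde{\mathbb C^*}:|z|>a\}$. For $\phi\in\mathbb R$ and $b>0$, $\ell_{\phi,b}:=\{z\in\widetilde{\mathbb C^*}:\arg z\in\left]\phi-\frac\pi2;\phi+\frac\pi2\right[,\ |z|=\frac{b}{\cos(\phi-\arg z)}\}$. $\mathfrak{gl}(n,\mathbb C)$ carries an arbitrary norm; $\mathscr O(D;V)$ is the space of $V$-valued holomorphic functions on $D$; $(e_1,\dots,e_n)$ is the standard basis of $\mathbb C^n$. Good decay condition on an open interval $I$: for any closed interval $J\subseteq I$, $R$ is $L^1$-integrable (with respect to arc length) along $\ell_{\phi,b}$ for all $\phi\in J$ and $b>a$, and $\lim_{b\to+\infty}\sup_{\phi\in J}\|R|_{\ell_{\phi,b}}\|_1=0$. Stokes rays (generic case). For $i\ne j_o$ put $\lambda_{ij_o}:=\lambda_i^{(0)}-\lambda_{j_o}^{(0)}\neq0$. The Stokes rays associated with the pair $(i,j_o)$ are the half-lines in $\widetilde{\mathbb C^*}$ given by $\operatorname{Re}(\lambda_{ij_o}z)=0$, $\operatorname{Im}(\lambda_{ij_o}z)<0$;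 their directions are $\arg z=\frac{3\pi}2-\arg\lambda_{ij_o}$, for all the determinations of $\arg\lambda_{ij_o}$ (so they are defined modulo $2\pi$). $\mu_o$ is the number of distinct classes modulo $2\pi$ of the directions of the Stokes rays associated with the pairs $(i,j_o)$, $i\neq j_o$; equivalently, choosing $\eta\in\mathbb R$ with $\eta\not\equiv\arg\lambda_{ij_o}$ mod $\pi$ for all $i\ne j_o$, $\tau_{\rho_0}<\dots<\tau_{\rho_{\mu_o-1}}$ are the distinct values of $\frac{3\pi}2-\arg\lambda_{ij_o}$ with $\arg\lambda_{ij_o}\in\left]\eta-2\pi;\eta\right[$, $i\ne j_o$. *)

(* Defs.v *)
From HB Require Import structures.
From mathcomp Require Import all_boot all_order all_algebra.
From mathcomp Require Import all_classical all_reals all_analysis.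
From mathcomp Require Import complex.
From mathcomp Require Import ring.
Set Implicit Arguments.
Unset Strict Implicit.
Unset Printing Implicit Defensive.
Import Order.TTheory GRing.Theory Num.Theory.
Import numFieldNormedType.Exports.
Local Open Scope classical_set_scope.
Local Open Scope ring_scope.
Local Open Scope complex_scope.

HB.instance Definition _ (R : realType) := NormedModule.copy R[i] R[i]^o.

(* A point of the universal cover of C^* is a pair (modulus, argument), with
   the product topology.  Pairs with nonpositive modulus are not points of the
   cover: everything below is restricted to regions of positive modulus. *)
Definition ucover (R : realType) : Type := (R * R)%type.

Section UniversalCover.
Context {R : realType}.
Implicit Types (z : ucover R) (s t : R).

Definition modulus z : R := z.1.
Definition argument z : R := z.2.

Definition cis t : R[i] := cos t +i* sin t.

Definition cexp (w : R[i]) : R[i] :=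
  (expR (complex.Re w))%:C * cis (complex.Im w).

Definition proj z : R[i] := (modulus z)%:C * cis (argument z).

Definition zpow s z : R[i] := (modulus z `^ s)%:C * cis (s * argument z).

Definition cover_gt (a : R) : set (ucover R) := [set z | a < modulus z].

(* The derivative is taken with respect to the coordinate [proj], which is a
   local homeomorphism. *)
Definition is_zderive (V : normedModType R[i]) (f : ucover R -> V) z (l : V) :=
  (fun z' : R * R => (proj z' - proj z)^-1 *: (f z' - f z)) @ (z : R * R)^'
    --> l.

Definition holomorphic_on (V : normedModType R[i]) (D : set (ucover R))
    (f : ucover R -> V) :=
  forall z, D z -> exists l, is_zderive f z l.

Definition ell (phi b : R) : set (ucover R) :=
  [set z | phi - pi / 2 < argument z < phi + pi / 2 /\
           modulus z = b / cos (phi - argument z)].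

(* Arc-length parametrization of [ell phi b]; see [range_ell_param] and
   [proj_ell_param]. *)
Definition ell_param (phi b t : R) : ucover R :=
  (Num.sqrt (b ^+ 2 + t ^+ 2), phi + atan (t / b)).

Lemma sqrt_ell_param b t : 0 < b ->
  Num.sqrt (b ^+ 2 + t ^+ 2) = b / cos (atan (t / b)).
Proof.
move=> b0; rewrite cos_atan invrK.
rewrite -[X in X * _](gtr0_norm b0) -sqrtr_sqr -sqrtrM ?sqr_ge0//.
by rewrite mulrDr mulr1 -exprMn mulrC divfK// gt_eqF.
Qed.

Lemma range_ell_param (phi b : R) : 0 < b ->
  range (ell_param phi b) = ell phi b.
Proof.
move=> b0; apply/seteqP; split => [_ [t _ <-]|[r th]].
  rewrite /ell /= /argument /modulus /=; split.
    by rewrite !ltrD2l atan_gtNpi2 atan_ltpi2.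
  by rewrite opprD addrA subrr add0r cosN sqrt_ell_param.
rewrite /ell /argument /modulus /= => -[/andP[th1 th2] ->].
have thI : th - phi \in `](- (pi / 2)), (pi / 2)[.
  by rewrite in_itv/= ltrBrDl th1/= ltrBlDl.
have e : b * tan (th - phi) / b = tan (th - phi).
  by rewrite mulrAC divff ?mul1r// gt_eqF.
exists (b * tan (th - phi)) => //; rewrite /ell_param sqrt_ell_param// e tanK//.
by rewrite [phi + _]addrC subrK -[in LHS]cosN opprB.
Qed.

Lemma proj_ell_param (phi b t : R) : 0 < b ->
  proj (ell_param phi b t) = cis phi * (b +i* t).
Proof.
move=> b0; rewrite /proj /modulus /argument /= sqrt_ell_param//.
have cn0 : cos (atan (t / b)) != 0.
  by rewrite gt_eqF// cos_gt0_pihalf// atan_gtNpi2 atan_ltpi2.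
have sE : sin (atan (t / b)) = t / b * cos (atan (t / b)).
  by rewrite -[X in _ = X * _](atanK (t / b)) /tan divfK.
have b1 : b != 0 by rewrite gt_eqF.
rewrite /cis cosD sinD sE; apply/eqP; rewrite eq_complex/=.
by apply/andP; split; apply/eqP; field; rewrite cn0 b1.
Qed.

Definition is_norm (n : nat) (N : 'M[R[i]]_n -> R) :=
  [/\ forall A, N A = 0 -> A = 0,
      forall A B, N (A + B) <= N A + N B &
      forall (c : R[i]) A, N (c *: A) = complex.Re `|c| * N A].

Definition good_decay (n : nat) (N : 'M[R[i]]_n -> R) (a : R)
    (P : ucover R -> 'M[R[i]]_n) (I : set R) :=
  forall c d : R, c <= d -> `[c, d] `<=` I ->
    (forall phi b, phi \in `[c, d] -> a < b ->
       lebesgue_measure.-integrable setT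
         (EFin \o (fun t => N (P (ell_param phi b t))))) /\
    (fun b : R => ereal_sup
       [set (\int[lebesgue_measure]_t (N (P (ell_param phi b t)))%:E)%E
         | phi in `[c, d]%classic]) @ +oo --> 0%E.

Definition stokes_ray (lam : R[i]) : set (ucover R) :=
  [set z | [/\ 0 < modulus z, complex.Re (lam * proj z) = 0
             & complex.Im (lam * proj z) < 0]].

Definition stokes_directions (l : nat) (lam0 : 'I_l -> R[i]) (jo : 'I_l) :
    set R :=
  \bigcup_(i in [set i | i != jo]) argument @` stokes_ray (lam0 i - lam0 jo).

Definition class_mod2pi t : set R := [set t + 2 * pi * k%:~R | k in @setT int].

(* [tau 0 < ... < tau mu.-1] are consecutive elements of [T]. *)
Definition consecutive (T : set R) (mu : nat) (tau : nat -> R) :=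
  [/\ forall r, (r < mu)%N -> T (tau r),
      forall r r', (r < r' < mu)%N -> tau r < tau r' &
      forall t, T t -> tau 0%N <= t <= tau mu.-1 ->
        exists2 r, (r < mu)%N & t = tau r].

Definition Lambda (l h : nat) (s : 'I_l -> nat) (sigma : 'I_h.+1 -> R)
    (lam : 'I_l -> 'I_h.+1 -> R[i]) z : 'M[R[i]]_(\sum_i s i) :=
  \mxdiag_(i < l)
    ((\sum_(k < h.+1) (sigma k)%:C * lam i k * zpow (sigma k - 1) z)%:M
       : 'M[R[i]]_(s i)).

Definition is_solution (n : nat) (a : R) (A : ucover R -> 'M[R[i]]_n)
    (y : ucover R -> 'cV[R[i]]_n) :=
  forall z, cover_gt a z -> is_zderive y z (A z *m y z).

Definition closed_sector (a c d : R) : set (ucover R) :=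
  [set z | a < modulus z /\ c <= argument z <= d].

Definition sector_k (a tmin tmax : R) (k : int) : set (ucover R) :=
  [set z | cover_gt a z /\
     tmax - pi < argument z - 2 * k%:~R * pi < tmin + 2 * pi].

(* The filter in the last line is that of [|z| -> +oo], uniformly in
   [arg z \in `[c, d]]. *)
Definition asymptotic_in (n : nat) (a : R) (S : set (ucover R))
    (y : ucover R -> 'cV[R[i]]_n) (e : 'cV[R[i]]_n) (q : ucover R -> R[i]) :=
  forall c d : R, closed_sector a c d `<=` S ->
    exists g : ucover R -> 'cV[R[i]]_n,
      (forall z, closed_sector a c d z -> y z = cexp (q z) *: (e + g z)) /\
      g @ filter_prod (pinfty_nbhs R) (globally `[c, d]%classic) --> (0 : 'cV[R[i]]_n).

End UniversalCover.

(* Main.v *)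
(* Put y = exp(Q) w, where Q is the exponent of the block j_o. Along a line in a
   direction psi for which Re((lambda_i - lambda_jo) e^(i psi)) > 0 for all
   i <> j_o, and far enough from the origin, the diagonal part of the equation
   for w can only increase |w|^2, so going back from infinity |w|^2 grows at most
   by exp(C ||R||_1), where ||R||_1 is the L^1 norm along the line; likewise for
   |w - e|^2 + 1. Since the Stokes directions lie within less than pi, such psi
   fill an interval ]A, B[ with A = tau_max, B = tau_min + pi. The estimate shows
   that a solution with w -> e along one direction psi has this behaviour in the
   two half-planes of arguments ]psi - pi, psi[ and ]psi, psi + pi[, hence by
   iteration in ]A - pi, B + pi[, and that it is unique. It exists as the limit
   of the solutions with w = e at a point that moves to infinity on a line.
   Global existence for the linear equation is a Picard iteration, with
   primitives provided by Goursat's theorem. *)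
Require Import Defs.
From mathcomp Require Import all_boot all_order all_algebra.
From mathcomp Require Import all_classical all_reals all_analysis complex.
From mathcomp Require Import ring lra.
Import Order.TTheory GRing.Theory Num.Theory.
Import numFieldNormedType.Exports.
Set Implicit Arguments.
Unset Strict Implicit.
Unset Printing Implicit Defensive.
Local Open Scope classical_set_scope.
Local Open Scope ring_scope.
Local Open Scope complex_scope.

(** The decay of the perturbation is given only through L^1 norms along the curves [ell phi b],
    which tend to 0 as the distance [b] from the origin grows. Hence the use of whole lines: the
    line through a distant point of a closed subsector is itself distant, so the factor
    [expR (C * ...)] is close to 1 uniformly there. A fixed line gives only a bounded factor, which
    is enough for uniqueness.

    The vector [e] is supported in block [jo], where the drift of the reduced equation vanishes. So
    [w - e] obeys the equation of [w] with a forcing controlled by the perturbation alone, and the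
    parameter [k] of [energy_le] treats [w] ([k = 0]) and [w - e] ([k = 1]) together. The limit
    construction controls the solution on a single line; lines in another good direction, which
    cross it far out, spread this to a first sector.

    Derivatives are taken with respect to a map [p] from the real plane to the complex numbers. The
    chart identifies [cover_gt a] with the whole plane, so every coordinate rectangle lies in the
    domain, and Goursat's theorem on rectangles yields global primitives. *)

Local Notation Re := (@complex.Re _).
Local Notation Im := (@complex.Im _).
Local Notation normc := (@Normc.normc _).
Local Notation proj := Defs.proj.

(** * Calculus of complex functions of a real variable *)

Section ComplexModulus.
Context {R : realType}.
Implicit Types (x y : R[i]) (c t : R).

Lemma ReD x y : Re (x + y) = Re x + Re y. Proof. by case: x y => [? ?] []. Qed.
Lemma ImD x y : Im (x + y) = Im x + Im y. Proof. by case: x y => [? ?] []. Qed.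
Lemma ReN x : Re (- x) = - Re x. Proof. by case: x. Qed.
Lemma ImN x : Im (- x) = - Im x. Proof. by case: x. Qed.
Lemma ReM x y : Re (x * y) = Re x * Re y - Im x * Im y.
Proof. by case: x y => [? ?] []. Qed.
Lemma ImM x y : Im (x * y) = Re x * Im y + Im x * Re y.
Proof. by case: x y => [? ?] [? ?] /=. Qed.
Lemma complexP x y : Re x = Re y -> Im x = Im y -> x = y.
Proof. by case: x y => [? ?] [? ?] /= -> ->. Qed.

Lemma Re_sum (I : Type) (r : seq I) (Q : pred I) (F : I -> R[i]) :
  Re (\sum_(i <- r | Q i) F i) = \sum_(i <- r | Q i) Re (F i).
Proof. exact: (big_morph _ ReD). Qed.

Lemma normcE x : normc x = Num.sqrt (Re x ^+ 2 + Im x ^+ 2).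
Proof. by case: x. Qed.

Lemma normc_ge0 x : 0 <= normc x. Proof. by rewrite normcE sqrtr_ge0. Qed.

Lemma normc0 : normc (0 : R[i]) = 0. Proof. exact: Normc.normc0. Qed.

Lemma normc_eq0 x : (normc x == 0) = (x == 0).
Proof. by apply/eqP/eqP => [/Normc.eq0_normc|->]; rewrite ?normc0. Qed.

Lemma normc_gt0 x : (0 < normc x) = (x != 0).
Proof. by rewrite lt_neqAle normc_ge0 andbT eq_sym normc_eq0. Qed.

Lemma normcM x y : normc (x * y) = normc x * normc y.
Proof. exact: Normc.normcM. Qed.

Lemma normcD x y : normc (x + y) <= normc x + normc y.
Proof. exact: le_normcD. Qed.

Lemma normcN x : normc (- x) = normc x. Proof. exact: normcN. Qed.

Lemma normcB x y : normc (x - y) <= normc x + normc y.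
Proof. by rewrite -[normc y]normcN normcD. Qed.

Lemma normcBC x y : normc (x - y) = normc (y - x).
Proof. by rewrite -normcN opprB. Qed.

Lemma sqr_normc x : normc x ^+ 2 = Re x ^+ 2 + Im x ^+ 2.
Proof. by rewrite normcE sqr_sqrtr// addr_ge0// sqr_ge0. Qed.

Lemma normr_Re x : `|Re x| <= normc x.
Proof.
by rewrite -(ler_pXn2r (_ : 0 < 2)%N) ?nnegrE ?normc_ge0// sqr_normc
  real_normK ?num_real// lerDl sqr_ge0.
Qed.

Lemma normr_Im x : `|Im x| <= normc x.
Proof.
by rewrite -(ler_pXn2r (_ : 0 < 2)%N) ?nnegrE ?normc_ge0// sqr_normc
  real_normK ?num_real// lerDr sqr_ge0.
Qed.

Lemma normc_real c : normc c%:C = `|c|.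
Proof. by rewrite normcE/= expr0n/= addr0 sqrtr_sqr. Qed.

Lemma normc_le x : normc x <= `|Re x| + `|Im x|.
Proof.
rewrite -(ler_pXn2r (_ : 0 < 2)%N) ?nnegrE ?normc_ge0 ?addr_ge0//.
rewrite sqr_normc sqrrD !real_normK ?num_real// lerD2r lerDl.
by rewrite mulrn_wge0// mulr_ge0.
Qed.

Lemma normc_sum (I : Type) (r : seq I) (Q : pred I) (F : I -> R[i]) :
  normc (\sum_(i <- r | Q i) F i) <= \sum_(i <- r | Q i) normc (F i).
Proof.
elim/big_ind2: _ => [|x a y b ha hb|//]; first by rewrite normc0.
exact: le_trans (normcD _ _) (lerD ha hb).
Qed.

Lemma normc_norm x : `|x| = (normc x)%:C.
Proof. by rewrite normc_def normcE. Qed.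

Lemma Re_norm x : Re `|x| = normc x.
Proof. by rewrite normc_norm. Qed.

Lemma cis0 : cis 0 = 1 :> R[i]. Proof. by rewrite /cis cos0 sin0. Qed.

Lemma cisD (s t : R) : cis (s + t) = cis s * cis t.
Proof. by apply: complexP; rewrite ?ReM ?ImM/= ?cosD ?sinD 1?addrC//; ring. Qed.

Lemma normc_cis (t : R) : normc (cis t) = 1.
Proof. by rewrite normcE/= cos2Dsin2 sqrtr1. Qed.

Lemma cisN (t : R) : cis t * cis (- t) = 1.
Proof. by rewrite -cisD subrr cis0. Qed.

(** By the half-angle formula [cos u = 1] forces [sin (u / 2) = 0], which is impossible for [u / 2]
    strictly between 0 and pi. *)
Lemma cis_eq1 (t : R) : cis t = 1 -> `|t| < 2 * pi -> t = 0.
Proof.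
have H (u : R) : cos u = 1 -> 0 < u -> u < 2 * pi -> False.
  move=> cu u0 upi; have : cos (u / 2 + u / 2) = 1 by rewrite -splitr.
  rewrite cosD -!expr2 => c2; have := cos2Dsin2 (u / 2) => s2.
  have s0 : sin (u / 2) ^+ 2 = 0 by lra.
  have : 0 < sin (u / 2) by apply: sin_gt0_pi; lra.
  by rewrite lt0r -sqrf_eq0 s0 eqxx.
move=> /(congr1 (@complex.Re R))/= ct; rewrite ltr_norml => /andP[t1 t2].
have [t0|t0|//] := ltgtP t 0.
- by exfalso; apply: (H (- t)); rewrite ?cosN//; lra.
- by exfalso; apply: (H t).
Qed.

Lemma cis_inj (s t : R) : cis s = cis t -> `|s - t| < 2 * pi -> s = t.
Proof.
move=> e d; apply/eqP; rewrite -subr_eq0; apply/eqP/cis_eq1 => //.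
by rewrite cisD e cisN.
Qed.

End ComplexModulus.

Section DerivativesAlongR.
Context {R : realType}.
Implicit Types (f g : R -> R[i]) (s t : R) (l m : R[i]).

Lemma derive_eq (u : R -> R) t (d e : R) :
  d = e -> is_derive t (1 : R) u d -> is_derive t (1 : R) u e.
Proof. by move=> ->. Qed.

(** Taken componentwise so that the mean value theorem and the fundamental theorem of calculus for
    real functions apply to each part. *)
Definition cder f t l :=
  is_derive t (1 : R) (Re \o f) (Re l) /\ is_derive t (1 : R) (Im \o f) (Im l).

Lemma cder_eq f t l m : l = m -> cder f t l -> cder f t m.
Proof. by move=> ->. Qed.

Lemma cder_ext f g t l : f =1 g -> cder f t l -> cder g t l.
Proof. by move=> /funext ->. Qed.

Lemma cderD f g t l m : cder f t l -> cder g t m ->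
  cder (fun s => f s + g s) t (l + m).
Proof.
move=> [f1 f2] [g1 g2]; split; rewrite ?ReD ?ImD.
- have -> : Re \o (fun s => f s + g s) = (Re \o f) + (Re \o g).
    by apply/funext => s /=; rewrite ReD.
  exact: is_deriveD.
- have -> : Im \o (fun s => f s + g s) = (Im \o f) + (Im \o g).
    by apply/funext => s /=; rewrite ImD.
  exact: is_deriveD.
Qed.

Lemma cderN f t l : cder f t l -> cder (fun s => - f s) t (- l).
Proof.
move=> [f1 f2]; split; rewrite ?ReN ?ImN.
- have -> : Re \o (fun s => - f s) = - (Re \o f).
    by apply/funext => s /=; rewrite ReN.
  exact: is_deriveN.
- have -> : Im \o (fun s => - f s) = - (Im \o f).
    by apply/funext => s /=; rewrite ImN.
  exact: is_deriveN.
Qed.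

Lemma cderB f g t l m : cder f t l -> cder g t m ->
  cder (fun s => f s - g s) t (l - m).
Proof. by move=> F G; apply: cderD => //; apply: cderN. Qed.

Lemma cderM f g t l m : cder f t l -> cder g t m ->
  cder (fun s => f s * g s) t (l * g t + f t * m).
Proof.
move=> [f1 f2] [g1 g2]; split.
- have -> : Re \o (fun s => f s * g s) =
      (Re \o f) * (Re \o g) - (Im \o f) * (Im \o g).
    by apply/funext => s /=; rewrite ReM.
  apply: (derive_eq _ (is_deriveB (is_deriveM f1 g1) (is_deriveM f2 g2))).
  by rewrite !ReD !ReM /= /GRing.scale/=; ring.
- have -> : Im \o (fun s => f s * g s) =
      (Re \o f) * (Im \o g) + (Im \o f) * (Re \o g).
    by apply/funext => s /=; rewrite ImM.
  apply: (derive_eq _ (is_deriveD (is_deriveM f1 g2) (is_deriveM f2 g1))).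
  by rewrite !ImD !ImM /= /GRing.scale/=; ring.
Qed.

Lemma cder_cst l t : cder (fun=> l) t 0.
Proof. by split; exact: is_derive_cst. Qed.

Lemma cder_sum (I : Type) (r : seq I) (F : I -> R -> R[i]) t (L : I -> R[i]) :
  (forall i, cder (F i) t (L i)) ->
  cder (fun s => \sum_(i <- r) F i s) t (\sum_(i <- r) L i).
Proof.
move=> H; elim: r => [|i r IH].
  apply: (@cder_ext (fun=> 0)); first by move=> s; rewrite big_nil.
  by rewrite big_nil; exact: cder_cst.
apply: (@cder_ext (fun s => F i s + \sum_(i <- r) F i s)).
  by move=> s; rewrite big_cons.
by rewrite big_cons; exact: cderD.
Qed.

Lemma cder_comp f (u : R -> R) t l (d : R) :
  cder f (u t) l -> is_derive t (1 : R) u d -> cder (f \o u) t (l * d%:C).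
Proof.
move=> [f1 f2] ud; split.
- by rewrite ReM/= mulr0 subr0; exact: is_derive1_comp f1 ud.
- by rewrite ImM/= mulr0 add0r; exact: is_derive1_comp f2 ud.
Qed.

Lemma cder_real (u : R -> R) t (d : R) : is_derive t (1 : R) u d ->
  cder (fun s => (u s)%:C) t d%:C.
Proof. by move=> H; split => //; exact: is_derive_cst. Qed.

Lemma cder_cis t : cder cis t ('i * cis t).
Proof.
split; rewrite ?ReM ?ImM/=.
- by apply: (derive_eq _ (is_derive_cos t)); ring.
- by apply: (derive_eq _ (is_derive_sin t)); ring.
Qed.

Lemma cder_cexp f t l : cder f t l ->
  cder (fun s => cexp (f s)) t (l * cexp (f t)).
Proof.
move=> [f1 f2].
have e := cder_real (is_derive1_comp (is_derive_expR (Re (f t))) f1).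
have c := @cder_comp cis (Im \o f) t _ _ (cder_cis _) f2.
apply: cder_eq (cderM e c); rewrite /cexp /=.
by apply: complexP; rewrite ?(ReD, ImD, ReM, ImM)/=; ring.
Qed.

Lemma derive_le (u v du dv : R -> R) (a b : R) : a <= b ->
  (forall s, a <= s <= b -> is_derive s (1 : R) u (du s)) ->
  (forall s, a <= s <= b -> is_derive s (1 : R) v (dv s)) ->
  (forall s, a <= s <= b -> du s <= dv s) -> u b - u a <= v b - v a.
Proof.
move=> ab ud vd uv.
have D s : a <= s <= b -> is_derive s (1 : R) (v - u) (dv s - du s).
  by move=> h; apply: is_deriveB; [exact: vd|exact: ud].
have [||c cab] := @MVT_segment R (v - u) (fun s => dv s - du s) a b ab.
- by move=> s /[!in_itv]/= /andP[s1 s2]; apply: D; rewrite !ltW.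
- apply: derivable_within_continuous => s; rewrite in_itv/= => h.
  by have [] := D s h.
rewrite in_itv/= in cab => E.
have : 0 <= (v b - u b) - (v a - u a).
  by rewrite [X in 0 <= X]E mulr_ge0 ?subr_ge0//; exact: uv.
lra.
Qed.

(* The factor 2 comes from treating real and imaginary parts separately. *)
Lemma cder_le f (df : R -> R[i]) (v dv : R -> R) (a b : R) : a <= b ->
  (forall s, a <= s <= b -> cder f s (df s)) ->
  (forall s, a <= s <= b -> is_derive s (1 : R) v (dv s)) ->
  (forall s, a <= s <= b -> normc (df s) <= dv s) ->
  normc (f b - f a) <= 2 * (v b - v a).
Proof.
move=> ab fd vd fv.
have H (pr : R[i] -> R) : (forall x, `|pr x| <= normc x) ->
    (forall s, a <= s <= b -> is_derive s (1 : R) (pr \o f) (pr (df s))) ->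
    `|pr (f b) - pr (f a)| <= v b - v a.
  move=> prn prd; rewrite ler_norml; apply/andP; split; last first.
    apply: (derive_le ab prd vd) => s sab.
    exact: le_trans (ler_norm _) (le_trans (prn _) (fv _ sab)).
  rewrite lerNl.
  suff : - pr (f b) - - pr (f a) <= v b - v a by lra.
  apply: (@derive_le (- (pr \o f)) v (fun s => - pr (df s)) dv a b ab) => //.
  - by move=> s sab; apply: is_deriveN; exact: prd.
  - move=> s sab; apply: le_trans (fv _ sab); apply: le_trans (prn _).
    by rewrite -normrN ler_norm.
apply: (le_trans (normc_le _)); rewrite ReD ImD ReN ImN mulrDl mul1r.
apply: lerD.
- by apply: (H Re normr_Re) => s sab; case: (fd s sab).
- by apply: (H Im normr_Im) => s sab; case: (fd s sab).
Qed.

Lemma cder_bound f (df : R -> R[i]) (M a b : R) : 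
  (forall s, Num.min a b <= s <= Num.max a b -> cder f s (df s)) ->
  (forall s, Num.min a b <= s <= Num.max a b -> normc (df s) <= M) ->
  normc (f b - f a) <= 2 * M * `|b - a|.
Proof.
wlog ab : a b / a <= b.
  move=> H fd fM; have [ab|ba] := leP a b; first exact: H.
  rewrite normcBC distrC; apply: (H b a (ltW ba)) => s.
  - by rewrite minC maxC; exact: fd.
  - by rewrite minC maxC; exact: fM.
rewrite (min_idPl ab) (max_idPr ab) => fd fM.
rewrite ger0_norm ?subr_ge0// -mulrA mulrBr.
apply: (@cder_le f df (fun s => M * s) (fun=> M)) => // s _.
have -> : (fun s => M * s) = M \*: (@id R) by [].
by apply: (is_derive_eq (is_deriveZ _ (is_derive_id _ _))); rewrite /GRing.scale/= mulr1.
Qed.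

End DerivativesAlongR.

(** * Antiderivatives of continuous functions on the whole line *)

Section Antiderivatives.
Context {R : realType}.

Lemma is_derive_integral (g : R -> R) (a x : R) : continuous g -> a < x ->
  is_derive x (1 : R) (fun y => \int[lebesgue_measure]_(t in `[a, y]) g t) (g x).
Proof.
move=> cg ax.
have ig : lebesgue_measure.-integrable `[a, x + 1] (EFin \o g).
  apply: continuous_compact_integrable; first exact: segment_compact.
  exact: continuous_subspaceT.
have xu : x < x + 1 by rewrite ltrDl.
have [dF F'] := continuous_FTC1_closed xu ig ax (cg x).
by rewrite -F' derive1E; exact: derivableP.
Qed.

(** An integral from [a] is an antiderivative only to the right of [a]. The base point therefore
    moves with [x], and subtracting the value at 0 makes the result independent of it. *)
Lemma antiderivative (g : R -> R) : continuous g ->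
  exists G : R -> R, forall x, is_derive x (1 : R) G (g x).
Proof.
move=> cg.
pose I (a x : R) : R := \int[lebesgue_measure]_(t in `[a, x]) g t.
have dI (a x : R) : a < x -> is_derive x (1 : R) (I a) (g x).
  exact: is_derive_integral.
have indep (a b x y : R) : a < x -> a < y -> b < x -> b < y ->
    I a x - I a y = I b x - I b y.
  wlog xy : x y / y <= x.
    move=> H ax ay bx yb; have [xy|/ltW yx] := leP y x; first exact: H.
    by have := H _ _ yx ay ax yb bx; lra.
  move=> ax ay bx yb; apply/le_anti/andP; split.
  - by apply: (derive_le xy) => s /andP[ys _]; [apply: dI|apply: dI|exact: lexx];
      apply: lt_le_trans ys.
  - by apply: (derive_le xy) => s /andP[ys _]; [apply: dI|apply: dI|exact: lexx];
      apply: lt_le_trans ys.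
(* The base point [- |x| - 1] lies to the left of both [x] and 0. Near [x] it can be replaced by the
   fixed point [A], which lies to the left of all the base points involved. *)
pose G (x : R) : R := I (- `|x| - 1) x - I (- `|x| - 1) 0.
exists G => x.
have N (y : R) : - `|y| - 1 < y /\ - `|y| - 1 < 0.
  by have := ler_norm (- y); rewrite normrN; have := normr_ge0 y; lra.
pose A := - `|x| - 2.
have D : is_derive x (1 : R) (fun y => I A y - I A 0) (g x).
  have -> : (fun y => I A y - I A 0) = I A - cst (I A 0) by [].
  rewrite -[g x]subr0; apply: is_deriveB; apply: dI.
  by rewrite /A; have := N x; lra.
apply: near_eq_is_derive D => //.
near=> y.
have yx : `|x - y| < 1 by near: y; apply: nbhsx_ballx.
have : `|y| <= `|x| + `|x - y|.
  by have := ler_normD x (y - x); rewrite subrKC distrC.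
move=> hy; apply: indep.
- by rewrite /A; have := N y; lra.
- by rewrite /A; have := normr_ge0 x; lra.
- by case: (N y).
- by case: (N y).
Unshelve. all: by end_near. Qed.

Implicit Types (f g : R -> R[i]) (s t : R).

Definition ccont g := forall t (e : R), 0 < e ->
  exists2 d : R, 0 < d & forall s, `|s - t| < d -> normc (g s - g t) <= e.

Lemma ccont_part (pr : R[i] -> R) g : (forall x, `|pr x| <= normc x) ->
  (forall x y, pr (x - y) = pr x - pr y) -> ccont g -> continuous (pr \o g).
Proof.
move=> prn prB cg t; apply/cvgrPdist_le => e e0.
have [d d0 H] := cg t e e0; near=> s.
rewrite /= -prB; apply: le_trans (prn _) _; rewrite normcBC; apply: H.
by rewrite distrC; near: s; exact: (@nbhsx_ballx _ _ t d d0).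
Unshelve. all: by end_near. Qed.

Lemma cantiderivative g : ccont g -> exists G, forall t, cder G t (g t).
Proof.
move=> cg.
have [|U HU] := @antiderivative (Re \o g).
  by apply: ccont_part cg; [exact: normr_Re|move=> x y; rewrite ReD ReN].
have [|V HV] := @antiderivative (Im \o g).
  by apply: ccont_part cg; [exact: normr_Im|move=> x y; rewrite ImD ImN].
by exists (fun t => U t +i* V t) => t; split; [exact: HU|exact: HV].
Qed.

(** A chosen antiderivative, with the zero function as default, so that [cint] is total; [cprimP]
    gives its meaning for continuous [g]. *)
Definition cprim g : R -> R[i] :=
  xget (fun=> 0) [set G | forall t, cder G t (g t)].

Lemma cprimP g : ccont g -> forall t, cder (cprim g) t (g t).
Proof.
move=> /cantiderivative[G HG].
exact: (@xgetPex _ (fun=> 0) [set G | forall t, cder G t (g t)] (ex_intro _ G HG)).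
Qed.

(** As a difference of values of one function, the integral is additive in its end points and
    changes sign with orientation by mere ring identities; [rint_split] relies on this. *)
Definition cint g (a b : R) := cprim g b - cprim g a.

Lemma cint_xx g a : cint g a a = 0. Proof. by rewrite /cint subrr. Qed.

End Antiderivatives.

(** * Continuity and complex differentiation of functions on the plane *)

Section PlaneContinuity.
Context {R : realType}.
Implicit Types (f g : R * R -> R[i]) (z : R * R) (l m : R[i]).

Definition near2 z (d : R) z' := `|z'.1 - z.1| < d /\ `|z'.2 - z.2| < d.

Definition dist1 z z' : R := `|z'.1 - z.1| + `|z'.2 - z.2|.

Lemma near2_le z d d' z' : d <= d' -> near2 z d z' -> near2 z d' z'.
Proof. by move=> dd' [h1 h2]; split; apply: lt_le_trans dd'. Qed.

Lemma near2_min z d d' z' : near2 z (Num.min d d') z' ->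
  near2 z d z' /\ near2 z d' z'.
Proof. by move=> h; split; apply: near2_le h; rewrite ge_min lexx ?orbT. Qed.

Lemma dist1_ge0 z z' : 0 <= dist1 z z'. Proof. exact: addr_ge0. Qed.

Definition cont2 f z := forall e : R, 0 < e ->
  exists2 d : R, 0 < d & forall z', near2 z d z' -> normc (f z' - f z) <= e.

Lemma cont2_bound f z : cont2 f z -> exists2 d : R, 0 < d &
  forall z', near2 z d z' -> normc (f z') <= normc (f z) + 1.
Proof.
move=> /(_ 1 ltr01)[d d0 H]; exists d => // z' /H h.
by rewrite -[f z'](subrK (f z)) addrC; apply: le_trans (normcD _ _) _; rewrite lerD2l.
Qed.

Lemma cont2_cst l z : cont2 (fun=> l) z.
Proof.
by move=> e e0; exists 1 => // z' _; rewrite subrr normc0 ltW.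
Qed.

Lemma cont2D f g z : cont2 f z -> cont2 g z -> cont2 (fun z => f z + g z) z.
Proof.
move=> cf cg e e0; have e2 : 0 < e / 2 by rewrite divr_gt0.
have [d d0 H] := cf _ e2; have [d' d0' H'] := cg _ e2.
exists (Num.min d d') => [|z' /near2_min[/H h /H' h']]; first by rewrite lt_min d0.
by rewrite opprD addrACA; apply: le_trans (normcD _ _) _; lra.
Qed.

Lemma cont2M f g z : cont2 f z -> cont2 g z -> cont2 (fun z => f z * g z) z.
Proof.
move=> cf cg e e0.
pose M := normc (f z) + normc (g z) + 1.
have M1 : 1 <= M by rewrite lerDr addr_ge0 ?normc_ge0.
have M0 : 0 < M by apply: lt_le_trans M1.
have e2 : 0 < e / (2 * M) by rewrite divr_gt0// mulr_gt0.
have [d d0 H] := cf _ e2; have [d' d0' H'] := cg _ e2.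
have [d3 d30 H3] := cont2_bound cg.
exists (Num.min d (Num.min d' d3)) => [|z']; first by rewrite !lt_min d0 d0'.
move=> /near2_min[/H h /near2_min[/H' h' /H3 h3]].
have -> : f z' * g z' - f z * g z = (f z' - f z) * g z' + f z * (g z' - g z).
  by ring.
apply: le_trans (normcD _ _) _; rewrite !normcM.
have -> : e = e / (2 * M) * M + M * (e / (2 * M)) by field; rewrite gt_eqF.
apply: lerD; apply: ler_pM => //; rewrite ?normc_ge0//.
- by apply: le_trans h3 _; rewrite /M; have := normc_ge0 (f z); lra.
- by rewrite /M; have := normc_ge0 (g z); lra.
Qed.

Lemma cont2_sum (I : Type) (r : seq I) (F : I -> R * R -> R[i]) z :
  (forall i, cont2 (F i) z) -> cont2 (fun z => \sum_(i <- r) F i z) z.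
Proof.
move=> H; elim: r => [|i r IH].
  rewrite (_ : (fun _ => _) = fun=> 0); first exact: cont2_cst.
  by apply/funext => z'; rewrite big_nil.
rewrite (_ : (fun _ => _) = fun z => F i z + \sum_(i <- r) F i z).
  exact: cont2D.
by apply/funext => z'; rewrite big_cons.
Qed.

Lemma cont2_slice1 f y : (forall z, cont2 f z) -> ccont (fun s => f (s, y)).
Proof.
move=> cf t e e0; have [d d0 H] := cf (t, y) e e0; exists d => // s st.
by apply: H; split => //=; rewrite subrr normr0.
Qed.

Lemma cont2_slice2 f x : (forall z, cont2 f z) -> ccont (fun s => f (x, s)).
Proof.
move=> cf t e e0; have [d d0 H] := cf (x, t) e e0; exists d => // s st.
by apply: H; split => //=; rewrite subrr normr0.
Qed.

End PlaneContinuity.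

Section PDiff.
Context {R : realType}.
Variable p : R * R -> R[i].
Implicit Types (f g : R * R -> R[i]) (z : R * R) (l m : R[i]).

(** Derivative with respect to the complex coordinate [p], written without division so that points
    with [p z' = p z] are no special case. For [p = proj] it is [is_zderive], entry by entry; see
    [is_zderiveP]. *)
Definition pd f z l := forall e : R, 0 < e -> exists2 d : R, 0 < d &
  forall z', near2 z d z' ->
    normc (f z' - f z - l * (p z' - p z)) <= e * normc (p z' - p z).

Lemma pd_cst l z : pd (fun=> l) z 0.
Proof.
move=> e e0; exists 1 => // z' _; rewrite subrr mul0r subr0 normc0.
by rewrite mulr_ge0 ?normc_ge0// ltW.
Qed.

Lemma pdD f g z l m : pd f z l -> pd g z m -> pd (fun z => f z + g z) z (l + m).
Proof.
move=> cf cg e e0; have e2 : 0 < e / 2 by rewrite divr_gt0.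
have [d d0 H] := cf _ e2; have [d' d0' H'] := cg _ e2.
exists (Num.min d d') => [|z' /near2_min[/H h /H' h']]; first by rewrite lt_min d0.
have -> : f z' + g z' - (f z + g z) - (l + m) * (p z' - p z) =
  (f z' - f z - l * (p z' - p z)) + (g z' - g z - m * (p z' - p z)) by ring.
by apply: le_trans (normcD _ _) _; lra.
Qed.

Lemma pd_eq f z l m : l = m -> pd f z l -> pd f z m.
Proof. by move=> ->. Qed.

Lemma pd_ext f g z l : f =1 g -> pd f z l -> pd g z l.
Proof. by move=> /funext ->. Qed.

Lemma pd_sum (I : Type) (r : seq I) (F : I -> R * R -> R[i]) z (L : I -> R[i]) :
  (forall i, pd (F i) z (L i)) ->
  pd (fun z => \sum_(i <- r) F i z) z (\sum_(i <- r) L i).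
Proof.
move=> H; elim: r => [|i r IH].
  apply: (@pd_ext (fun=> 0)); first by move=> s; rewrite big_nil.
  by rewrite big_nil; exact: pd_cst.
apply: (@pd_ext (fun z => F i z + \sum_(i <- r) F i z)).
  by move=> s; rewrite big_cons.
by rewrite big_cons; exact: pdD.
Qed.

Hypothesis p_cont : forall z, cont2 p z.

Lemma pd_cont2 f z l : pd f z l -> cont2 f z.
Proof.
move=> pf e e0.
pose M := normc l + 1.
have M0 : 0 < M by rewrite ltr_wpDl ?normc_ge0.
have eM : 0 < e / M by rewrite divr_gt0.
have [d d0 H] := pf 1 ltr01; have [d' d0' H'] := p_cont z eM.
exists (Num.min d d') => [|z' /near2_min[/H h /H' h']]; first by rewrite lt_min d0.
rewrite -[f z' - f z](subrK (l * (p z' - p z))).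
apply: le_trans (normcD _ _) _; rewrite normcM.
have -> : e = M * (e / M) by field; rewrite gt_eqF.
have h2 : M * normc (p z' - p z) <= M * (e / M) by rewrite ler_pM2l.
by apply: le_trans h2; rewrite /M mulrDl addrC lerD2l.
Qed.

Lemma pdM f g z l m : pd f z l -> pd g z m ->
  pd (fun z => f z * g z) z (l * g z + f z * m).
Proof.
move=> cf cg e e0.
pose M := normc (g z) + normc l + normc (f z) + 2.
have M2 : 2 <= M by rewrite lerDr !addr_ge0 ?normc_ge0.
have M0 : 0 < M by apply: lt_le_trans M2.
have e2 : 0 < e / (3 * M) by rewrite divr_gt0// mulr_gt0.
have [d d0 H] := cf _ e2; have [d' d0' H'] := cg _ e2.
have [d3 d30 H3] := cont2_bound (pd_cont2 cg).
have [d4 d40 H4] := pd_cont2 cg e2.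
exists (Num.min (Num.min d d') (Num.min d3 d4)) => [|z'].
  by rewrite !lt_min d0 d0' d30.
move=> /near2_min[/near2_min[/H h /H' h'] /near2_min[/H3 h3 /H4 h4]].
set D := p z' - p z in h h' *.
have -> : f z' * g z' - f z * g z - (l * g z + f z * m) * D =
  (f z' - f z - l * D) * g z' + l * (g z' - g z) * D
   + f z * (g z' - g z - m * D) by ring.
apply: le_trans (normcD _ _) _.
have -> : e * normc D = (e / (3 * M) * normc D) * M + M * (e / (3 * M)) * normc D
   + M * (e / (3 * M) * normc D) by field; rewrite gt_eqF.
have [f0 g0 l0] : [/\ 0 <= normc (f z), 0 <= normc (g z) & 0 <= normc l].
  by split; exact: normc_ge0.
apply: lerD; [apply: le_trans (normcD _ _) _; apply: lerD|]; rewrite !normcM.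
- by apply: ler_pM => //; rewrite ?normc_ge0// /M; apply: le_trans h3 _; lra.
- apply: ler_wpM2r; first exact: normc_ge0.
  by apply: ler_pM => //; rewrite ?normc_ge0// /M; lra.
- by apply: ler_pM => //; rewrite ?normc_ge0// /M; lra.
Qed.

End PDiff.

Lemma pd_comp {R : realType} (p : R * R -> R[i]) (k : R * R -> R * R)
    (f : R * R -> R[i]) z l :
  (forall e : R, 0 < e ->
     exists2 d : R, 0 < d & forall z', near2 z d z' -> near2 (k z) e (k z')) ->
  pd p f (k z) l -> pd (p \o k) (f \o k) z l.
Proof.
move=> ck pf e e0; have [d d0 H] := pf e e0; have [d' d0' H'] := ck d d0.
by exists d' => // z' /H'/H.
Qed.

Lemma nested_segments {R : realType} (a b : nat -> R) :
  (forall n, a n <= a n.+1) -> (forall n, b n.+1 <= b n) ->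
  (forall n, a n <= b n) -> exists x, forall n, a n <= x <= b n.
Proof.
move=> a1 b1 ab.
have ha m k : a m <= a (m + k)%N.
  by elim: k => [|k IH]; rewrite ?addn0// addnS (le_trans IH).
have hb m k : b (m + k)%N <= b m.
  by elim: k => [|k IH]; rewrite ?addn0// addnS (le_trans _ IH).
have hab m n : a m <= b n.
  by apply: le_trans (ha m n) _; apply: le_trans (ab _) _; rewrite addnC.
exists (sup (range a)) => n; apply/andP; split.
  apply: ub_le_sup; last by exists n.
  by exists (b n) => _ [m _ <-].
by apply: ge_sup; [exists (a 0), 0|move=> _ [m _ <-]].
Qed.

(** * Goursat's theorem *)

Section Goursat.
Context {R : realType}.
Variables p p1 p2 : R * R -> R[i].
Hypothesis p_d1 : forall x y, cder (fun s => p (s, y)) x (p1 (x, y)).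
Hypothesis p_d2 : forall x y, cder (fun s => p (x, s)) y (p2 (x, y)).
Hypothesis p1_cont : forall z, cont2 p1 z.
Hypothesis p2_cont : forall z, cont2 p2 z.
Hypothesis p_low : forall z, exists c d : R, [/\ 0 < c, 0 < d &
  forall z', near2 z d z' -> c * dist1 z z' <= normc (p z' - p z)].
Implicit Types (f g F : R * R -> R[i]) (z : R * R) (l m : R[i]).

Lemma near2_seg1 z (d x y s : R) : near2 z d (x, y) ->
  Num.min z.1 x <= s <= Num.max z.1 x -> near2 z d (s, y).
Proof.
move=> [/= h1 h2] /andP[s1 s2]; split => //=; apply: le_lt_trans h1.
move: s1 s2; have [zx|xz] := leP z.1 x => s1 s2.
  by rewrite !ger0_norm ?subr_ge0// lerD2r.
by rewrite distrC [leRHS]distrC !ger0_norm ?subr_ge0 ?(ltW xz)// lerD2l lerN2.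
Qed.

Lemma near2_seg2 z (d x y s : R) : near2 z d (x, y) ->
  Num.min z.2 y <= s <= Num.max z.2 y -> near2 z d (x, s).
Proof.
move=> [/= h1 h2]; have := @near2_seg1 (z.2, z.1) d y x s (conj h2 h1).
by move=> H /H[].
Qed.

(* The path from [z] to [z'] first moves the first coordinate, then the second. *)
Lemma path_le F (u1 u2 : R * R -> R[i]) z (d M : R) z' :
  (forall x y, cder (fun s => F (s, y)) x (u1 (x, y))) ->
  (forall x y, cder (fun s => F (x, s)) y (u2 (x, y))) ->
  (forall w, near2 z d w -> normc (u1 w) <= M /\ normc (u2 w) <= M) ->
  near2 z d z' -> normc (F z' - F z) <= 2 * M * dist1 z z'.
Proof.
case: z => x0 y0; case: z' => x y F1 F2 uM h.
have h0 : near2 (x0, y0) d (x, y0).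
  by case: h => h1 h2; split => //=; rewrite subrr normr0; apply: le_lt_trans h2.
have -> : F (x, y) - F (x0, y0) = (F (x, y0) - F (x0, y0)) + (F (x, y) - F (x, y0)).
  by ring.
rewrite /dist1 /= mulrDr; apply: le_trans (normcD _ _) _; apply: lerD.
- apply: (@cder_bound R (fun s => F (s, y0)) (fun s => u1 (s, y0))) => s hs.
    exact: F1.
  by have [] := uM _ (near2_seg1 h0 hs).
- apply: (@cder_bound R (fun s => F (x, s)) (fun s => u2 (x, s))) => s hs.
    exact: F2.
  by have [] := uM _ (near2_seg2 h hs).
Qed.

Lemma p_lip z : exists C d : R, [/\ 0 < C, 0 < d,
  forall z', near2 z d z' -> normc (p z' - p z) <= C * dist1 z z' &
  forall z', near2 z d z' -> normc (p1 z') <= C /\ normc (p2 z') <= C].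
Proof.
have [d d0 H] := cont2_bound (p1_cont z).
have [d' d0' H'] := cont2_bound (p2_cont z).
pose M := normc (p1 z) + normc (p2 z) + 1.
have [n1 n2] : 0 <= normc (p1 z) /\ 0 <= normc (p2 z) by split; exact: normc_ge0.
have B z' : near2 z (Num.min d d') z' -> normc (p1 z') <= M /\ normc (p2 z') <= M.
  by move=> /near2_min[/H h /H' h']; rewrite /M; split; lra.
exists (2 * M), (Num.min d d'); split; rewrite ?lt_min ?d0//.
- by rewrite /M; lra.
- by move=> z'; apply: path_le.
- by move=> z' /B[b1 b2]; split; apply: le_trans (_ : _ <= M) _ => //; rewrite /M; lra.
Qed.

Lemma p_cont z : cont2 p z.
Proof.
have [C [d [C0 d0 H _]]] := p_lip z => e e0.
have eC : 0 < e / (2 * C) by rewrite divr_gt0// mulr_gt0.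
exists (Num.min d (e / (2 * C))) => [|z']; first by rewrite lt_min d0.
move=> /near2_min[/H h [h1 h2]]; apply: le_trans h _.
have -> : e = C * (e / (2 * C) + e / (2 * C)) by field; rewrite gt_eqF.
by rewrite ler_pM2l// /dist1 lerD// ltW.
Qed.

(** The two hypotheses are the Cauchy-Riemann equations in the coordinate [p]. The function
    [F - f z * p] has partial derivatives [(f - f z) * p1] and [(f - f z) * p2], small near [z], so
    its increment is small against [dist1]; the lower bound [p_low] converts [dist1] into the
    increment of [p]. *)
Lemma pd_partials F f z :
  (forall x y, cder (fun s => F (s, y)) x (f (x, y) * p1 (x, y))) ->
  (forall x y, cder (fun s => F (x, s)) y (f (x, y) * p2 (x, y))) ->
  cont2 f z -> pd p F z (f z).
Proof.
move=> F1 F2 cf e e0.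
have [c [d [c0 d0 low]]] := p_low z.
have [C [d' [C0 d0' _ B]]] := p_lip z.
have e1 : 0 < e * c / (2 * C) by rewrite divr_gt0 ?mulr_gt0.
have [d3 d30 H] := cf _ e1.
exists (Num.min d (Num.min d' d3)); first by rewrite !lt_min d0 d0'.
move=> z' hz; have [/low hlow hz'] := near2_min hz.
pose G w := F w - f z * p w.
have -> : F z' - F z - f z * (p z' - p z) = G z' - G z by rewrite /G; ring.
apply: (@le_trans _ _ (2 * (e * c / 2) * dist1 z z')); last first.
  rewrite (_ : _ * dist1 z z' = e * (c * dist1 z z')); last by field.
  by rewrite ler_pM2l.
apply: (@path_le G (fun w => (f w - f z) * p1 w) (fun w => (f w - f z) * p2 w)
  _ _ _ _ _ _ _ hz') => [x y|x y|w].
- by apply: cder_eq (cderB (F1 x y) (cderM (cder_cst _ _) (p_d1 x y))); ring.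
- by apply: cder_eq (cderB (F2 x y) (cderM (cder_cst _ _) (p_d2 x y))); ring.
- move=> /near2_min[/B[b1 b2] /H h].
  have -> : e * c / 2 = e * c / (2 * C) * C by field; rewrite gt_eqF.
  by split; rewrite normcM; apply: ler_pM => //; exact: normc_ge0.
Qed.

(** The form [f dp] integrated over a horizontal side; [vint] does the same for a vertical side, and
    [rint] for the boundary of the rectangle [[a, b] x [c, d]]. *)
Definition hint f y a b := cint (fun s => f (s, y) * p1 (s, y)) a b.
Definition vint f x a b := cint (fun s => f (x, s) * p2 (x, s)) a b.

Definition rint f a b c d :=
  hint f c a b + vint f b c d - hint f d a b - vint f a c d.

Lemma hint_cder f y a t : (forall z, cont2 f z) ->
  cder (hint f y a) t (f (t, y) * p1 (t, y)).
Proof.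
move=> cf; have cc := @cont2_slice1 _ (fun z => f z * p1 z) y
  (fun z => cont2M (cf z) (p1_cont z)).
by apply: cder_eq (cderB (cprimP cc t) (cder_cst _ _)); rewrite subr0.
Qed.

Lemma vint_cder f x a t : (forall z, cont2 f z) ->
  cder (vint f x a) t (f (x, t) * p2 (x, t)).
Proof.
move=> cf; have cc := @cont2_slice2 _ (fun z => f z * p2 z) x
  (fun z => cont2M (cf z) (p2_cont z)).
by apply: cder_eq (cderB (cprimP cc t) (cder_cst _ _)); rewrite subr0.
Qed.

Lemma rint_split f (a b c d m n : R) :
  rint f a b c d = rint f a m c n + rint f m b c n
                 + rint f a m n d + rint f m b n d.
Proof. by rewrite /rint /hint /vint /cint; ring. Qed.

(** Near [z] the form [f dp] is [(f z + l * (p - p z)) dp] up to a small error. The main part is the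
    differential of [Phi] and contributes nothing around a closed path. Each side leaves an error of
    at most [2 * (e / 4 * S)] times its length, and the four lengths add up to [2 * S]. *)
Lemma rint_local f z l (e : R) : (forall z, cont2 f z) -> pd p f z l -> 0 < e ->
  exists2 d : R, 0 < d & forall x x' y y',
    x <= z.1 <= x' -> y <= z.2 <= y' -> x' - x < d -> y' - y < d ->
    normc (rint f x x' y y') <= e * (x' - x + (y' - y)) ^+ 2.
Proof.
move=> cf pf e0.
have [C [d [C0 d0 lip B]]] := p_lip z.
(* One factor [C] pays for [|p w - p z| <= C * S], the other for the bound on [p1] and [p2]. *)
have e1 : 0 < e / (4 * C ^+ 2) by rewrite divr_gt0// mulr_gt0// exprn_gt0.
have [d' d0' H] := pf _ e1.
exists (Num.min d d'); first by rewrite lt_min d0.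
move=> x x' y y' /andP[x1 x2] /andP[y1 y2] hx hy.
set S := x' - x + (y' - y).
have S0 : 0 <= S by rewrite /S; lra.
pose Phi w := f z * p w + l * (p w - p z) ^+ 2 / 2.
have E w : x <= w.1 <= x' -> y <= w.2 <= y' ->
    normc (f w - f z - l * (p w - p z)) * C <= e / 4 * S.
  move=> /andP[w1 w2] /andP[w3 w4].
  have hw : near2 z (Num.min d d') w.
    split; [apply: le_lt_trans hx|apply: le_lt_trans hy]; 
      by rewrite ler_norml; apply/andP; split; lra.
  have [n1 n2] := near2_min hw.
  have dS : dist1 z w <= S.
    by apply: lerD; rewrite ler_norml; apply/andP; split; lra.
  have h2 : normc (p w - p z) <= C * S.
    by apply: le_trans (lip _ n1) _; rewrite ler_pM2l.
  have -> : e / 4 * S = (e / (4 * C ^+ 2) * (C * S)) * C by field; rewrite gt_eqF.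
  rewrite ler_pM2r//; apply: le_trans (H _ n2) _.
  by rewrite ler_pM2l.
have Bn w : x <= w.1 <= x' -> y <= w.2 <= y' ->
    normc (p1 w) <= C /\ normc (p2 w) <= C.
  move=> /andP[w1 w2] /andP[w3 w4]; apply: B; have [h1 h2] : x' - x < d /\ y' - y < d.
    by move: hx hy; rewrite !lt_min => /andP[-> _] /andP[-> _].
  split; [apply: le_lt_trans h1|apply: le_lt_trans h2];
    by rewrite ler_norml; apply/andP; split; lra.
have xx : x <= x' by lra.
have yy : y <= y' by lra.
have HE t : y <= t <= y' ->
    normc (hint f t x x' - (Phi (x', t) - Phi (x, t))) <= 2 * (e / 4 * S) * (x' - x).
  move=> ht.
  have -> : hint f t x x' - (Phi (x', t) - Phi (x, t)) =
      (hint f t x x' - Phi (x', t)) - (hint f t x x - Phi (x, t)).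
    by rewrite /hint cint_xx; ring.
  rewrite -[X in _ * X]ger0_norm ?subr_ge0//.
  apply: (@cder_bound R (fun s => hint f t x s - Phi (s, t))
    (fun s => (f (s, t) - f z - l * (p (s, t) - p z)) * p1 (s, t))) => s.
    move=> _; have D := p_d1 s t.
    have D' := cderB D (cder_cst (p z) s).
    apply: cder_eq (cderB (hint_cder _ _ _ cf) (cderD (cderM (cder_cst (f z) s) D)
      (cderM (cderM (cder_cst l s) (cderM D' D')) (cder_cst (2^-1) s)))).
    by field.
  rewrite (min_idPl xx) (max_idPr xx) => hs.
  apply: le_trans (E (s, t) hs ht); rewrite normcM.
  by apply: ler_wpM2l; rewrite ?normc_ge0//; case: (Bn (s, t) hs ht).
have VE t : x <= t <= x' ->
    normc (vint f t y y' - (Phi (t, y') - Phi (t, y))) <= 2 * (e / 4 * S) * (y' - y).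
  move=> ht.
  have -> : vint f t y y' - (Phi (t, y') - Phi (t, y)) =
      (vint f t y y' - Phi (t, y')) - (vint f t y y - Phi (t, y)).
    by rewrite /vint cint_xx; ring.
  rewrite -[X in _ * X]ger0_norm ?subr_ge0//.
  apply: (@cder_bound R (fun s => vint f t y s - Phi (t, s))
    (fun s => (f (t, s) - f z - l * (p (t, s) - p z)) * p2 (t, s))) => s.
    move=> _; have D := p_d2 t s.
    have D' := cderB D (cder_cst (p z) s).
    apply: cder_eq (cderB (vint_cder _ _ _ cf) (cderD (cderM (cder_cst (f z) s) D)
      (cderM (cderM (cder_cst l s) (cderM D' D')) (cder_cst (2^-1) s)))).
    by field.
  rewrite (min_idPl yy) (max_idPr yy) => hs.
  apply: le_trans (E (t, s) ht hs); rewrite normcM.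
  by apply: ler_wpM2l; rewrite ?normc_ge0//; case: (Bn (t, s) ht hs).
have := HE y; have := HE y'; have := VE x; have := VE x'.
set h1 := hint f y x x'; set h2 := hint f y' x x'.
set v1 := vint f x y y'; set v2 := vint f x' y y'.
rewrite !lexx xx yy => /(_ isT) b1 /(_ isT) b2 /(_ isT) b3 /(_ isT) b4.
have -> : rint f x x' y y' =
  (h1 - (Phi (x', y) - Phi (x, y))) + (v2 - (Phi (x', y') - Phi (x', y)))
  - (h2 - (Phi (x', y') - Phi (x, y'))) - (v1 - (Phi (x, y') - Phi (x, y))).
  by rewrite /rint -/h1 -/h2 -/v1 -/v2; ring.
apply: le_trans (normcB _ _) _; apply: le_trans (lerD (normcB _ _) (lexx _)) _.
apply: le_trans (lerD (lerD (normcD _ _) (lexx _)) (lexx _)) _.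
apply: le_trans (lerD (lerD (lerD b4 b1) b3) b2) _.
rewrite (_ : _ + _ = e * S ^+ 2)//.
by rewrite /S; field.
Qed.

(** Goursat's bisection: rectangles halved in both directions shrink to a point, each carrying at
    least a quarter of the previous integral in modulus. At the limit point [rint_local] gains a
    factor [4 ^- n], which cancels the loss [4 ^+ n]. *)
Lemma goursat f x x' y y' : (forall z, exists l, pd p f z l) ->
  x <= x' -> y <= y' -> rint f x x' y y' = 0.
Proof.
move=> pf xx yy.
have cf z : cont2 f z by have [l /(pd_cont2 p_cont)] := pf z.
pose q : Type := ((R * R) * (R * R))%type.
pose G (r : q) := normc (rint f r.1.1 r.1.2 r.2.1 r.2.2).
pose lft (r : R * R) := (r.1, (r.1 + r.2) / 2).
pose rgt (r : R * R) := ((r.1 + r.2) / 2, r.2).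
(* The last quarter is the default: if each of the other three carries less than a quarter of the
   integral, the last one carries more. *)
pose step (r : q) : q :=
  if G r <= 4 * G (lft r.1, lft r.2) then (lft r.1, lft r.2) else
  if G r <= 4 * G (rgt r.1, lft r.2) then (rgt r.1, lft r.2) else
  if G r <= 4 * G (lft r.1, rgt r.2) then (lft r.1, rgt r.2) else
  (rgt r.1, rgt r.2).
have stepG r : G r <= 4 * G (step r).
  rewrite /step; case: ifPn => // n1; case: ifPn => // n2; case: ifPn => // n3.
  move: n1 n2 n3; rewrite -!ltNge => n1 n2 n3.
  have : G r <= G (lft r.1, lft r.2) + G (rgt r.1, lft r.2)
      + G (lft r.1, rgt r.2) + G (rgt r.1, rgt r.2).
    rewrite {1}/G (rint_split _ _ _ _ _ ((r.1.1 + r.1.2) / 2) ((r.2.1 + r.2.2) / 2)).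
    do 3 (apply: le_trans (normcD _ _) _; apply: lerD => //).
  by lra.
pose Q n := iter n step ((x, x'), (y, y')).
have QS n : Q n.+1 = step (Q n) by [].
have stepc r : ((step r).1 = lft r.1 \/ (step r).1 = rgt r.1) /\
               ((step r).2 = lft r.2 \/ (step r).2 = rgt r.2).
  by rewrite /step; case: ifP => _; [|case: ifP => _; [|case: ifP => _]] => /=; auto.
have ord n : (Q n).1.1 <= (Q n).1.2 /\ (Q n).2.1 <= (Q n).2.2.
  elim: n => [//|n [h1 h2]]; rewrite QS; have [] := stepc (Q n).
  by move=> [->|->] [->|->]; rewrite /lft /rgt/=; split; lra.
have len n : (Q n).1.2 - (Q n).1.1 = (x' - x) / 2 ^+ n /\
             (Q n).2.2 - (Q n).2.1 = (y' - y) / 2 ^+ n.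
  elim: n => [|n [h1 h2]]; first by rewrite expr0 !divr1.
  have e t : t / 2 ^+ n.+1 = t / 2 ^+ n / 2 :> R.
    by rewrite exprS invfM mulrA mulrAC.
  rewrite !e -h1 -h2 QS; have [] := stepc (Q n).
  by move=> [->|->] [->|->]; rewrite /lft /rgt/=; split; field.
have [X HX] : exists X : R, forall n, (Q n).1.1 <= X <= (Q n).1.2.
  apply: nested_segments => n; last by case: (ord n).
  - by have [oo _] := ord n; rewrite QS; have [[e|e] _] := stepc (Q n); rewrite e /=; lra.
  - by have [oo _] := ord n; rewrite QS; have [[e|e] _] := stepc (Q n); rewrite e /=; lra.
have [Y HY] : exists Y : R, forall n, (Q n).2.1 <= Y <= (Q n).2.2.
  apply: nested_segments => n; last by case: (ord n).
  - by have [_ oo] := ord n; rewrite QS; have [_ [e|e]] := stepc (Q n); rewrite e /=; lra.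
  - by have [_ oo] := ord n; rewrite QS; have [_ [e|e]] := stepc (Q n); rewrite e /=; lra.
have QG (n : nat) : G (Q 0%N) <= 4 ^+ n * G (Q n).
  elim: n => [|n IH]; first by rewrite expr0 mul1r.
  apply: le_trans IH _; rewrite exprSr -mulrA ler_pM2l ?exprn_gt0//.
have [l pl] := pf (X, Y).
suff : normc (rint f x x' y y') <= 0.
  by rewrite le_eqVlt ltNge normc_ge0 orbF normc_eq0 => /eqP.
set S := x' - x + (y' - y).
have S0 : 0 <= S by rewrite /S; lra.
apply/ler_addgt0Pr => e e0; rewrite add0r.
(* The summand 1 covers degenerate rectangles, where [S] may be 0. *)
have e1 : 0 < e / (S ^+ 2 + 1) by rewrite divr_gt0// ltr_wpDl// sqr_ge0.
have [d d0 H] := rint_local cf pl e1.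
have [n Hn] : exists n, S / 2 ^+ n < d.
  have [n hn] : exists n : nat, S / d < n%:R.
    by exists (Num.bound (S / d)); apply: archi_boundP; rewrite divr_ge0// ltW.
  exists n; rewrite ltr_pdivrMr ?exprn_gt0// mulrC -ltr_pdivrMr//.
  apply: lt_trans hn _; rewrite -natrX ltr_nat.
  exact: ltn_expl.
have lt1 t : 0 <= t -> t <= S -> t / 2 ^+ n < d.
  move=> t0 tS; apply: le_lt_trans Hn.
  by rewrite ler_wpM2r// invr_ge0 exprn_ge0.
have [l1 l2] := len n.
have := QG n; rewrite {1}/G /= => hG; apply: le_trans hG _.
have := H _ _ _ _ (HX n) (HY n).
rewrite l1 l2 => /(_ _ _)/le_trans hh.
apply: (@le_trans _ _ (4 ^+ n * (e / (S ^+ 2 + 1)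
    * ((x' - x) / 2 ^+ n + (y' - y) / 2 ^+ n) ^+ 2))).
  rewrite ler_pM2l ?exprn_gt0//; apply: hh => //; apply: lt1; rewrite /S; lra.
have -> : 4 ^+ n = (2 ^+ n) ^+ 2 :> R.
  by rewrite -exprM mulnC exprM; congr (_ ^+ n); ring.
have -> : (2 ^+ n) ^+ 2 * (e / (S ^+ 2 + 1) *
    ((x' - x) / 2 ^+ n + (y' - y) / 2 ^+ n) ^+ 2) = e * (S ^+ 2 / (S ^+ 2 + 1)).
  have u0 : S ^+ 2 + 1 != 0 by rewrite gt_eqF// ltr_wpDl ?sqr_ge0.
  have t0 : 2 ^+ n != 0 :> R by rewrite expf_neq0.
  rewrite -mulrDl -/S; move: (2 ^+ n) t0 => t t0; clearbody S.
  by field; rewrite t0 u0.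
rewrite ler_piMr ?(ltW e0)// ler_pdivrMr ?ltr_wpDl ?sqr_ge0// mul1r lerDl.
exact: ler01.
Qed.

Lemma rint_eq0 f x x' y y' : (forall z, exists l, pd p f z l) ->
  rint f x x' y y' = 0.
Proof.
move=> pf; have H a b c d : a <= b -> c <= d -> rint f a b c d = 0 by exact: goursat.
have S a b c d : rint f a b c d = - rint f b a c d.
  by rewrite /rint /hint /vint /cint; ring.
have T a b c d : rint f a b c d = - rint f a b d c.
  by rewrite /rint /hint /vint /cint; ring.
have [xx|/ltW xx] := leP x x'; have [yy|/ltW yy] := leP y y'.
- exact: H.
- by rewrite T H// oppr0.
- by rewrite S H// oppr0.
- by rewrite S T H// !oppr0.
Qed.

Definition primitive f z0 z := hint f z0.2 z0.1 z.1 + vint f z.1 z0.2 z.2.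

Lemma primitiveE f z0 z : (forall z, exists l, pd p f z l) ->
  primitive f z0 z = vint f z0.1 z0.2 z.2 + hint f z.2 z0.1 z.1.
Proof.
move=> pf; apply/eqP; rewrite -subr_eq0; apply/eqP.
rewrite -(rint_eq0 z0.1 z.1 z0.2 z.2 pf) /primitive /rint; ring.
Qed.

(** Each formula ends with a move in one coordinate, so it gives the partial derivative in that
    coordinate. Only continuity of [f] is assumed: for the limit in [picard] nothing more is known
    of the integrand at that stage. *)
Lemma pd_two_paths F f z0 l : (forall z, cont2 f z) ->
  (forall z, F z = l + (hint f z0.2 z0.1 z.1 + vint f z.1 z0.2 z.2)) ->
  (forall z, F z = l + (vint f z0.1 z0.2 z.2 + hint f z.2 z0.1 z.1)) ->
  forall z, pd p F z (f z).
Proof.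
move=> cf F1 F2 z; apply: pd_partials => // x y.
- apply: (@cder_ext _ (fun s => l + (vint f z0.1 z0.2 y + hint f y z0.1 s))).
    by move=> s; rewrite F2.
  apply: cder_eq (cderD (cder_cst _ _) (cderD (cder_cst _ _) (hint_cder _ _ _ cf))).
  by rewrite !add0r.
- apply: (@cder_ext _ (fun s => l + (hint f z0.2 z0.1 x + vint f x z0.2 s))).
    by move=> s; rewrite F1.
  apply: cder_eq (cderD (cder_cst _ _) (cderD (cder_cst _ _) (vint_cder _ _ _ cf))).
  by rewrite !add0r.
Qed.

Lemma pd_primitive f z0 : (forall z, exists l, pd p f z l) ->
  forall z, pd p (primitive f z0) z (f z).
Proof.
move=> pf; apply: (@pd_two_paths _ _ z0 0) => z.
- by have [l /(pd_cont2 p_cont)] := pf z.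
- by rewrite add0r.
- by rewrite add0r primitiveE.
Qed.

End Goursat.

(** * Linear equations *)

Section GeometricSeries.
Context {R : realType}.

Lemma le_geometric0 (x C : R) : (forall M, x <= C / 2 ^+ M) -> x <= 0.
Proof.
move=> H; rewrite leNgt; apply/negP => x0.
have C0 : 0 < C by have := H 0%N; rewrite expr0 divr1; apply: lt_le_trans.
have hn := archi_boundP (ltW (divr_gt0 C0 x0)).
set n := Num.bound _ in hn.
have := H n; rewrite leNgt => /negP; apply.
rewrite ltr_pdivrMr ?exprn_gt0// mulrC -ltr_pdivrMr//.
by apply: lt_trans hn _; rewrite -natrX ltr_nat ltn_expl.
Qed.

Lemma real_geometric_series (u : nat -> R) (K : R) :
  (forall k, `|u k| <= K / 2 ^+ k) ->
  exists x, forall N, `|x - \sum_(k < N) u k| <= 2 * (K / 2 ^+ N).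
Proof.
move=> uK; pose S N := \sum_(k < N) u k.
have SS N : S N.+1 = S N + u N by rewrite /S big_ord_recr.
have hK N : K / 2 ^+ N.+1 = K / 2 ^+ N / 2.
  by rewrite exprSr invfM mulrA.
have [x Hx] : exists x, forall N, S N - 2 * (K / 2 ^+ N) <= x <= S N + 2 * (K / 2 ^+ N).
  apply: nested_segments => N.
  - by rewrite SS hK; have := uK N; rewrite ler_norml => /andP[]; lra.
  - by rewrite SS hK; have := uK N; rewrite ler_norml => /andP[]; lra.
  - by have := uK N; have := normr_ge0 (u N); lra.
by exists x => N; rewrite ler_norml -/(S N); have /andP[] := Hx N; lra.
Qed.

Lemma geometric_series (u : nat -> R[i]) (K : R) :
  (forall k, normc (u k) <= K / 2 ^+ k) ->
  exists l, forall N, normc (l - \sum_(k < N) u k) <= 4 * K / 2 ^+ N.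
Proof.
move=> uK.
have [x Hx] := @real_geometric_series (fun k => Re (u k)) K
  (fun k => le_trans (normr_Re _) (uK k)).
have [y Hy] := @real_geometric_series (fun k => Im (u k)) K
  (fun k => le_trans (normr_Im _) (uK k)).
exists (x +i* y) => N; apply: le_trans (normc_le _) _.
rewrite ReD ImD ReN ImN Re_sum (big_morph _ (@ImD R) (erefl : Im 0 = 0)) /=.
by have := Hx N; have := Hy N; rewrite -[4 * K / _]mulrA; lra.
Qed.

Lemma geometric_series_unique (S : nat -> R[i]) (l l' : R[i]) (K K' : R) :
  (forall N, normc (l - S N) <= K / 2 ^+ N) ->
  (forall N, normc (l' - S N) <= K' / 2 ^+ N) -> l = l'.
Proof.
move=> H H'; apply/eqP; rewrite -subr_eq0 -normc_eq0; apply/eqP/le_anti.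
rewrite normc_ge0 andbT; apply: (@le_geometric0 _ (K + K')) => N.
rewrite -(subrKA (S N)) mulrDl; apply: le_trans (normcD _ _) _.
by apply: lerD => //; rewrite normcBC.
Qed.

End GeometricSeries.

Section PlaneBounds.
Context {R : realType}.

Definition box (z0 : R * R) (D : R) (z : R * R) :=
  `|z.1 - z0.1| <= D /\ `|z.2 - z0.2| <= D.

Lemma cont2_box_bound (f : R * R -> R[i]) (z0 : R * R) (D : R) :
  (forall z, cont2 f z) -> exists2 M : R, 0 <= M &
    forall z, box z0 D z -> normc (f z) <= M.
Proof.
move=> cf; pose g z := normc (f z).
have cg : continuous (g : R * R -> R).
  move=> z; apply/cvgrPdist_le => e e0.
  have [d d0 H] := cf z e e0.
  have nb : \forall z' \near z, ball z d z' by exact: (@nbhsx_ballx _ _ z d d0).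
  apply: filterS nb => z' [b1 b2].
  have /H h : near2 z d z' by split; rewrite distrC.
  rewrite /g ler_norml lerBrDr lerBlDr; apply/andP; split.
  - rewrite addrC lerBlDr -[f z'](subrK (f z)); apply: le_trans (normcD _ _) _.
    by rewrite addrC lerD2l.
  - rewrite -[f z](subrK (f z')); apply: le_trans (normcD _ _) _.
    by rewrite lerD2r normcBC.
have cB : compact (`[z0.1 - D, z0.1 + D]%classic `*` `[z0.2 - D, z0.2 + D]%classic).
  by apply: compact_setX; exact: segment_compact.
have /compact_bounded[M [_ HM]] :=
  continuous_compact (continuous_subspaceT cg) cB.
exists (`|M| + 1) => [|z [h1 h2]]; first by rewrite addr_ge0.
apply: le_trans (ler_norm _) _; apply: (HM (`|M| + 1)).
  by apply: le_lt_trans (ler_norm M) _; rewrite ltrDl.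
exists z => //; split; rewrite /= in_itv/=.
- by move: h1; rewrite ler_norml => /andP[]; lra.
- by move: h2; rewrite ler_norml => /andP[]; lra.
Qed.

Lemma box_seg1 (z0 z : R * R) (D s : R) : box z0 D z ->
  Num.min z0.1 z.1 <= s <= Num.max z0.1 z.1 -> box z0 D (s, z.2).
Proof.
move=> [/= h1 h2] /andP[s1 s2]; split => //=; apply: le_trans h1.
move: s1 s2; have [zx|xz] := leP z0.1 z.1 => s1 s2.
  by rewrite !ger0_norm ?subr_ge0// lerD2r.
by rewrite distrC [leRHS]distrC !ger0_norm ?subr_ge0 ?(ltW xz)// lerD2l lerN2.
Qed.

Lemma box_seg2 (z0 z : R * R) (D s : R) : box z0 D z ->
  Num.min z0.2 z.2 <= s <= Num.max z0.2 z.2 -> box z0 D (z.1, s).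
Proof.
move=> [/= h1 h2]; have := @box_seg1 (z0.2, z0.1) (z.2, z.1) D s (conj h2 h1).
by move=> H /H[].
Qed.

Lemma box_corner (z0 z : R * R) (D : R) : box z0 D z ->
  box z0 D (z.1, z0.2) /\ box z0 D (z0.1, z.2).
Proof.
by move=> [h1 h2]; split; split; rewrite //= subrr normr0; apply: le_trans h1.
Qed.

(** [w] stands for the length of the side already travelled. With this shift the bounds for the two
    sides of a path telescope in [picard_term_le]. *)
Lemma exp_edge_le (h dh : R -> R[i]) (a b K L w : R) : 0 < L ->
  (forall s, Num.min a b <= s <= Num.max a b -> cder h s (dh s)) ->
  (forall s, Num.min a b <= s <= Num.max a b ->
     normc (dh s) <= K * expR (L * (`|s - a| + w))) ->
  normc (h b - h a) <=
    2 * (K / L) * (expR (L * (`|b - a| + w)) - expR (L * w)).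
Proof.
move=> L0.
have main (f df : R -> R[i]) (c : R) : 0 <= c ->
    (forall s, 0 <= s <= c -> cder f s (df s)) ->
    (forall s, 0 <= s <= c -> normc (df s) <= K * expR (L * (s + w))) ->
    normc (f c - f 0) <= 2 * (K / L) * (expR (L * (c + w)) - expR (L * w)).
  move=> c0 fd fK; rewrite -mulrA mulrBr -[in L * w](add0r w).
  apply: (@cder_le _ f df (fun s => K / L * expR (L * (s + w))) _ _ _ c0 fd _ fK).
  move=> s _.
  have d1 : is_derive s (1 : R) (fun s => L * (s + w)) L.
    have -> : (fun s => L * (s + w)) = L \*: ((@id R) + cst w) by [].
    apply: (derive_eq _ (is_deriveZ _ (is_deriveD (is_derive_id _ _) (is_derive_cst _ _ _)))).
    by rewrite /GRing.scale/= addr0 mulr1.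
  have d2 := @is_derive1_comp R expR (fun s => L * (s + w)) s _ _ (is_derive_expR _) d1.
  have -> : (fun s => K / L * expR (L * (s + w))) =
    (K / L) \*: (expR \o (fun s => L * (s + w))) by [].
  apply: (derive_eq _ (is_deriveZ _ d2)).
  by rewrite /GRing.scale/=; field; rewrite gt_eqF.
have dshift (s : R) : is_derive s (1 : R) (fun s => a + s) 1.
  have -> : (fun s => a + s) = cst a + (@id R) by [].
  by apply: (derive_eq _ (is_deriveD (is_derive_cst _ _ _) (is_derive_id _ _))); rewrite add0r.
have drefl (s : R) : is_derive s (1 : R) (fun s => a - s) (-1).
  have -> : (fun s => a - s) = cst a - (@id R) by [].
  by apply: (derive_eq _ (is_deriveB (is_derive_cst _ _ _) (is_derive_id _ _))); rewrite sub0r.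
have [ab|/ltW ba] := leP a b => hd hK.
- have := main (h \o (fun s => a + s)) (fun s => dh (a + s)) (b - a).
  rewrite /= subrKC addr0 ger0_norm ?subr_ge0//; apply => // s /andP[s0 s1].
    apply: cder_eq (@cder_comp R h (fun s => a + s) s _ _ (hd (a + s) _) (dshift s)).
      by rewrite mulr1.
    by lra.
  by have := hK (a + s); rewrite addrAC subrr add0r ger0_norm//; apply; lra.
- have := main (h \o (fun s => a - s)) (fun s => - dh (a - s)) (a - b).
  rewrite /= subKr subr0 distrC ger0_norm ?subr_ge0//; apply => // s /andP[s0 s1].
    apply: cder_eq (@cder_comp R h (fun s => a - s) s _ _ (hd (a - s) _) (drefl s)).
      by rewrite rmorphN mulrN mulr1.
    by lra.
  rewrite normcN; have := hK (a - s).
  by rewrite addrAC subrr add0r normrN ger0_norm//; apply; lra.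
Qed.

End PlaneBounds.

Section Picard.
Context {R : realType}.
Variables p p1 p2 : R * R -> R[i].
Hypothesis p_d1 : forall x y, cder (fun s => p (s, y)) x (p1 (x, y)).
Hypothesis p_d2 : forall x y, cder (fun s => p (x, s)) y (p2 (x, y)).
Hypothesis p1_cont : forall z, cont2 p1 z.
Hypothesis p2_cont : forall z, cont2 p2 z.
Hypothesis p_low : forall z, exists c d : R, [/\ 0 < c, 0 < d &
  forall z', near2 z d z' -> c * dist1 z z' <= normc (p z' - p z)].

Let p_cont := p_cont p_d1 p_d2 p1_cont p2_cont.
Let prim := primitive p1 p2.

Lemma primitive_d1 f z0 x y : (forall z, exists l, pd p f z l) ->
  cder (fun s => prim f z0 (s, y)) x (f (x, y) * p1 (x, y)).
Proof.
move=> pf; have cf z : cont2 f z by have [l /(pd_cont2 p_cont)] := pf z.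
apply: (@cder_ext _ (fun s => vint p2 f z0.1 z0.2 y + hint p1 f y z0.1 s)).
  by move=> s; rewrite /prim (primitiveE p_d1 p_d2 p1_cont p2_cont).
by apply: cder_eq (cderD (cder_cst _ x) (hint_cder p1_cont y z0.1 x cf)); rewrite add0r.
Qed.

Lemma primitive_d2 f z0 x y : (forall z, cont2 f z) ->
  cder (fun s => prim f z0 (x, s)) y (f (x, y) * p2 (x, y)).
Proof.
move=> cf.
have := cderD (cder_cst (hint p1 f z0.2 z0.1 x) y) (vint_cder p2_cont x z0.2 y cf).
by rewrite add0r.
Qed.

Variables (n : nat) (A : 'I_n -> 'I_n -> R * R -> R[i]).
Hypothesis A_pd : forall i j z, exists l, pd p (A i j) z l.
Variables (z0 : R * R) (c : 'I_n -> R[i]).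

(** The differences of successive Picard iterates; their sum is the solution with value [c] at
    [z0]. *)
Fixpoint picard_term k (i : 'I_n) : R * R -> R[i] :=
  if k is k'.+1 then
    prim (fun z => \sum_j A i j z * picard_term k' j z) z0
  else fun=> c i.

Let rhs (Y : 'I_n -> R * R -> R[i]) i z := \sum_j A i j z * Y j z.

Lemma rhs_pd Y : (forall i z, exists l, pd p (Y i) z l) ->
  forall i z, exists l, pd p (rhs Y i) z l.
Proof.
move=> HY i z.
have H j : {l | pd p (fun z => A i j z * Y j z) z l}.
  apply: cid; have [l Al] := A_pd i j z; have [m Ym] := HY j z.
  by eexists; exact: (pdM p_cont Al Ym).
by exists (\sum_j sval (H j)); apply: pd_sum => j; exact: svalP.
Qed.

Lemma rhs_cont Y : (forall i z, cont2 (Y i) z) -> forall i z, cont2 (rhs Y i) z.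
Proof.
move=> HY i z; apply: cont2_sum => j; apply: cont2M => //.
by have [l /(pd_cont2 p_cont)] := A_pd i j z.
Qed.

Lemma picard_term_pd k i z : exists l, pd p (picard_term k i) z l.
Proof.
elim: k i z => [|k IH] i z; first by exists 0; exact: pd_cst.
eexists; apply: (pd_primitive p_d1 p_d2 p1_cont p2_cont p_low).
exact: rhs_pd.
Qed.

Lemma picard_bound_A D : exists2 M : R, 0 <= M & forall i j z, box z0 D z ->
  normc (A i j z * p1 z) <= M /\ normc (A i j z * p2 z) <= M.
Proof.
have H (ij : 'I_n * 'I_n) : {M : R | 0 <= M & forall z, box z0 D z ->
    normc (A ij.1 ij.2 z * p1 z) <= M /\ normc (A ij.1 ij.2 z * p2 z) <= M}.
  apply: cid2; case: ij => i j /=.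
  have cA z : cont2 (A i j) z by have [l /(pd_cont2 p_cont)] := A_pd i j z.
  have [M M0 H] := @cont2_box_bound R (fun z => A i j z * p1 z) z0 D
    (fun z => cont2M (cA z) (p1_cont z)).
  have [M' M0' H'] := @cont2_box_bound R (fun z => A i j z * p2 z) z0 D
    (fun z => cont2M (cA z) (p2_cont z)).
  exists (M + M') => [|z bz]; first by rewrite addr_ge0.
  by have := H z bz; have := H' z bz; split; lra.
have H0 ij : 0 <= s2val (H ij) by case: (H ij).
exists (\sum_ij s2val (H ij)); first exact: sumr_ge0.
move=> i j z bz; have [h h'] : normc (A i j z * p1 z) <= s2val (H (i, j)) /\
    normc (A i j z * p2 z) <= s2val (H (i, j)).
  by case: (H (i, j)) => /= M _; exact.
have le : s2val (H (i, j)) <= \sum_ij s2val (H ij).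
  by rewrite (bigD1 (i, j))//= lerDl sumr_ge0.
by split; [apply: le_trans h le|apply: le_trans h' le].
Qed.

Lemma rhs_le Y (M K : R) (q : R * R -> R[i]) i z : 0 <= M ->
  (forall i j, normc (A i j z * q z) <= M) -> (forall j, normc (Y j z) <= K) ->
  normc (rhs Y i z * q z) <= n%:R * M * K.
Proof.
move=> M0 HM HK; rewrite /rhs mulr_suml; apply: le_trans (normc_sum _ _ _) _.
apply: le_trans (_ : _ <= \sum_(j < n) M * K) _; last first.
  by rewrite sumr_const card_ord -mulrA mulr_natl.
apply: ler_sum => j _; rewrite mulrAC normcM; apply: ler_pM => //; exact: normc_ge0.
Qed.

(** Measured against the weight [expR (L * dist1 z0 z)], each integration costs a factor
    [2 * n * M / L], where [M] bounds the coefficients on the box. A large [L] turns the usual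
    factorial convergence into a geometric one. *)
Lemma picard_term_le D : exists K : R, forall k i z, box z0 D z ->
  normc (picard_term k i z) <= K / 2 ^+ k.
Proof.
have [M M0 HM] := picard_bound_A D.
(* The 4 makes the cost of one integration at most 1/2; the 1 keeps [L] positive when [n] or [M] is
   0. *)
pose L := 4 * n%:R * M + 1.
have nM : 0 <= n%:R * M by rewrite mulr_ge0.
have L0 : 0 < L by rewrite /L -mulrA ltr_wpDl// mulr_ge0.
pose C := \sum_i normc (c i).
have C0 : 0 <= C by apply: sumr_ge0 => i _; exact: normc_ge0.
have E k i z : box z0 D z ->
    normc (picard_term k i z) <= C / 2 ^+ k * expR (L * dist1 z0 z).
  elim: k i z => [|k IH] i z bz.
    rewrite expr0 divr1 /= -[leLHS]mulr1; apply: ler_pM => //.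
    - exact: normc_ge0.
    - by rewrite /C (bigD1 i)//= lerDl sumr_ge0// => j _; exact: normc_ge0.
    - by rewrite -expR0 ler_expR mulr_ge0 ?dist1_ge0// ltW.
  pose K := n%:R * M * (C / 2 ^+ k).
  have K0 : 0 <= K by rewrite mulr_ge0// divr_ge0// exprn_ge0.
  pose f := rhs (picard_term k) i.
  have cf w : cont2 f w.
    by apply: rhs_cont => j w'; have [l /(pd_cont2 p_cont)] := picard_term_pd k j w'.
  have [bz1 bz2] := box_corner bz.
  have h1 : normc (hint p1 f z0.2 z0.1 z.1) <=
      2 * (K / L) * (expR (L * (`|z.1 - z0.1| + 0)) - expR (L * 0)).
    have -> : hint p1 f z0.2 z0.1 z.1 =
      hint p1 f z0.2 z0.1 z.1 - hint p1 f z0.2 z0.1 z0.1.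
      by rewrite /hint cint_xx subr0.
    apply: (@exp_edge_le R _ (fun s => f (s, z0.2) * p1 (s, z0.2)) z0.1 z.1 K L 0 L0).
      by move=> s _; exact: (hint_cder p1_cont _ _ _ cf).
    move=> s hs; have bs := box_seg1 bz1 hs.
    rewrite /K -[leRHS]mulrA; apply: rhs_le => // [i' j|j].
      by have [] := HM i' j _ bs.
    by have := IH j _ bs; rewrite /dist1/= subrr normr0.
  have h2 : normc (vint p2 f z.1 z0.2 z.2) <= 2 * (K / L) *
      (expR (L * (`|z.2 - z0.2| + `|z.1 - z0.1|)) - expR (L * `|z.1 - z0.1|)).
    have -> : vint p2 f z.1 z0.2 z.2 =
      vint p2 f z.1 z0.2 z.2 - vint p2 f z.1 z0.2 z0.2.
      by rewrite /vint cint_xx subr0.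
    apply: (@exp_edge_le R _ (fun s => f (z.1, s) * p2 (z.1, s)) z0.2 z.2 K L _ L0).
      by move=> s _; exact: (vint_cder p2_cont _ _ _ cf).
    move=> s hs; have bs := box_seg2 bz hs.
    rewrite /K -[leRHS]mulrA; apply: rhs_le => // [i' j|j].
      by have [] := HM i' j _ bs.
    by have := IH j _ bs; rewrite /dist1/= [X in L * X]addrC.
  rewrite -/(picard_term k) /= -/(rhs _ _) -/f /prim /primitive.
  apply: le_trans (normcD _ _) _; apply: le_trans (lerD h1 h2) _.
  rewrite addr0 mulr0 expR0 (addrC `|z.2 - z0.2|) -/(dist1 z0 z).
  rewrite addrC -mulrDr subrKA.
  have KL : 2 * (K / L) <= C / 2 ^+ k.+1.
    have : 0 <= C / 2 ^+ k by rewrite divr_ge0// exprn_ge0.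
    have -> : C / 2 ^+ k.+1 = C / 2 ^+ k / 2 by rewrite exprSr invfM mulrA.
    rewrite /K; move: (C / 2 ^+ k) => t t0.
    suff : n%:R * M * t / L <= t / 4 by lra.
    rewrite ler_pdivrMr// /L -[4 * _ * _]mulrA; move: (n%:R * M) nM => u u0.
    by nra.
  apply: le_trans (_ : _ <= 2 * (K / L) * expR (L * dist1 z0 z)) _.
    apply: ler_wpM2l; first by rewrite mulr_ge0// divr_ge0// ltW.
    by rewrite lerBlDr lerDl.
  by rewrite ler_wpM2r// expR_ge0.
exists (C * expR (L * (D + D))) => k i z bz.
apply: le_trans (E k i z bz) _; rewrite mulrAC.
rewrite ler_wpM2r ?invr_ge0 ?exprn_ge0// ler_wpM2l// ler_expR ler_pM2l//.
by case: bz => h1 h2; exact: lerD.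
Qed.

(** The series is not differentiated term by term. Its sum satisfies the integral equation along
    both two-sided paths from [z0] to [z] ([F1] and [F2]), and [pd_two_paths] turns these into the
    derivative. *)
Theorem picard : exists Y : 'I_n -> R * R -> R[i],
  (forall i, Y i z0 = c i) /\
  (forall i z, pd p (Y i) z (\sum_j A i j z * Y j z)).
Proof.
pose S N i z := \sum_(k < N) picard_term k i z.
have box_self z : box z0 (dist1 z0 z) z by split; rewrite ?lerDl ?lerDr.
have ex i z : {l | exists K, forall N, normc (l - S N i z) <= 4 * K / 2 ^+ N}.
  apply: cid; have [K HK] := picard_term_le (dist1 z0 z).
  have [l Hl] := @geometric_series R (fun k => picard_term k i z) K
    (fun k => HK k i z (box_self z)).
  by exists l, K.
pose Y i z := sval (ex i z).
(* The limits were chosen point by point. Uniqueness of the limit identifies them with limits whose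
   rate of convergence is uniform on a box. *)
have YS D : exists2 K : R, 0 <= K & forall i z N, box z0 D z ->
    normc (Y i z - S N i z) <= K / 2 ^+ N.
  have [K HK] := picard_term_le D; exists (`|4 * K|) => // i z N bz.
  have [l Hl] := @geometric_series R (fun k => picard_term k i z) K
    (fun k => HK k i z bz).
  have [K' HK'] := svalP (ex i z).
  have -> : Y i z = l by exact: geometric_series_unique HK' Hl.
  apply: le_trans (Hl N) _.
  by rewrite ler_wpM2r ?invr_ge0 ?exprn_ge0// ler_norm.
have Spd N i z : exists l, pd p (S N i) z l.
  have H (k : 'I_N) : {l | pd p (picard_term k i) z l}.
    by apply: cid; exact: picard_term_pd.
  by exists (\sum_k sval (H k)); apply: pd_sum => k; exact: svalP.
have Scont N i z : cont2 (S N i) z by have [l /(pd_cont2 p_cont)] := Spd N i z.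
have Ycont i z : cont2 (Y i) z.
  move=> e e0; have [K K0 HK] := YS (dist1 z0 z + 1).
  have [N HN] : exists N, K / 2 ^+ N <= e / 3.
    apply: contrapT => /forallNP H.
    have : e / 3 <= 0.
      by apply: (@le_geometric0 _ _ K) => N; move/negP: (H N); rewrite -ltNge => /ltW.
    by rewrite leNgt divr_gt0.
  have e3 : 0 < e / 3 by rewrite divr_gt0.
  have [d d0 H] := Scont N i z _ e3.
  exists (Num.min d 1) => [|z' /near2_min[/H h [n1 n2]]]; first by rewrite lt_min d0/=.
  have b1 : box z0 (dist1 z0 z + 1) z.
    by have [? ?] := box_self z; split; apply: le_trans (_ : _ <= dist1 z0 z) _;
      rewrite // lerDl.
  have b2 : box z0 (dist1 z0 z + 1) z'.
    have [t1 t2] := box_self z; split.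
    - rewrite -(subrKA z.1); apply: le_trans (ler_normD _ _) _.
      by rewrite addrC lerD// ltW.
    - rewrite -(subrKA z.2); apply: le_trans (ler_normD _ _) _.
      by rewrite addrC lerD// ltW.
  have := HK i _ N b1; have := HK i _ N b2; rewrite [normc (Y i z - _)]normcBC => k1 k2.
  have -> : Y i z' - Y i z = (Y i z' - S N i z') + (S N i z' - S N i z) + (S N i z - Y i z).
    by ring.
  apply: le_trans (normcD _ _) _; apply: le_trans (lerD (normcD _ _) (lexx _)) _.
  by lra.
have gcont i z : cont2 (rhs Y i) z by apply: rhs_cont.
have S0 N i : S N.+1 i z0 = c i.
  rewrite /S big_ord_recl /= big1 ?addr0// => k _.
  by rewrite /= /prim /primitive /hint /vint !cint_xx addr0.
have Sd1 N i x y :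
    cder (fun s => S N.+1 i (s, y)) x (rhs (S N) i (x, y) * p1 (x, y)).
  apply: (@cder_ext _ (fun s => c i + \sum_(k < N) prim (rhs (picard_term k) i) z0 (s, y))).
    by move=> s; rewrite /S big_ord_recl.
  have D (k : 'I_N) := @primitive_d1 (rhs (picard_term k) i) z0 x y
    (rhs_pd (picard_term_pd k) i).
  apply: cder_eq (cderD (cder_cst (c i) x) (cder_sum (index_enum 'I_N) D)).
  rewrite add0r -mulr_suml; congr (_ * _); rewrite exchange_big/=.
  by apply: eq_bigr => j _; rewrite mulr_sumr.
have Sd2 N i x y :
    cder (fun s => S N.+1 i (x, s)) y (rhs (S N) i (x, y) * p2 (x, y)).
  apply: (@cder_ext _ (fun s => c i + \sum_(k < N) prim (rhs (picard_term k) i) z0 (x, s))).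
    by move=> s; rewrite /S big_ord_recl.
  have ct (k : 'I_N) : forall i z, cont2 (picard_term k i) z.
    by move=> i' z; have [l /(pd_cont2 p_cont)] := picard_term_pd k i' z.
  have D (k : 'I_N) := @primitive_d2 (rhs (picard_term k) i) z0 x y
    (rhs_cont (ct k) i).
  apply: cder_eq (cderD (cder_cst (c i) y) (cder_sum (index_enum 'I_N) D)).
  rewrite add0r -mulr_suml; congr (_ * _); rewrite exchange_big/=.
  by apply: eq_bigr => j _; rewrite mulr_sumr.
have eqY i z (F : R[i]) :
    (exists C, forall N, normc (S N.+1 i z - F) <= C / 2 ^+ N) -> Y i z = F.
  move=> [C HC]; have [K K0 HK] := YS (dist1 z0 z).
  apply: (@geometric_series_unique _ (fun N => S N.+1 i z) _ _ K C) => N.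
    apply: le_trans (HK i z N.+1 (box_self z)) _.
    rewrite ler_wpM2l// lef_pV2 ?posrE ?exprn_gt0//.
    by rewrite ler_eXn2l// ltr1n.
  by rewrite normcBC.
have diff N i (q : R * R -> R[i]) w : rhs (S N) i w * q w - rhs Y i w * q w =
    rhs (fun j z => S N j z - Y j z) i w * q w.
  by rewrite -mulrBl; congr (_ * _); rewrite /rhs -sumrB; apply: eq_bigr => j _;
    rewrite mulrBr.
(* Along a side, the derivative of [S N.+1] minus the integral of [rhs Y] is [rhs (S N - Y)] times
   [p1], of order [2 ^- N], so the integral equation holds in the limit. *)
have edge1 D : exists C, forall N i y a b,
    box z0 D (b, y) -> a = z0.1 ->
    normc ((S N.+1 i (b, y) - hint p1 (rhs Y i) y a b) - S N.+1 i (a, y)) <= C / 2 ^+ N.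
  have [K K0 HK] := YS D; have [M M0 HM] := picard_bound_A D.
  exists (2 * (n%:R * M * K) * D) => N i y a b bb az.
  have -> : S N.+1 i (a, y) = S N.+1 i (a, y) - hint p1 (rhs Y i) y a a.
    by rewrite /hint cint_xx subr0.
  apply: le_trans (_ : _ <= 2 * (n%:R * M * (K / 2 ^+ N)) * `|b - a|) _; last first.
    have -> : 2 * (n%:R * M * (K / 2 ^+ N)) * `|b - a| =
      (2 * (n%:R * M * K) / 2 ^+ N) * `|b - a| by ring.
    rewrite [leRHS]mulrAC ler_wpM2l ?divr_ge0 ?mulr_ge0 ?exprn_ge0//.
    by rewrite az; case: bb.
  apply: (@cder_bound R (fun s => S N.+1 i (s, y) - hint p1 (rhs Y i) y a s)
    (fun s => rhs (S N) i (s, y) * p1 (s, y) - rhs Y i (s, y) * p1 (s, y))) => s hs.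
    by apply: cderB; [exact: Sd1|exact: (hint_cder p1_cont _ _ _ (gcont i))].
  have bs : box z0 D (s, y) by apply: (box_seg1 bb); rewrite -az.
  rewrite diff; apply: rhs_le => // [i' j|j]; first by case: (HM i' j _ bs).
  by rewrite normcBC; exact: HK.
have edge2 D : exists C, forall N i x a b,
    box z0 D (x, b) -> a = z0.2 ->
    normc ((S N.+1 i (x, b) - vint p2 (rhs Y i) x a b) - S N.+1 i (x, a)) <= C / 2 ^+ N.
  have [K K0 HK] := YS D; have [M M0 HM] := picard_bound_A D.
  exists (2 * (n%:R * M * K) * D) => N i x a b bb az.
  have -> : S N.+1 i (x, a) = S N.+1 i (x, a) - vint p2 (rhs Y i) x a a.
    by rewrite /vint cint_xx subr0.
  apply: le_trans (_ : _ <= 2 * (n%:R * M * (K / 2 ^+ N)) * `|b - a|) _; last first.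
    have -> : 2 * (n%:R * M * (K / 2 ^+ N)) * `|b - a| =
      (2 * (n%:R * M * K) / 2 ^+ N) * `|b - a| by ring.
    rewrite [leRHS]mulrAC ler_wpM2l ?divr_ge0 ?mulr_ge0 ?exprn_ge0//.
    by rewrite az; case: bb.
  apply: (@cder_bound R (fun s => S N.+1 i (x, s) - vint p2 (rhs Y i) x a s)
    (fun s => rhs (S N) i (x, s) * p2 (x, s) - rhs Y i (x, s) * p2 (x, s))) => s hs.
    by apply: cderB; [exact: Sd2|exact: (vint_cder p2_cont _ _ _ (gcont i))].
  have bs : box z0 D (x, s) by apply: (box_seg2 bb); rewrite -az.
  rewrite diff; apply: rhs_le => // [i' j|j]; first by case: (HM i' j _ bs).
  by rewrite normcBC; exact: HK.
have F1 i z : Y i z = c i + (hint p1 (rhs Y i) z0.2 z0.1 z.1 + vint p2 (rhs Y i) z.1 z0.2 z.2).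
  apply: eqY; have [C HC] := edge1 (dist1 z0 z); have [C' HC'] := edge2 (dist1 z0 z).
  have [bz1 bz2] := box_corner (box_self z).
  exists (C' + C) => N.
  have := HC N i z0.2 z0.1 z.1 bz1 erefl.
  have -> : S N.+1 i (z0.1, z0.2) = c i by rewrite -surjective_pairing S0.
  have := HC' N i z.1 z0.2 z.2; rewrite -surjective_pairing => /(_ (box_self z) erefl).
  rewrite mulrDl => t1 t2; apply: le_trans (lerD t1 t2).
  by apply: le_trans (normcD _ _); rewrite le_eqVlt; apply/orP; left;
    apply/eqP; congr Normc.normc; ring.
have F2 i z : Y i z = c i + (vint p2 (rhs Y i) z0.1 z0.2 z.2 + hint p1 (rhs Y i) z.2 z0.1 z.1).
  apply: eqY; have [C HC] := edge1 (dist1 z0 z); have [C' HC'] := edge2 (dist1 z0 z).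
  have [bz1 bz2] := box_corner (box_self z).
  exists (C' + C) => N.
  have := HC' N i z0.1 z0.2 z.2 bz2 erefl.
  have -> : S N.+1 i (z0.1, z0.2) = c i by rewrite -surjective_pairing S0.
  have := HC N i z.2 z0.1 z.1; rewrite -surjective_pairing => /(_ (box_self z) erefl).
  rewrite mulrDl => t1 t2; apply: le_trans (lerD t2 t1).
  by apply: le_trans (normcD _ _); rewrite le_eqVlt; apply/orP; left;
    apply/eqP; congr Normc.normc; ring.
exists Y; split => [i|i z].
  by rewrite F1 /hint /vint !cint_xx !addr0.
exact: (pd_two_paths p_d1 p_d2 p1_cont p2_cont p_low (gcont i) (F1 i) (F2 i) z).
Qed.

End Picard.

Section PathDerivatives.
Context {R : realType}.

Lemma is_derive_epsP (u : R -> R) (t l : R) : is_derive t (1 : R) u l <->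
  forall e : R, 0 < e -> exists2 d : R, 0 < d &
    forall s, `|s - t| < d -> `|u s - u t - l * (s - t)| <= e * `|s - t|.
Proof.
split.
- move=> /is_derive1_caratheodory[g [gE gc gl]] e e0.
  move/cvgrPdist_le : gc => /(_ e e0) [d/= d0 H]; exists d => // s st.
  rewrite gE -gl -mulrBl normrM ler_wpM2r// distrC; apply: H.
  by rewrite /ball_/= distrC.
- move=> H; apply/is_derive1_caratheodory.
  exists (fun s => if s == t then l else (u s - u t) / (s - t)).
  split; [| |by rewrite eqxx].
    move=> s; have [->|st] := eqVneq s t; first by rewrite !subrr mulr0.
    by rewrite divfK// subr_eq0.
  apply/cvgrPdist_le => e e0; have [d d0 {}H] := H e e0.
  have nb : \forall s \near t, `|t - s| < d by exact: (@nbhsx_ballx _ _ t d d0).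
  apply: filterS nb => s; rewrite distrC eqxx => st.
  have [_|nst] := eqVneq s t; first by rewrite subrr normr0 ltW.
  have st0 : s - t != 0 by rewrite subr_eq0.
  rewrite distrC -(ler_pM2r (_ : 0 < `|s - t|)) ?normr_gt0//.
  by rewrite -normrM mulrBl divfK//; exact: H.
Qed.

Lemma cder_epsP (f : R -> R[i]) (t : R) (l : R[i]) : cder f t l <->
  forall e : R, 0 < e -> exists2 d : R, 0 < d &
    forall s, `|s - t| < d ->
      normc (f s - f t - l * (s - t)%:C) <= e * `|s - t|.
Proof.
split.
- move=> [/is_derive_epsP h1 /is_derive_epsP h2] e e0.
  have e2 : 0 < e / 2 by rewrite divr_gt0.
  have [d d0 H] := h1 _ e2; have [d' d0' H'] := h2 _ e2.
  exists (Num.min d d') => [|s]; rewrite lt_min ?d0// => /andP[/H h /H' h'].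
  apply: le_trans (normc_le _) _.
  rewrite !(ReD, ImD, ReN, ImN, ReM, ImM)/= !mulr0 subr0 add0r.
  by rewrite /= in h h'; apply: le_trans (lerD h h') _; lra.
- move=> H; split; apply/is_derive_epsP => e /H[d d0 {}H]; exists d => // s /H.
  + apply: le_trans; apply: le_trans (normr_Re _).
    by rewrite !(ReD, ReN, ReM)/= mulr0 subr0.
  + apply: le_trans; apply: le_trans (normr_Im _).
    by rewrite !(ImD, ImN, ImM)/= mulr0 add0r.
Qed.

Lemma pd_path (p f : R * R -> R[i]) (g : R -> R * R) (t : R) (l v : R[i]) :
  (forall e : R, 0 < e ->
     exists2 d : R, 0 < d & forall s, `|s - t| < d -> near2 (g t) e (g s)) ->
  cder (p \o g) t v -> pd p f (g t) l -> cder (f \o g) t (l * v).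
Proof.
move=> gc /cder_epsP pg pf; apply/cder_epsP => e e0.
have [d1 d10 H1] := pg 1 ltr01.
pose K := normc l + normc v + 1.
have K1 : 1 <= K by rewrite lerDr addr_ge0 ?normc_ge0.
have K0 : 0 < K by apply: lt_le_trans K1.
have e2 : 0 < e / (2 * K) by rewrite divr_gt0// mulr_gt0.
have [d2 d20 H2] := pg _ e2.
have [d3 d30 H3] := pf _ e2; have [d4 d40 H4] := gc _ d30.
exists (Num.min (Num.min d1 d2) d4); first by rewrite !lt_min d10 d20.
move=> s; rewrite !lt_min => /andP[/andP[/H1 h1 /H2 h2] /H4/H3 h3].
rewrite /= in h1 h2 h3.
set D := p (g s) - p (g t) in h1 h2 h3 *.
have hD : normc D <= K * `|s - t|.
  rewrite -[D](subrK (v * (s - t)%:C)); apply: le_trans (normcD _ _) _.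
  rewrite normcM normc_real; apply: le_trans (lerD h1 (lexx _)) _.
  by rewrite -mulrDl ler_wpM2r// /K; have := normc_ge0 l; lra.
have -> : (f \o g) s - (f \o g) t - l * v * (s - t)%:C =
  (f (g s) - f (g t) - l * D) + l * (D - v * (s - t)%:C) by rewrite /=; ring.
apply: le_trans (normcD _ _) _; rewrite normcM.
have -> : e * `|s - t| = e / (2 * K) * (K * `|s - t|) + K * (e / (2 * K) * `|s - t|).
  by field; rewrite gt_eqF.
apply: lerD.
- by apply: le_trans h3 _; rewrite ler_wpM2l// ltW.
- apply: ler_pM => //; rewrite ?normc_ge0// /K; have := normc_ge0 v; lra.
Qed.

Lemma cder_cont (f : R -> R[i]) (t : R) (l : R[i]) : cder f t l ->
  forall e : R, 0 < e ->
    exists2 d : R, 0 < d & forall s, `|s - t| < d -> normc (f s - f t) <= e.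
Proof.
move=> /cder_epsP H e e0; have [d d0 {}H] := H 1 ltr01.
pose K := normc l + 1.
have K0 : 0 < K by rewrite ltr_wpDl ?normc_ge0.
exists (Num.min d (e / K)); first by rewrite lt_min d0 divr_gt0.
move=> s; rewrite lt_min => /andP[/H h]; rewrite ltr_pdivlMr// => /ltW h2.
rewrite -[f s - f t](subrK (l * (s - t)%:C)); apply: le_trans (normcD _ _) _.
rewrite normcM normc_real; apply: le_trans (lerD h (lexx _)) _.
by apply: le_trans h2; rewrite -mulrDl [leRHS]mulrC /K [normc l + 1]addrC.
Qed.

End PathDerivatives.

(** * Energy estimates along paths *)

Section Energy.
Context {R : realType} {n : nat}.
Implicit Types (v : 'I_n -> R -> R[i]).

Definition energy (w : 'I_n -> R[i]) : R := \sum_i normc (w i) ^+ 2.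

Lemma energy_ge0 w : 0 <= energy w.
Proof. by apply: sumr_ge0 => i _; exact: sqr_ge0. Qed.

Lemma energy_ge w i : normc (w i) ^+ 2 <= energy w.
Proof. by rewrite /energy (bigD1 i)//= lerDl sumr_ge0// => j _; exact: sqr_ge0. Qed.

Lemma normc_le_energy w i : normc (w i) <= Num.sqrt (energy w).
Proof.
rewrite -(ler_pXn2r (_ : 0 < 2)%N) ?nnegrE ?normc_ge0 ?sqrtr_ge0//.
by rewrite sqr_sqrtr ?energy_ge0// energy_ge.
Qed.

Lemma is_derive_energy v (dv : 'I_n -> R[i]) (t : R) :
  (forall i, cder (v i) t (dv i)) ->
  is_derive t (1 : R) (fun s => energy (v^~ s))
    (\sum_i 2 * (Re (v i t) * Re (dv i) + Im (v i t) * Im (dv i))).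
Proof.
move=> H.
have -> : (fun s => energy (v^~ s)) =
    \sum_(i < n) ((Re \o v i) ^+ 2 + (Im \o v i) ^+ 2).
  apply/funext => s; rewrite /energy fct_sumE; apply: eq_bigr => i _.
  by rewrite sqr_normc.
have D i : is_derive t (1 : R) ((Re \o v i) ^+ 2 + (Im \o v i) ^+ 2)
    (2 * (Re (v i t) * Re (dv i) + Im (v i t) * Im (dv i))).
  have [h1 h2] := H i.
  apply: derive_eq (is_deriveD (is_deriveX 2 h1) (is_deriveX 2 h2)).
  by rewrite /GRing.scale/= !expr1; ring.
exact: (is_derive_sum D).
Qed.

(* Backward Gronwall estimate: the drift [delta] can only increase the energy
   with time, so from [t2] back to [t1] only the perturbation [B] counts. *)
Lemma energy_le v (e : 'I_n -> R[i]) (k : R) (delta : 'I_n -> R -> R[i])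
    (B : 'I_n -> 'I_n -> R -> R[i]) (rho Th : R -> R) (t1 t2 : R) :
  t1 <= t2 -> 0 <= k <= 1 -> (forall i, normc (e i) <= 1) ->
  (forall t, t1 <= t <= t2 -> [/\
    forall i, cder (v i) t
      (delta i t * v i t + \sum_j B i j t * (v j t + k%:C * e j)),
    forall i, 0 <= Re (delta i t),
    forall i j, normc (B i j t) <= rho t &
    is_derive t (1 : R) Th (rho t)]) ->
  energy (v^~ t1) + k <=
    (energy (v^~ t2) + k) * expR (4 * n%:R ^+ 2 * (Th t2 - Th t1)).
Proof.
move=> t12 /andP[k0 k1] e1 H.
(* With [r] the square root of the energy, the perturbation contributes at least
   [- 2 * n^2 * rho * r * (r + k)] to its derivative, and [r * (r + k) <= 2 * (r^2 + k)] because
   [k <= 1]. *)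
pose c : R := 4 * n%:R ^+ 2.
pose dv i t := delta i t * v i t + \sum_j B i j t * (v j t + k%:C * e j).
pose dE t := \sum_i 2 * (Re (v i t) * Re (dv i t) + Im (v i t) * Im (dv i t)).
pose G t := (energy (v^~ t) + k) * expR (c * (Th t - Th t1)).
pose dG t := (dE t + c * rho t * (energy (v^~ t) + k)) * expR (c * (Th t - Th t1)).
have dGE t : t1 <= t <= t2 -> is_derive t (1 : R) G (dG t).
  move=> ht; have [h1 _ _ h4] := H t ht.
  have D1 : is_derive t (1 : R) (fun t => energy (v^~ t) + k) (dE t).
    have -> : (fun t => energy (v^~ t) + k) = (fun t => energy (v^~ t)) + cst k by [].
    by rewrite -[dE t]addr0; apply: is_deriveD; exact: is_derive_energy.
  have D2 : is_derive t (1 : R) (fun t => c * (Th t - Th t1)) (c * rho t).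
    have -> : (fun t => c * (Th t - Th t1)) = c \*: (Th - cst (Th t1)) by [].
    apply: derive_eq (is_deriveZ _ (is_deriveB h4 (is_derive_cst _ _ _))).
    by rewrite subr0.
  have D3 := @is_derive1_comp R expR _ t _ _ (is_derive_expR _) D2.
  apply: derive_eq (is_deriveM D1 D3).
  by rewrite /dG /GRing.scale/=; ring.
have dG0 t : t1 <= t <= t2 -> 0 <= dG t.
  move=> ht; have [_ h2 h3 _] := H t ht.
  apply: mulr_ge0; last exact: expR_ge0.
  set E := energy (v^~ t).
  have E0 : 0 <= E by exact: energy_ge0.
  set r := Num.sqrt E.
  have r0 : 0 <= r by exact: sqrtr_ge0.
  have rE : r ^+ 2 = E by rewrite sqr_sqrtr.
  have vr i : normc (v i t) <= r by exact: normc_le_energy.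
  (* That [rho t] is nonnegative is read off an entry of [B], which exists only for positive [n]. *)
  have [n0|n0] := posnP n.
    have -> : dE t = 0.
      by rewrite /dE big1// => i; have := leq_ltn_trans (leq0n i) (ltn_ord i); rewrite n0.
    by rewrite /c n0 expr0n/= mulr0 !mul0r addr0.
  have rho0 : 0 <= rho t.
    by apply: le_trans (h3 (Ordinal n0) (Ordinal n0)); exact: normc_ge0.
  pose w i := \sum_j B i j t * (v j t + k%:C * e j).
  have wle i : normc (w i) <= n%:R * (rho t * (r + k)).
    apply: le_trans (normc_sum _ _ _) _.
    apply: le_trans (_ : _ <= \sum_(j < n) rho t * (r + k)) _; last first.
      by rewrite sumr_const card_ord mulr_natl.
    apply: ler_sum => j _; rewrite normcM; apply: ler_pM; rewrite ?normc_ge0//.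
    apply: le_trans (normcD _ _) _; apply: lerD => //.
    by rewrite normcM normc_real ger0_norm// ler_piMr.
  have term i : - (2 * (r * (n%:R * (rho t * (r + k))))) <=
      2 * (Re (v i t) * Re (dv i t) + Im (v i t) * Im (dv i t)).
    have -> : Re (v i t) * Re (dv i t) + Im (v i t) * Im (dv i t) =
      Re (delta i t) * normc (v i t) ^+ 2 +
      (Re (v i t) * Re (w i) + Im (v i t) * Im (w i)).
      by rewrite sqr_normc /dv -/(w i) ReD ImD ReM ImM; ring.
    rewrite [leRHS]mulrDr -[leLHS]add0r; apply: lerD.
      by rewrite mulr_ge0// mulr_ge0// sqr_ge0.
    rewrite -mulrN ler_pM2l//.
    have -> : Re (v i t) * Re (w i) + Im (v i t) * Im (w i) =
        Re ((v i t)^*%C * w i).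
      by rewrite ReM; case: (v i t) => x y /=; ring.
    have hc : normc ((v i t)^*%C) = normc (v i t).
      by rewrite !normcE; case: (v i t) => x y /=; rewrite sqrrN.
    rewrite lerNl -ReN; apply: le_trans (ler_norm _) _.
    apply: le_trans (normr_Re _) _; rewrite normcN normcM hc.
    by apply: ler_pM; rewrite ?normc_ge0.
  have : - (n%:R * (2 * (r * (n%:R * (rho t * (r + k)))))) <= dE t.
    apply: le_trans (ler_sum (index_enum 'I_n) (fun i _ => term i)).
    by rewrite sumr_const card_ord -[leRHS]mulr_natl mulrN.
  suff : n%:R * (2 * (r * (n%:R * (rho t * (r + k))))) <= c * rho t * (E + k) by lra.
  have -> : n%:R * (2 * (r * (n%:R * (rho t * (r + k))))) =
    (2 * n%:R ^+ 2 * rho t) * (r * (r + k)) by ring.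
  have -> : c * rho t * (E + k) = (2 * n%:R ^+ 2 * rho t) * (2 * (E + k)).
    by rewrite /c; ring.
  apply: ler_wpM2l; first by rewrite mulr_ge0// mulr_ge0// exprn_ge0.
  by rewrite -rE; nra.
have d0 t : t1 <= t <= t2 -> is_derive t (1 : R) (fun=> 0 : R) 0.
  by move=> _; exact: is_derive_cst.
have := derive_le t12 d0 dGE dG0.
by rewrite subrr subr_ge0 {1}/G subrr mulr0 expR0 mulr1.
Qed.

(** With all of the right-hand side counted as perturbation, [energy_le] has no preferred direction:
    reversing time covers the case [a <= b]. *)
Lemma linear_edge_le v (B : 'I_n -> 'I_n -> R -> R[i]) (M a b : R) :
  (forall t, Num.min a b <= t <= Num.max a b ->
    (forall i, cder (v i) t (\sum_j B i j t * v j t)) /\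
    (forall i j, normc (B i j t) <= M)) ->
  energy (v^~ b) <= energy (v^~ a) * expR (4 * n%:R ^+ 2 * (M * `|b - a|)).
Proof.
have dM (t : R) : is_derive t (1 : R) (fun s => M * s) M.
  have -> : (fun s => M * s) = M \*: (@id R) by [].
  by apply: (derive_eq _ (is_deriveZ _ (is_derive_id _ _))); rewrite /GRing.scale/= mulr1.
have main v' B' a' b' : b' <= a' ->
  (forall t, b' <= t <= a' ->
    (forall i, cder (v' i) t (\sum_j B' i j t * v' j t)) /\
    (forall i j, normc (B' i j t) <= M)) ->
  energy (v'^~ b') <= energy (v'^~ a') * expR (4 * n%:R ^+ 2 * (M * (a' - b'))).
  move=> ba H.
  have := @energy_le v' (fun=> 0) 0 (fun _ _ => 0) B' (fun=> M) (fun s => M * s) b' a' ba.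
  rewrite lexx ler01 !addr0 -mulrBr => -> //.
  - by move=> i; rewrite normc0.
  - move=> t ht; have [h1 h2] := H t ht; split => // i.
    apply: cder_eq (h1 i); rewrite mul0r add0r.
    by apply: eq_bigr => j _; rewrite mulr0 addr0.
have [ab|/ltW ba] := leP a b => H; last first.
  by rewrite distrC ger0_norm ?subr_ge0//; exact: (main v B a b ba H).
rewrite ger0_norm ?subr_ge0//.
have := main (fun i s => v i (- s)) (fun i j s => - B i j (- s)) (- a) (- b).
rewrite !opprK addrC; apply; first by rewrite lerN2.
have dN (t : R) : is_derive t (1 : R) (fun s => - s) (-1).
  have -> : (fun s : R => - s) = - (@id R) by [].
  exact: is_deriveN.
move=> t ht; have ht' : a <= - t <= b by lra.
have [h1 h2] := H _ ht'; split => [i|i j]; last by rewrite normcN.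
apply: cder_eq (@cder_comp R (v i) (fun s => - s) t _ _ (h1 i) (dN t)).
rewrite rmorphN mulrN mulr1 -sumrN.
by apply: eq_bigr => j _; rewrite mulNr.
Qed.

End Energy.

Section LinearDependence.
Context {R : realType}.
Variables p p1 p2 : R * R -> R[i].
Hypothesis p_d1 : forall x y, cder (fun s => p (s, y)) x (p1 (x, y)).
Hypothesis p_d2 : forall x y, cder (fun s => p (x, s)) y (p2 (x, y)).
Hypothesis p1_cont : forall z, cont2 p1 z.
Hypothesis p2_cont : forall z, cont2 p2 z.
Variables (n : nat) (A : 'I_n -> 'I_n -> R * R -> R[i]).
Hypothesis A_pd : forall i j z, exists l, pd p (A i j) z l.

(** [C] is common to all solutions. This gives both uniqueness for given initial values
    ([solution_eq0]) and the passage to the limit in [recessive_solution]. *)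
Lemma linear_dependence (z0 z : R * R) : exists2 C : R, 0 <= C &
  forall Y : 'I_n -> R * R -> R[i],
    (forall i z, pd p (Y i) z (\sum_j A i j z * Y j z)) ->
    energy (Y^~ z) <= C * energy (Y^~ z0).
Proof.
have [M M0 HM] := picard_bound_A p_d1 p_d2 p1_cont p2_cont A_pd z0 (dist1 z0 z).
have bz : box z0 (dist1 z0 z) z by split; rewrite ?lerDl ?lerDr.
have [bz1 bz2] := box_corner bz.
exists (expR (4 * n%:R ^+ 2 * (M * `|z.2 - z0.2|))
      * expR (4 * n%:R ^+ 2 * (M * `|z.1 - z0.1|))).
  by rewrite mulr_ge0// expR_ge0.
move=> Y HY.
have h1 := @linear_edge_le R n (fun i s => Y i (s, z0.2))
  (fun i j s => A i j (s, z0.2) * p1 (s, z0.2)) M z0.1 z.1.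
have h2 := @linear_edge_le R n (fun i s => Y i (z.1, s))
  (fun i j s => A i j (z.1, s) * p2 (z.1, s)) M z0.2 z.2.
rewrite /= -!surjective_pairing in h1 h2.
rewrite [energy _ in leRHS]/= -mulrA.
have {}h1 := h1 _; have {}h2 := h2 _.
apply: le_trans (h2 _) _.
  move=> t ht; split => [i|i j]; last first.
    by have [] := HM i j _ (box_seg2 bz ht).
  have ct e : 0 < e -> exists2 d : R, 0 < d &
      forall s, `|s - t| < d -> near2 (z.1, t) e (z.1, s).
    by move=> e0; exists e => // s hs; split => //=; rewrite subrr normr0.
  apply: cder_eq (pd_path ct (p_d2 z.1 t) (HY i (z.1, t))).
  by rewrite mulr_suml; apply: eq_bigr => j _; rewrite mulrAC.
rewrite mulrC ler_wpM2l ?expR_ge0// mulrC.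
apply: h1 => t ht; split => [i|i j]; last first.
  by have [] := HM i j _ (box_seg1 bz1 ht).
have ct e : 0 < e -> exists2 d : R, 0 < d &
    forall s, `|s - t| < d -> near2 (t, z0.2) e (s, z0.2).
  by move=> e0; exists e => // s hs; split => //=; rewrite subrr normr0.
apply: cder_eq (pd_path ct (p_d1 t z0.2) (HY i (t, z0.2))).
by rewrite mulr_suml; apply: eq_bigr => j _; rewrite mulrAC.
Qed.

End LinearDependence.

(** * The equation on the universal cover *)

Section ComplexDerivatives.
Context {R : realType}.

Lemma gt0_complex (e : R[i]) : 0 < e -> exists2 r : R, 0 < r & e = r%:C.
Proof.
case: e => x y; rewrite ltcE/= => /andP[/eqP -> x0]; by exists x.
Qed.

Lemma mx_cvgP m n (T : Type) (F : set_system T) (FF : Filter F)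
    (g : T -> 'M[R[i]]_(m, n)) (l : 'M[R[i]]_(m, n)) :
  g @ F --> l <-> forall e : R, 0 < e ->
    \forall x \near F, forall i j, normc (g x i j - l i j) <= e.
Proof.
split.
- move=> /cvg_ballP H e e0.
  have eC : 0 < e%:C by rewrite ltcR.
  apply: filterS (H _ eC) => x [_ b] i j.
  by rewrite normcBC -lecR -normc_norm; apply/ltW/b.
- move=> H; apply/cvg_ballP => e /gt0_complex[r r0 ->].
  have r2 : 0 < r / 2 by rewrite divr_gt0.
  apply: filterS (H _ r2) => x b; split; first by rewrite ltcR.
  move=> i j; rewrite /ball/= normc_norm ltcR normcBC.
  by apply: le_lt_trans (b i j) _; rewrite ltr_pdivrMr// ltr_pMr// ltr1n.
Qed.

Lemma near2P (z : R * R) (Q : set (R * R)) : (\forall z' \near z, Q z') <->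
  exists2 d : R, 0 < d & forall z', near2 z d z' -> Q z'.
Proof.
split.
- move=> /nbhs_ballP[d/= d0 H]; exists d => // z' [h1 h2]; apply: H.
  by split; rewrite /ball/= distrC.
- move=> [d d0 H]; apply/nbhs_ballP; exists d => // z' [h1 h2]; apply: H.
  by split; rewrite distrC.
Qed.

Lemma sin_ge : exists2 d : R, 0 < d &
  forall u : R, `|u| < d -> `|u| / 2 <= `|sin u|.
Proof.
have /is_derive_epsP H := @is_derive_sin R 0.
have e2 : 0 < 2^-1 :> R by rewrite invr_gt0.
have [d d0 {}H] := H _ e2.
exists d => // u ud; have := H u; rewrite !subr0 sin0 subr0 cos0 mul1r => /(_ ud).
have := ler_normD (sin u) (u - sin u); rewrite subrKC distrC; lra.
Qed.

Lemma normc_proj (z : R * R) : 0 < z.1 -> normc (proj z) = z.1.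
Proof. by move=> z0; rewrite /proj normcM normc_cis mulr1 normc_real gtr0_norm. Qed.

(** The difference of moduli bounds the radial increment. With [r' >= r / 2] and
    [|sin u| >= |u| / 2], the bound [e2] gives an angular increment of at most [4 / r] times the
    chord, whence the constant [1 + 4 / r]. *)
Lemma proj_low (z : R * R) : 0 < z.1 -> exists c d : R, [/\ 0 < c, 0 < d &
  forall z', near2 z d z' -> c * dist1 z z' <= normc (proj z' - proj z)].
Proof.
case: z => r th /= r0; have [d d0 H] := sin_ge.
exists (1 + 4 / r)^-1, (Num.min d (r / 2)).
have c0 : 0 < 1 + 4 / r by rewrite ltr_wpDl// ?divr_gt0.
split; [by rewrite invr_gt0|by rewrite lt_min d0 divr_gt0|].
case=> r' th' /near2_min[[_ /= /H h2] [/= h1 _]].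
set X := normc (proj (r', th') - proj (r, th)).
have r'0 : r / 2 < r' by move: h1; rewrite ltr_norml => /andP[]; lra.
have r'00 : 0 < r' by lra.
have e1 : `|r' - r| <= X.
  have n1 : normc (proj (r', th')) = r' by rewrite normc_proj.
  have n2 : normc (proj (r, th)) = r by rewrite normc_proj.
  have := normcD (proj (r', th') - proj (r, th)) (proj (r, th)).
  have := normcD (proj (r, th) - proj (r', th')) (proj (r', th')).
  rewrite !subrK normcBC -/X n1 n2 => ? ?.
  by rewrite ler_norml; lra.
(* After rotation by [- th] the point [proj (r, th)] is real, so the imaginary part sees only the
   angle. *)
have e2 : r' * `|sin (th' - th)| <= X.
  have -> : X = normc (cis (- th) * (proj (r', th') - proj (r, th))).
    by rewrite normcM normc_cis mul1r.
  apply: le_trans (normr_Im _).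
  have -> : cis (- th) * (proj (r', th') - proj (r, th)) =
      r'%:C * cis (th' - th) - r%:C * (cis th * cis (- th)).
    by rewrite /proj /modulus /argument /= cisD; ring.
  rewrite cisN ImD ImN !ImM /= !(mul0r, mulr0, addr0, oppr0).
  by rewrite normrM gtr0_norm.
rewrite [leRHS](_ : _ = X)//; clearbody X.
rewrite ler_pdivrMl// /dist1 /= mulrDl mul1r; apply: lerD => //.
rewrite mulrAC ler_pdivlMr//.
have : r / 2 * (`|th' - th| / 2) <= X.
  by apply: le_trans e2; apply: ler_pM => //; rewrite ?divr_ge0 ?ltW.
by lra.
Qed.

Lemma is_zderiveP m n (f : ucover R -> 'M[R[i]]_(m, n)) (z : R * R)
    (l : 'M[R[i]]_(m, n)) : 0 < z.1 ->
  is_zderive f z l <-> forall i j, pd proj (fun z => f z i j) z (l i j).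
Proof.
move=> z0; have [c [d [c0 d0 low]]] := proj_low z0.
have inj z' : near2 z d z' -> z' <> z -> proj z' - proj z != 0.
  move=> /low h ne; rewrite -normc_gt0; apply: lt_le_trans h.
  rewrite mulr_gt0// lt_neqAle dist1_ge0 andbT eq_sym; apply/eqP => e0; apply: ne.
  have := normr_ge0 (z'.1 - z.1); have := normr_ge0 (z'.2 - z.2).
  move: e0; rewrite /dist1 => e0 g2 g1.
  have /eqP : `|z'.1 - z.1| = 0 by lra.
  have /eqP : `|z'.2 - z.2| = 0 by lra.
  rewrite !normr_eq0 !subr_eq0 => /eqP e2 /eqP e1.
  by rewrite [z']surjective_pairing [z]surjective_pairing e1 e2.
have E z' i j : proj z' - proj z != 0 ->
    normc (((proj z' - proj z)^-1 *: (f z' - f z)) i j - l i j) *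
      normc (proj z' - proj z) =
    normc (f z' i j - f z i j - l i j * (proj z' - proj z)).
  by move=> nz; rewrite -normcM !mxE; congr Normc.normc; field.
split.
- move=> /mx_cvgP H i j e e0.
  have := H _ e0; rewrite near_withinE => /near2P[d' d'0 {}H].
  exists (Num.min d d'); first by rewrite lt_min d0.
  move=> z' /near2_min[h1 h2].
  have [->|/eqP zz] := eqVneq z' z.
    by rewrite !subrr mulr0 subrr normc0 mulr0.
  rewrite -E ?inj//; apply: ler_wpM2r; first exact: normc_ge0.
  by apply: H => //; apply/eqP.
- move=> H; apply/mx_cvgP => e e0.
  have H' (ij : 'I_m * 'I_n) : {d : R | 0 < d & forall z', near2 z d z' ->
      normc (f z' ij.1 ij.2 - f z ij.1 ij.2 - l ij.1 ij.2 * (proj z' - proj z)) <=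
      e * normc (proj z' - proj z)}.
    by apply: cid2; exact: H.
  have : \forall z' \near z, z' != z -> forall ij : 'I_m * 'I_n,
      normc (((proj z' - proj z)^-1 *: (f z' - f z)) ij.1 ij.2 - l ij.1 ij.2) <= e.
    have H2 : \forall z' \near z, forall ij : 'I_m * 'I_n, near2 z (s2val (H' ij)) z'.
      have H4 ij : \forall z' \near z, near2 z (s2val (H' ij)) z'.
        by apply/near2P; exists (s2val (H' ij)) => //; case: (H' ij).
      exact: filter_forall H4.
    have H3 : \forall z' \near z, near2 z d z' by apply/near2P; exists d.
    apply: filterS2 H2 H3 => z' h2 h3 /eqP zz ij.
    have nz := inj _ h3 zz.
    rewrite -(ler_pM2r (_ : 0 < normc (proj z' - proj z))) ?normc_gt0// E//.
    by have := h2 ij; case: (H' ij) => /= t t0 Ht /Ht.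
  move=> K; rewrite near_withinE; apply: filterS K => z' K zz i j.
  exact: (K zz (i, j)).
Qed.

End ComplexDerivatives.

Lemma pdN {R : realType} (p f : R * R -> R[i]) z l :
  pd p f z l -> pd p (fun z => - f z) z (- l).
Proof.
move=> H e /H[d d0 {}H]; exists d => // z' /H.
by rewrite -normcN; congr (Normc.normc _ <= _); ring.
Qed.

Lemma cont2_fst {R : realType} (f df : R -> R[i]) (z : R * R) :
  (forall t, cder f t (df t)) ->
  cont2 (fun w => f w.1) z.
Proof.
move=> H e e0; have [d d0 {}H] := cder_cont (H z.1) e0.
by exists d => // z' [h _]; exact: H.
Qed.

Lemma cont2_snd {R : realType} (f df : R -> R[i]) (z : R * R) :
  (forall t, cder f t (df t)) ->
  cont2 (fun w => f w.2) z.
Proof.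
move=> H e e0; have [d d0 {}H] := cder_cont (H z.2) e0.
by exists d => // z' [_ h]; exact: H.
Qed.

Lemma proj_cont {R : realType} (z : R * R) : cont2 (proj : R * R -> R[i]) z.
Proof.
apply: cont2M; last exact: cont2_snd (@cder_cis R).
by apply: (cont2_fst (df := fun=> 1)) => x; apply: cder_real; exact: is_derive_id.
Qed.

Section CoverEquation.
Context {R : realType}.
Variable a : R.
Hypothesis a0 : 0 < a.

(* A global chart of [cover_gt a], so that the equation lives on the plane. *)
Definition chart (w : R * R) : R * R := (a + expR w.1, w.2).
Definition chart_inv (z : R * R) : R * R := (ln (z.1 - a), z.2).

Lemma chart_gt w : a < (chart w).1.
Proof. by rewrite /= ltrDl expR_gt0. Qed.

Lemma chartK w : chart_inv (chart w) = w.
Proof. by rewrite /chart_inv /= addrAC subrr add0r expRK; case: w. Qed.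

Lemma chart_invK z : a < z.1 -> chart (chart_inv z) = z.
Proof.
by move=> az; rewrite /chart /= lnK ?posrE ?subr_gt0// subrKC; case: z az.
Qed.

Lemma chart_cont w (e : R) : 0 < e ->
  exists2 d : R, 0 < d & forall w', near2 w d w' -> near2 (chart w) e (chart w').
Proof.
move=> e0.
have /cvgrPdist_lt/(_ e e0) : {for w.1, continuous (@expR R)} by exact: continuous_expR.
move=> [d/= d0 H]; exists (Num.min d e); first by rewrite lt_min d0.
move=> w' /near2_min[[h1 _] [_ h2]]; split => //=.
rewrite opprD addrACA subrr add0r distrC; apply: H.
by rewrite /ball_/= distrC.
Qed.

Lemma chart_inv_cont z (e : R) : a < z.1 -> 0 < e ->
  exists2 d : R, 0 < d &
    forall z', near2 z d z' -> near2 (chart_inv z) e (chart_inv z').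
Proof.
move=> az e0.
have /cvgrPdist_lt/(_ e e0) : {for z.1 - a, continuous (@ln R)}.
  by apply: continuous_ln; rewrite subr_gt0.
move=> [d/= d0 H]; exists (Num.min d e); first by rewrite lt_min d0.
move=> z' /near2_min[[h1 _] [_ h2]]; split => //=.
rewrite distrC; apply: H; rewrite /ball_/=.
by rewrite (_ : z.1 - a - (z'.1 - a) = z.1 - z'.1); [rewrite distrC|ring].
Qed.

Let p : R * R -> R[i] := proj \o chart.
Let p1 (w : R * R) : R[i] := (expR w.1)%:C * cis w.2.
Let p2 (w : R * R) : R[i] := (a + expR w.1)%:C * ('i * cis w.2).

Lemma chart_d1 x y : cder (fun s => p (s, y)) x (p1 (x, y)).
Proof.
have D : is_derive x (1 : R) (fun s => a + expR s) (expR x).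
  have -> : (fun s => a + expR s) = cst a + @expR R by [].
  by apply: derive_eq (is_deriveD (is_derive_cst _ _ _) (is_derive_expR x)); rewrite add0r.
by apply: cder_eq (cderM (cder_real D) (cder_cst (cis y) x)); rewrite mulr0 addr0.
Qed.

Lemma chart_d2 x y : cder (fun s => p (x, s)) y (p2 (x, y)).
Proof.
apply: cder_eq (cderM (cder_cst (a + expR x)%:C y) (cder_cis y)).
by rewrite mul0r add0r.
Qed.

Lemma chart_p1_cont z : cont2 p1 z.
Proof.
apply: cont2M; first exact: cont2_fst (fun t => cder_real (is_derive_expR t)).
exact: cont2_snd (@cder_cis R).
Qed.

Lemma chart_p2_cont z : cont2 p2 z.
Proof.
have D (x : R) : is_derive x (1 : R) (fun s => a + expR s) (expR x).
  have -> : (fun s => a + expR s) = cst a + @expR R by [].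
  by apply: derive_eq (is_deriveD (is_derive_cst _ _ _) (is_derive_expR x)); rewrite add0r.
apply: cont2M; first exact: cont2_fst (fun t => cder_real (D t)).
apply: cont2M; first exact: cont2_cst.
exact: cont2_snd (@cder_cis R).
Qed.

Lemma chart_low z : exists c d : R, [/\ 0 < c, 0 < d &
  forall z', near2 z d z' -> c * dist1 z z' <= normc (p z' - p z)].
Proof.
have [c [d [c0 d0 H]]] := @proj_low R (chart z) (lt_trans a0 (chart_gt z)).
have [d' d'0 H'] := chart_cont z d0.
(* [expR v - expR u >= expR u * (v - u)], and the smaller of the two first coordinates is at least
   [z.1 - 1]; the angular coordinate is unchanged, hence the 1. *)
pose k := Num.min 1 (expR (z.1 - 1)).
have k0 : 0 < k by rewrite lt_min ltr01 expR_gt0.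
exists (c * k), (Num.min d' 1); split; [by rewrite mulr_gt0|by rewrite lt_min d'0 ltr01|].
move=> z' /near2_min[/H' h1 [h2 _]].
apply: le_trans (H _ h1); rewrite -mulrA ler_pM2l// /dist1 mulrDr.
apply: lerD; last by rewrite ler_piMl// ge_min lexx.
rewrite /= opprD addrACA subrr add0r.
have ex (u v : R) : u <= v -> z.1 - 1 <= u -> k * (v - u) <= expR v - expR u.
  move=> uv zu; have -> : expR v = expR u * expR (v - u) by rewrite -expRD subrKC.
  have g : 1 + (v - u) <= expR (v - u) by exact: expR_ge1Dx.
  have ku : k <= expR u by rewrite /k ge_min orbC ler_expR zu.
  have : expR u * (1 + (v - u)) <= expR u * expR (v - u) by rewrite ler_pM2l// expR_gt0.
  have : k * (v - u) <= expR u * (v - u) by rewrite ler_wpM2r ?subr_ge0.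
  by lra.
move: h2; rewrite ltr_norml => /andP[h2 h3].
have [zz|/ltW zz] := leP z.1 z'.1.
  rewrite [leRHS]ger0_norm ?subr_ge0 ?ler_expR// ger0_norm ?subr_ge0//.
  by apply: ex => //; lra.
rewrite distrC [leRHS]distrC [leRHS]ger0_norm ?subr_ge0 ?ler_expR//.
by rewrite ger0_norm ?subr_ge0//; apply: ex => //; lra.
Qed.

Lemma pd_chart_inv f z l : a < z.1 ->
  pd p (f \o chart) (chart_inv z) l -> pd proj f z l.
Proof.
move=> az H e e0.
have [d d0 {}H] := H e e0; have [d' d'0 H'] := chart_inv_cont az d0.
have azd : 0 < z.1 - a by rewrite subr_gt0.
exists (Num.min d' (z.1 - a)); first by rewrite lt_min d'0.
move=> z' /near2_min[/H'/H h [h1 _]].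
have az' : a < z'.1 by move: h1; rewrite ltr_norml => /andP[]; lra.
by move: h; rewrite /p /comp !(chart_invK az, chart_invK az').
Qed.

Variables (n : nat) (A : 'I_n -> 'I_n -> R * R -> R[i]).
Hypothesis A_pd : forall i j z, a < z.1 -> exists l, pd proj (A i j) z l.

Definition cover_solution (u : 'I_n -> R * R -> R[i]) :=
  forall z, a < z.1 -> forall i, pd proj (u i) z (\sum_j A i j z * u j z).

Let B i j w := A i j (chart w).

Lemma chart_A_pd i j w : exists l, pd p (B i j) w l.
Proof.
have [l Hl] := A_pd i j (chart_gt w); exists l.
by apply: (pd_comp (k := chart)) => // e; exact: chart_cont.
Qed.

Lemma cover_solution_exists (z0 : R * R) (c : 'I_n -> R[i]) : a < z0.1 ->
  exists u, cover_solution u /\ forall i, u i z0 = c i.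
Proof.
move=> az0.
have [Y [Y0 HY]] := picard chart_d1 chart_d2 chart_p1_cont chart_p2_cont chart_low
  chart_A_pd (chart_inv z0) c.
exists (fun i z => Y i (chart_inv z)); split => [z az i|i]; last by rewrite Y0.
apply: (pd_chart_inv az).
apply: (@pd_ext _ _ (Y i)); first by move=> w; rewrite /= chartK.
by apply: pd_eq (HY i _); apply: eq_bigr => j _; rewrite /B chart_invK.
Qed.

Lemma cover_solution_dependence (z0 z : R * R) : a < z0.1 -> a < z.1 ->
  exists2 C : R, 0 <= C & forall u, cover_solution u ->
    energy (u^~ z) <= C * energy (u^~ z0).
Proof.
move=> az0 az.
have [C C0 H] := linear_dependence chart_d1 chart_d2 chart_p1_cont chart_p2_cont
  chart_A_pd (chart_inv z0) (chart_inv z).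
exists C => // u Hu; have := H (fun i w => u i (chart w)).
rewrite /= !chart_invK//; apply => i w.
apply: (@pd_comp R proj chart (u i) w); first by move=> e; exact: chart_cont.
exact: Hu _ (chart_gt w) i.
Qed.

Lemma cover_solutionB u v : cover_solution u -> cover_solution v ->
  cover_solution (fun i z => u i z - v i z).
Proof.
move=> Hu Hv z az i.
have h1 := Hu z az i; have h2 := Hv z az i.
apply: pd_eq (pdD h1 (pdN h2)).
by rewrite -sumrB; apply: eq_bigr => j _; rewrite mulrBr.
Qed.

End CoverEquation.

(** * Comparison of an arbitrary matrix norm with the entries *)

Section NormEquivalence.
Context {R : realType}.

(** The norm has a positive minimum on every face of the unit cube, a product of compact sets
    avoiding 0. Rescaling by the largest coordinate moves any nonzero vector onto a face. *)
Lemma rV_norm_equivalence k (f : 'rV[R]_k -> R) :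
  (forall v, f v = 0 -> v = 0) -> (forall v w, f (v + w) <= f v + f w) ->
  (forall c v, f (c *: v) = `|c| * f v) ->
  exists2 K : R, 0 <= K & forall (v : 'rV[R]_k) j, `|v ord0 j| <= K * f v.
Proof.
move=> f0 fD fZ.
have f00 : f 0 = 0 by rewrite -(scale0r 0) fZ normr0 mul0r.
have fN v : f (- v) = f v by rewrite -scaleN1r fZ normrN normr1 mul1r.
have fge0 v : 0 <= f v.
  by have := fD v (- v); rewrite subrr f00 fN; lra.
pose C := \sum_j f (delta_mx ord0 j).
have C0 : 0 <= C by exact: sumr_ge0.
have fle (v : 'rV[R]_k) t : 0 <= t -> (forall j, `|v ord0 j| <= t) -> f v <= t * C.
  move=> t0 vt; rewrite (row_sum_delta v) /C mulr_sumr.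
  elim/big_ind2 : _ => [|x1 x2 y1 y2 h1 h2|j _]; first by rewrite f00.
    exact: le_trans (fD _ _) (lerD h1 h2).
  by rewrite fZ ler_wpM2r.
have fcont : continuous f.
  move=> v; apply/(@cvgrPdist_le _ _ _ _ (@nbhs_filter _ v)) => e e0.
  have eC : 0 < e / (C + 1) by rewrite divr_gt0// ltr_wpDl.
  apply/nbhs_ballP; exists (e / (C + 1)) => //= w [_ b].
  have h (u u' : 'rV[R]_k) : (forall j, `|(u - u') ord0 j| <= e / (C + 1)) -> f u - f u' <= e.
    move=> huu; rewrite lerBlDr; apply: le_trans (_ : _ <= f (u - u') + f u') _.
      by have := fD (u - u') u'; rewrite subrK.
    rewrite lerD2r; apply: le_trans (fle _ _ (ltW eC) huu) _.
    by rewrite mulrAC ler_pdivrMr ?ltr_wpDl// ler_pM2l// lerDl.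
  have b1 j : `|(v - w) ord0 j| <= e / (C + 1).
    by rewrite !mxE; exact: ltW (b ord0 j).
  rewrite ler_norml lerNl opprB; apply/andP; split; apply: h => // j.
  by have := b1 j; rewrite !mxE distrC.
have face (x : 'I_k * bool) : {m : R | 0 < m & forall v : 'rV[R]_k,
    (forall j, `|v ord0 j| <= 1) -> v ord0 x.1 = (-1) ^+ x.2 -> m <= f v}.
  case: x => i b /=; apply: cid2.
  pose A j : set R := if j == i then [set (-1) ^+ b] else `[-1, 1]%classic.
  pose S := [set v : 'rV[R]_k | forall j, A j (v ord0 j)].
  have cS : compact S.
    apply: rV_compact => j; rewrite /A; case: ifP => _; first exact: compact_set1.
    exact: segment_compact.
  have S0 : S !=set0.
    exists ((-1) ^+ b *: delta_mx ord0 i) => j; rewrite /A !mxE eqxx /=.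
    case: eqP => [_|_]; first by rewrite mulr1.
    by rewrite mulr0 /= in_itv /= lerN10 ler01.
  have [v vS vm] := compact_EVT_min S0 cS (continuous_subspaceT fcont).
  exists (f v).
    rewrite lt_neqAle fge0 andbT eq_sym; apply/eqP => /f0 v0.
    move: vS; rewrite inE => /(_ i); rewrite /A eqxx v0 mxE /= => /esym/eqP.
    by rewrite signr_eq0.
  move=> w w1 wi; apply: vm; rewrite inE => j; rewrite /A.
  case: eqP => [->|_]; first by rewrite /= wi.
  by rewrite /= in_itv/= -ler_norml.
have m0 x : 0 < s2val (face x) by case: (face x).
exists (\sum_x (s2val (face x))^-1).
  by apply: sumr_ge0 => x _; rewrite invr_ge0 ltW.
move=> v j.
have [i _ imax] := @Order.TotalTheory.arg_maxP _ _ _ j xpredT (fun i => `|v ord0 i|) isT.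
apply: le_trans (imax j isT) _.
have [t0|t0] := eqVneq `|v ord0 i| 0.
  by rewrite /= t0 mulr_ge0// sumr_ge0// => x _; rewrite invr_ge0 ltW.
have tp : 0 < `|v ord0 i| by rewrite lt_neqAle eq_sym t0 normr_ge0.
(* The face met by [v] divided by [|v_i|]: the index of a largest coordinate together with its
   sign. *)
pose x : 'I_k * bool := (i, v ord0 i < 0).
have hx : s2val (face x) * `|v ord0 i| <= f v.
  have -> : f v = f (`|v ord0 i|^-1 *: v) * `|v ord0 i|.
    by rewrite fZ ger0_norm ?invr_ge0// mulrAC mulVf// mul1r.
  rewrite ler_pM2r//; case: (face x) => /= m mp; apply => [j'|].
    rewrite mxE normrM ger0_norm ?invr_ge0// mulrC ler_pdivrMr// mul1r.
    exact: imax.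
  rewrite mxE /x /=; have [neg|pos] := ltP (v ord0 i) 0.
    by rewrite ltr0_norm// invrN mulNr mulVf// -normr_eq0.
  by rewrite ger0_norm// mulVf// -normr_eq0.
rewrite -ler_pdivlMl// in hx.
apply: le_trans hx _; rewrite ler_wpM2r//.
by rewrite (bigD1 x)//= lerDl sumr_ge0// => y _; rewrite invr_ge0 ltW.
Qed.

Variables (n : nat) (N : 'M[R[i]]_n -> R).
Hypothesis HN : is_norm N.

Lemma mxnorm_ge0 A : 0 <= N A.
Proof.
case: HN => [_ ND NZ].
have N0 : N 0 = 0 by rewrite -(scale0r 0) NZ Re_norm normc0 mul0r.
have NN : N (- A) = N A by rewrite -scaleN1r NZ Re_norm normcN Normc.normc1 mul1r.
by have := ND A (- A); rewrite subrr N0 NN; lra.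
Qed.

Lemma mxnorm_entry : exists2 K : R, 0 <= K &
  forall (A : 'M[R[i]]_n) i j, normc (A i j) <= K * N A.
Proof.
case: HN => [N0 ND NZ].
pose k := (n * n)%N.
pose M (v : 'rV[R]_(k + k)) : 'M[R[i]]_n :=
  \matrix_(i, j) (lsubmx v ord0 (mxvec_index i j) +i* rsubmx v ord0 (mxvec_index i j)).
have [|||K K0 HK] := @rV_norm_equivalence (k + k) (N \o M).
- move=> v /N0 Mv; rewrite -(hsubmxK v).
  suff [-> ->] : lsubmx v = 0 /\ rsubmx v = 0 by rewrite row_mx0.
  split; apply/rowP => x; case/mxvec_indexP: x => i j;
    by have /matrixP/(_ i j) := Mv; rewrite mxE [in RHS]mxE => -[h1 h2];
      rewrite [RHS]mxE ?h1 ?h2.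
- move=> v w /=; apply: le_trans (ND _ _); rewrite le_eqVlt; apply/orP; left.
  by apply/eqP; congr N; apply/matrixP => i j; rewrite !mxE.
- move=> c v /=; rewrite -[`|c|]normc_real -Re_norm -NZ; congr N.
  by apply/matrixP => i j; rewrite !mxE; apply: complexP; rewrite ?ReM ?ImM/=; ring.
exists (K + K) => [|A i j]; first by rewrite addr_ge0.
pose v : 'rV[R]_(k + k) := row_mx (mxvec (map_mx (@complex.Re R) A))
                                  (mxvec (map_mx (@complex.Im R) A)).
have Mv : M v = A.
  apply/matrixP => i' j'; rewrite mxE /v row_mxKl row_mxKr !mxvecE !mxE.
  exact: complexP.
apply: le_trans (normc_le _) _; rewrite mulrDl -Mv; apply: lerD.
- by rewrite mxE /= mxE; exact: HK.
- by rewrite mxE /= mxE; exact: HK.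
Qed.

(** Continuity of [N] in the entries; it makes the norm of [P] continuous along lines, as required
    for taking a primitive of it. *)
Lemma mxnorm_cont (A B : 'M[R[i]]_n) :
  `|N A - N B| <= \sum_i \sum_j normc (A i j - B i j) * N (delta_mx i j).
Proof.
case: HN => [_ ND NZ].
have N0 : N 0 = 0 by rewrite -(scale0r 0) NZ Re_norm normc0 mul0r.
have le (C : 'M[R[i]]_n) : N C <= \sum_i \sum_j normc (C i j) * N (delta_mx i j).
  rewrite {1}(matrix_sum_delta C).
  elim/big_ind2 : _ => [|x1 x2 y1 y2 h1 h2|i _]; first by rewrite N0.
    exact: le_trans (ND _ _) (lerD h1 h2).
  elim/big_ind2 : _ => [|x1 x2 y1 y2 h1 h2|j _]; first by rewrite N0.
    exact: le_trans (ND _ _) (lerD h1 h2).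
  by rewrite NZ Re_norm.
have h (C D : 'M[R[i]]_n) : N C - N D <= \sum_i \sum_j normc (C i j - D i j) * N (delta_mx i j).
  rewrite lerBlDr; apply: le_trans (_ : _ <= N (C - D) + N D) _.
    by have := ND (C - D) D; rewrite subrK.
  rewrite lerD2r; apply: le_trans (le _) _.
  by apply: ler_sum => i _; apply: ler_sum => j _; rewrite !mxE.
rewrite ler_norml lerNl opprB h andbT; apply: le_trans (h _ _) _.
by apply: ler_sum => i _; apply: ler_sum => j _; rewrite normcBC.
Qed.

End NormEquivalence.

Section PowersOnTheCover.
Context {R : realType}.

Lemma powR_mul1 (r s : R) : 0 < r -> r `^ (s - 1) * r = r `^ s.
Proof.
move=> r0; rewrite -{2}(powRr1 (ltW r0)) -powRD ?subrK//.
by apply/implyP => _; rewrite gt_eqF.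
Qed.

Lemma is_derive_powR_comp (r : R -> R) (t dr s : R) : 0 < r t ->
  is_derive t (1 : R) r dr ->
  is_derive t (1 : R) (fun u => r u `^ s) (s * r t `^ (s - 1) * dr).
Proof.
by move=> r0 Dr; exact: (is_derive1_comp (is_derive1_powR s r0) Dr).
Qed.

Lemma cder_cis_comp (th : R -> R) (t dth : R) :
  is_derive t (1 : R) th dth ->
  cder (fun u => cis (th u)) t ('i * cis (th t) * dth%:C).
Proof. by move=> D; exact: (@cder_comp R cis th t _ _ (cder_cis (th t)) D). Qed.

(** The last factor is the derivative of [proj] along the path ([cder_proj]), so this is the chain
    rule for the power function in polar coordinates. *)
Lemma cder_zpow (r th : R -> R) (t dr dth s : R) : 0 < r t ->
  is_derive t (1 : R) r dr -> is_derive t (1 : R) th dth ->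
  cder (fun u => zpow s (r u, th u)) t
    (s%:C * zpow (s - 1) (r t, th t) * ((dr +i* (r t * dth)) * cis (th t))).
Proof.
move=> r0 Dr Dth.
have Dsth : is_derive t (1 : R) (fun u => s * th u) (s * dth).
  by apply: derive_eq (is_deriveZ s Dth); rewrite /GRing.scale.
apply: cder_eq (cderM (cder_real (is_derive_powR_comp s r0 Dr)) (cder_cis_comp Dsth)).
rewrite /zpow /modulus /argument /=.
have -> : s * th t = (s - 1) * th t + th t by ring.
rewrite cisD -(powR_mul1 s r0); move: (r t `^ (s - 1)) => q.
by apply: complexP; rewrite !(ReD, ImD, ReM, ImM)/=; ring.
Qed.

Lemma cder_proj (r th : R -> R) (t dr dth : R) : 0 < r t ->
  is_derive t (1 : R) r dr -> is_derive t (1 : R) th dth ->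
  cder (fun u => proj (r u, th u)) t ((dr +i* (r t * dth)) * cis (th t)).
Proof.
move=> r0 Dr Dth; apply: cder_eq (cderM (cder_real Dr) (cder_cis_comp Dth)).
rewrite /modulus /argument /=.
by apply: complexP; rewrite !(ReD, ImD, ReM, ImM)/=; ring.
Qed.

Lemma cder_unique (f : R -> R[i]) (t : R) (l m : R[i]) :
  cder f t l -> cder f t m -> l = m.
Proof.
move=> [[_ f1] [_ f2]] [[_ g1] [_ g2]].
by apply: complexP; [rewrite -f1 -g1|rewrite -f2 -g2].
Qed.

Lemma normc_zpow (s : R) (z : R * R) : normc (zpow s z) = z.1 `^ s.
Proof. by rewrite /zpow normcM normc_cis mulr1 normc_real ger0_norm ?powR_ge0. Qed.

(** In the chart both partial derivatives of [zpow s] are [s * zpow (s - 1)] times those of [proj],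
    which is the hypothesis of [pd_partials]. *)
Lemma zpow_pd (a s : R) (z : R * R) : 0 < a -> a < z.1 ->
  pd proj (zpow s) z (s%:C * zpow (s - 1) z).
Proof.
move=> a0 az.
have ch w : 0 < (chart a w).1 by exact: lt_trans a0 (chart_gt a w).
have De (x : R) : is_derive x (1 : R) (fun s => a + expR s) (expR x).
  have -> : (fun s => a + expR s) = cst a + @expR R by [].
  by apply: derive_eq (is_deriveD (is_derive_cst _ _ _) (is_derive_expR x)); rewrite add0r.
have cont w : cont2 (fun w => s%:C * zpow (s - 1) (chart a w)) w.
  apply: cont2M; first exact: cont2_cst.
  apply: cont2M.
  - apply: (@cont2_fst _ (fun x => ((a + expR x) `^ (s - 1))%:C)
      (fun x => ((s - 1) * (a + expR x) `^ (s - 1 - 1) * expR x)%:C)) => t.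
    apply: cder_real; apply: (@is_derive_powR_comp (fun x => a + expR x)) => //.
    exact: ch (t, 0).
  - apply: (@cont2_snd _ (fun x => cis ((s - 1) * x))
      (fun t => 'i * cis ((s - 1) * t) * (s - 1)%:C)) => t.
    apply: cder_cis_comp.
    have D := is_deriveZ (s - 1) (is_derive_id t (1 : R)).
    by apply: derive_eq D; rewrite /GRing.scale/= mulr1.
have := @pd_partials R _ _ _ (chart_d1 a) (chart_d2 a) (@chart_p1_cont R)
  (chart_p2_cont a) (chart_low a0) (fun w => zpow s (chart a w))
  (fun w => s%:C * zpow (s - 1) (chart a w)) (chart_inv a z).
move=> H; apply: (pd_chart_inv az); apply: pd_eq (H _ _ _) => //.
- by rewrite chart_invK.
- move=> x y.
  apply: cder_eq (@cder_zpow (fun u => a + expR u) (fun=> y) x _ _ s (ch (x, y)) (De x)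
    (is_derive_cst y x 1)).
  by rewrite mulr0.
- move=> x y.
  apply: cder_eq (@cder_zpow (fun=> a + expR x) id y _ _ s (ch (x, y))
    (is_derive_cst (a + expR x) y 1) (is_derive_id y 1)).
  by rewrite mulr1 /chart /=; congr (_ * _); apply: complexP; rewrite !(ReM, ImM)/=; ring.
Qed.

End PowersOnTheCover.

(** * Lines in a given direction, lifted to the universal cover *)

Section Lines.
Context {R : realType}.

(* [line psi eps b] runs along a line of the plane in direction [psi]; the two
   signs of [eps] say on which side of the line the origin lies. *)
Definition line (psi eps b t : R) : R * R :=
  ell_param (psi - eps * (pi / 2)) b (eps * t).

Lemma cis_pihalf : cis (pi / 2) = 'i :> R[i].
Proof. by rewrite /cis cos_pihalf sin_pihalf. Qed.

Lemma is_derive_atan_div (b t : R) : 0 < b ->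
  is_derive t (1 : R) (fun u => atan (u / b)) (b / (b ^+ 2 + t ^+ 2)).
Proof.
move=> b0.
have D : is_derive t (1 : R) (fun u => u / b) b^-1.
  have -> : (fun u : R => u / b) = b^-1 \*: (@id R).
    by apply/funext => u /=; rewrite mulrC.
  by apply: derive_eq (is_deriveZ _ (is_derive_id t 1)); rewrite /GRing.scale/= mulr1.
apply: derive_eq (@is_derive1_comp R atan (fun u => u / b) t _ _ (is_derive1_atan _) D).
have b1 : b != 0 by rewrite gt_eqF.
have p1 : b ^+ 2 + t ^+ 2 != 0 by rewrite gt_eqF// ltr_wpDr ?sqr_ge0// exprn_gt0.
have p2 : 1 + (t / b) ^+ 2 != 0 by rewrite gt_eqF// ltr_wpDr ?sqr_ge0.
have e : 1 + (t / b) ^+ 2 = (b ^+ 2 + t ^+ 2) / b ^+ 2 by field.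
by rewrite e; field; rewrite p1 b1.
Qed.

Lemma is_derive_hyp (b t : R) : 0 < b ->
  is_derive t (1 : R) (fun u => Num.sqrt (b ^+ 2 + u ^+ 2))
    (t / Num.sqrt (b ^+ 2 + t ^+ 2)).
Proof.
move=> b0.
have p1 : 0 < b ^+ 2 + t ^+ 2 by rewrite ltr_wpDr ?sqr_ge0// exprn_gt0.
have D : is_derive t (1 : R) (fun u => b ^+ 2 + u ^+ 2) (2 * t).
  have -> : (fun u => b ^+ 2 + u ^+ 2) = cst (b ^+ 2) + (@id R) ^+ 2.
    by apply/funext => u.
  apply: derive_eq (is_deriveD (is_derive_cst _ _ _) (is_deriveX 2 (is_derive_id t 1))).
  by rewrite /GRing.scale/= expr1 add0r mulr1.
apply: derive_eq (@is_derive1_comp R Num.sqrt (fun u => b ^+ 2 + u ^+ 2) t _ _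
  (is_derive1_sqrt p1) D).
by field; rewrite gt_eqF// sqrtr_gt0.
Qed.

Lemma ell_modulus (phi b t : R) : 0 < b -> b <= (ell_param phi b t).1.
Proof.
move=> b0; rewrite /= -{1}(gtr0_norm b0) -sqrtr_sqr ler_wsqrtr// lerDl.
exact: sqr_ge0.
Qed.

Lemma line_modulus (psi eps b t : R) : 0 < b -> b <= (line psi eps b t).1.
Proof. exact: ell_modulus. Qed.

(** The polar velocity is identified by uniqueness of derivatives: by [proj_ell_param] the projected
    curve is affine in the parameter, with velocity [cis psi]. *)
Lemma line_derive (psi eps b t : R) : 0 < b -> eps = 1 \/ eps = -1 ->
  exists dr dth : R, [/\
    is_derive t (1 : R) (fun u => (line psi eps b u).1) dr,
    is_derive t (1 : R) (fun u => (line psi eps b u).2) dth &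
    (dr +i* ((line psi eps b t).1 * dth)) * cis (line psi eps b t).2 = cis psi].
Proof.
move=> b0 he.
have De : is_derive t (1 : R) (fun u => eps * u) eps.
  by apply: derive_eq (is_deriveZ eps (is_derive_id t 1)); rewrite /GRing.scale/= mulr1.
have D1 := @is_derive1_comp R (fun u => Num.sqrt (b ^+ 2 + u ^+ 2)) (fun u => eps * u) t
  _ _ (is_derive_hyp (eps * t) b0) De.
have D2' := @is_derive1_comp R (fun u => atan (u / b)) (fun u => eps * u) t
  _ _ (is_derive_atan_div (eps * t) b0) De.
have D2 := is_deriveD (is_derive_cst (psi - eps * (pi / 2)) t 1) D2'.
do 2 eexists; split; [exact: D1|exact: D2|].
have r0 : 0 < (line psi eps b t).1 by apply: lt_le_trans (line_modulus _ _ _ b0).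
have C1 := @cder_proj R (fun u => (line psi eps b u).1) (fun u => (line psi eps b u).2)
  t _ _ r0 D1 D2.
apply: cder_unique C1 _.
apply: (@cder_ext _ (fun u => cis (psi - eps * (pi / 2)) * (b%:C + 'i * (eps * u)%:C))).
  move=> u; rewrite -[RHS]/(proj (ell_param (psi - eps * (pi / 2)) b (eps * u))).
  rewrite proj_ell_param//; congr (_ * _).
  by apply: complexP; rewrite !(ReD, ImD, ReM, ImM)/=; ring.
apply: cder_eq (cderM (cder_cst _ t) (cderD (cder_cst _ t) (cderM (cder_cst 'i t)
  (cder_real De)))).
rewrite !mul0r !add0r.
have -> : 'i * eps%:C = cis (eps * (pi / 2)) :> R[i].
  case: he => ->; first by rewrite mul1r cis_pihalf mulr1.
  rewrite mulN1r /cis cosN sinN cos_pihalf sin_pihalf.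
  by apply: complexP; rewrite !(ReM, ImM)/=; ring.
by rewrite -cisD subrK.
Qed.

Lemma line_cont (psi eps b t e : R) : 0 < b -> eps = 1 \/ eps = -1 -> 0 < e ->
  exists2 d : R, 0 < d & forall s, `|s - t| < d ->
    near2 (line psi eps b t) e (line psi eps b s).
Proof.
move=> b0 he e0; have [dr [dth [D1 D2 _]]] := line_derive psi t b0 he.
have e2 : 0 < e / 2 by rewrite divr_gt0.
have [d d0 H] := cder_cont (cder_real D1) e2.
have [d' d'0 H'] := cder_cont (cder_real D2) e2.
exists (Num.min d d'); first by rewrite lt_min d0.
move=> s; rewrite lt_min => /andP[/H h /H' h'].
rewrite -rmorphB normc_real in h; rewrite -rmorphB normc_real in h'.
by split; [apply: le_lt_trans h _|apply: le_lt_trans h' _]; lra.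
Qed.

Lemma line_proj_cder (psi eps b t : R) : 0 < b -> eps = 1 \/ eps = -1 ->
  cder (proj \o line psi eps b) t (cis psi).
Proof.
move=> b0 he; have [dr [dth [D1 D2 <-]]] := line_derive psi t b0 he.
by apply: (@cder_proj R (fun u => (line psi eps b u).1) (fun u => (line psi eps b u).2)
  t _ _ _ D1 D2); apply: lt_le_trans (line_modulus _ _ _ b0).
Qed.

Lemma line_zpow_cder (psi eps b t s : R) : 0 < b -> eps = 1 \/ eps = -1 ->
  cder (fun u => zpow s (line psi eps b u)) t
    (s%:C * zpow (s - 1) (line psi eps b t) * cis psi).
Proof.
move=> b0 he; have [dr [dth [D1 D2 <-]]] := line_derive psi t b0 he.
by apply: (@cder_zpow R (fun u => (line psi eps b u).1) (fun u => (line psi eps b u).2)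
  t _ _ s _ D1 D2); apply: lt_le_trans (line_modulus _ _ _ b0).
Qed.

End Lines.

(** * Consequences of the good decay condition *)

Section Decay.
Context {R : realType} {n : nat}.
Variables (a : R) (N : 'M[R[i]]_n -> R) (P : R * R -> 'M[R[i]]_n).
Hypothesis a0 : 0 < a.
Hypothesis HN : is_norm N.
Hypothesis P_pd : forall i j z, a < z.1 ->
  exists l, pd proj (fun z => P z i j) z l.
Hypothesis P_decay : forall I : set R, open I -> is_interval I ->
  good_decay N a P I.

Definition ell_L1 (phi b : R) : R :=
  fine (\int[lebesgue_measure]_t (N (P (ell_param phi b t)))%:E)%E.

(** The decay condition on the whole real line, applied to the degenerate segment [[phi, phi]]. *)
Lemma decay_at (phi : R) :
  (forall b, a < b -> lebesgue_measure.-integrable setT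
     (EFin \o (fun t => N (P (ell_param phi b t))))) /\
  (forall e : R, 0 < e -> exists2 b0 : R, a < b0 & forall b, b0 <= b -> ell_L1 phi b <= e).
Proof.
have iT : is_interval [set: R] by move=> x y _ _ z _.
have [H1 H2] := P_decay openT iT (lexx phi) (fun _ _ => I).
have I1 b : a < b -> lebesgue_measure.-integrable setT
     (EFin \o (fun t => N (P (ell_param phi b t)))).
  by apply: H1; rewrite in_itv/= lexx.
split => // e e0.
move/fine_cvgP : H2 => [H3 /cvgrPdist_le/(_ e e0) H2].
have {H3 H2} [M [_ HM]] := filterI H3 H2.
exists (Num.max (a + 1) (M + 1)); first by rewrite lt_max ltrDl ltr01.
move=> b; rewrite ge_max => /andP[b1 b2].
have [] := HM b; first by lra.
set S := ereal_sup _ => Sfin; rewrite sub0r normrN => Se.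
have le : (\int[lebesgue_measure]_t (N (P (ell_param phi b t)))%:E <= S)%E.
  by apply: ereal_sup_ubound; exists phi => //=; rewrite in_itv/= lexx.
apply: le_trans (_ : _ <= fine S) _; last first.
  by apply: le_trans (ler_norm _) Se.
apply: fine_le => //; apply: integrable_fin_num => //.
by apply: I1; lra.
Qed.

Lemma ell_norm_continuous (phi b : R) : a < b ->
  continuous (fun t => N (P (ell_param phi b t))).
Proof.
move=> ab t; have b0 : 0 < b by exact: lt_trans ab.
have lc e : 0 < e -> exists2 d : R, 0 < d & forall s, `|s - t| < d ->
    near2 (ell_param phi b t) e (ell_param phi b s).
  move=> e0; have [d d0 H] := @line_cont R (phi + pi / 2) 1 b t e b0 (or_introl erefl) e0.
  by exists d => // s /H; rewrite /line !mul1r addrK.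
apply/cvgrPdist_le => e e0.
pose C := \sum_i \sum_j N (delta_mx i j).
have C0 : 0 <= C.
  by apply: sumr_ge0 => i _; apply: sumr_ge0 => j _; exact: mxnorm_ge0 HN _.
have eC : 0 < e / (C + 1) by rewrite divr_gt0// ltr_wpDl.
have az : a < (ell_param phi b t).1 by apply: lt_le_trans (ell_modulus _ _ b0).
have D (ij : 'I_n * 'I_n) : {d : R | 0 < d & forall s, `|s - t| < d ->
    normc (P (ell_param phi b s) ij.1 ij.2 - P (ell_param phi b t) ij.1 ij.2) <= e / (C + 1)}.
  apply: cid2; have [l Hl] := P_pd ij.1 ij.2 az.
  have [d d0 H] := pd_cont2 (@proj_cont R) Hl eC.
  by have [d' d'0 H'] := lc d d0; exists d' => // s /H'/H.
have near_all : \forall s \near t, forall ij : 'I_n * 'I_n, `|s - t| < s2val (D ij).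
  have H4 ij : \forall s \near t, `|s - t| < s2val (D ij).
    have d0 : 0 < s2val (D ij) by case: (D ij).
    have : \forall s \near t, ball t (s2val (D ij)) s by exact: (@nbhsx_ballx _ _ t _ d0).
    by apply: filterS => s; rewrite /ball/= distrC.
  exact: filter_forall H4.
apply: filterS near_all => s hs.
apply: le_trans (mxnorm_cont HN _ _) _.
apply: (@le_trans _ _ (e / (C + 1) * C)).
  rewrite /C mulr_sumr; apply: ler_sum => i _; rewrite mulr_sumr.
  apply: ler_sum => j _; rewrite ler_wpM2r//; first exact: mxnorm_ge0 HN _.
  by rewrite normcBC; have := hs (i, j); case: (D (i, j)) => /= d _; exact.
by rewrite mulrAC ler_pdivrMr ?ltr_wpDl// ler_pM2l// lerDl.
Qed.

(** Increments of [Th] play the part of integrals of the norm over pieces of the line. In this form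
    they enter [energy_le] by differentiation alone, and the L^1 norm bounds them all. *)
Lemma ell_primitive (phi b : R) : a < b -> exists Th : R -> R,
  (forall t, is_derive t (1 : R) Th (N (P (ell_param phi b t)))) /\
  (forall t1 t2, t1 <= t2 -> 0 <= Th t2 - Th t1 <= ell_L1 phi b).
Proof.
move=> ab; have cN := @ell_norm_continuous phi b ab.
have [Th HTh] := antiderivative cN; exists Th; split => // t1 t2 t12.
have N0 t : 0 <= N (P (ell_param phi b t)) by exact: mxnorm_ge0 HN _.
have [iN _] := decay_at phi; have {}iN := iN b ab.
have L0 : 0 <= ell_L1 phi b.
  by apply: fine_ge0; apply: integral_ge0 => t _; rewrite lee_fin.
have [->|/eqP t12'] := eqVneq t1 t2; first by rewrite subrr lexx.
have lt12 : t1 < t2 by rewrite lt_neqAle t12 andbT; apply/eqP.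
have E : (\int[lebesgue_measure]_(t in `[t1, t2]) (N (P (ell_param phi b t)))%:E =
    (Th t2)%:E - (Th t1)%:E)%E.
  apply: continuous_FTC2 => //.
  - exact: continuous_subspaceT.
  - have dTh t : derivable Th t 1 by case: (HTh t).
    have cTh : continuous Th by move=> t; apply/differentiable_continuous/derivable1_diffP.
    by split => [t _|//|]; [exact: dTh|apply: cvg_at_right_filter; exact: cTh|
      apply: cvg_at_left_filter; exact: cTh].
  - by move=> t _; rewrite derive1E; case: (HTh t).
have le : (\int[lebesgue_measure]_(t in `[t1, t2]) (N (P (ell_param phi b t)))%:E <=
    \int[lebesgue_measure]_t (N (P (ell_param phi b t)))%:E)%E.
  apply: ge0_subset_integral => //.
  - by case/integrableP: iN.
  - by move=> t _; rewrite lee_fin.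
have ge : (0 <= \int[lebesgue_measure]_(t in `[t1, t2]) (N (P (ell_param phi b t)))%:E)%E.
  by apply: integral_ge0 => t _; rewrite lee_fin.
rewrite E -EFinB in le ge; rewrite lee_fin in ge; rewrite ge /=.
have F : (\int[lebesgue_measure]_t (N (P (ell_param phi b t)))%:E)%E \is a fin_num.
  by apply: integrable_fin_num.
by rewrite -lee_fin /ell_L1 fineK.
Qed.

Lemma line_primitive (psi eps b : R) : a < b -> eps = 1 \/ eps = -1 ->
  exists Th : R -> R,
    (forall t, is_derive t (1 : R) Th (N (P (line psi eps b t)))) /\
    (forall t1 t2, t1 <= t2 -> 0 <= Th t2 - Th t1 <= ell_L1 (psi - eps * (pi / 2)) b).
Proof.
move=> ab he; have [Th [H1 H2]] := @ell_primitive (psi - eps * (pi / 2)) b ab.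
case: he H1 H2 => -> H1 H2.
- exists (fun t => Th t); split=> [t|//].
  by rewrite /line [1 * t]mul1r; exact: H1.
- have dN (t : R) : is_derive t (1 : R) (fun s => - s) (-1).
    have -> : (fun s : R => - s) = - (@id R) by [].
    exact: is_deriveN.
  exists (fun t => - Th (- t)); split=> [t|t1 t2 t12].
    have D := @is_derive1_comp R Th (fun s => - s) t _ _ (H1 _) (dN t).
    apply: derive_eq (is_deriveN D).
    by rewrite /line [-1 * t]mulN1r mulrN1 opprK.
  have := H2 (- t2) (- t1); rewrite lerN2 => /(_ t12).
  by rewrite opprK addrC.
Qed.

End Decay.

(** * Recessive solutions *)

Section ComplexExponential.
Context {R : realType}.

Lemma cexpD (x y : R[i]) : cexp (x + y) = cexp x * cexp y.
Proof. by rewrite /cexp ReD ImD expRD cisD rmorphM mulrACA. Qed.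

Lemma cexpN (x : R[i]) : cexp x * cexp (- x) = 1.
Proof. by rewrite -cexpD subrr /cexp expR0 cis0 mulr1. Qed.

Lemma powR_small (del e : R) : 0 < del -> 0 < e ->
  exists2 X : R, 0 < X & forall r, X <= r -> r `^ (- del) <= e.
Proof.
move=> d0 e0; have ei : 0 < e^-1 by rewrite invr_gt0.
exists (e^-1 `^ del^-1) => [|r Xr]; first exact: powR_gt0.
have X0 : 0 < e^-1 `^ del^-1 by exact: powR_gt0.
have r0 : 0 < r by apply: lt_le_trans Xr.
rewrite powRN invf_ple ?posrE ?powR_gt0//.
apply: le_trans (_ : _ <= (e^-1 `^ del^-1) `^ del) _.
  by rewrite -powRrM mulVf ?gt_eqF// powRr1// ltW.
by apply: ge0_ler_powR => //; rewrite ?nnegrE ltW.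
Qed.

Lemma energyB_le n (v w : 'I_n -> R[i]) :
  energy (fun i => v i - w i) <= 2 * (energy v + energy w).
Proof.
rewrite /energy -big_split/= mulr_sumr; apply: ler_sum => i _.
have h := normcB (v i) (w i).
have : normc (v i - w i) ^+ 2 <= (normc (v i) + normc (w i)) ^+ 2.
  by apply: lerXn2r => //; rewrite nnegrE ?addr_ge0 ?normc_ge0.
have := sqr_ge0 (normc (v i) - normc (w i)).
by nra.
Qed.

Lemma line_end (psi eps b del X : R) : 0 < b -> eps = 1 \/ eps = -1 -> 0 < del ->
  exists T : R, forall t, T <= t ->
    X <= (line psi eps b t).1 /\ `|(line psi eps b t).2 - psi| <= del.
Proof.
move=> b0 he del0.
have := @cvgy_atan R; move=> /cvgrPdist_le/(_ _ del0)[M [_ HM]].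
exists (Num.max `|X| (b * (M + 1))) => t; rewrite ge_max => /andP[t1 t2]; split.
  apply: le_trans (ler_norm X) _; apply: le_trans t1 _.
  apply: le_trans (ler_norm t) _; rewrite -sqrtr_sqr /line /= ler_wsqrtr//.
  have -> : (eps * t) ^+ 2 = t ^+ 2 by case: he => ->; ring.
  by rewrite lerDr sqr_ge0.
have -> : (line psi eps b t).2 - psi = eps * (atan (t / b) - pi / 2).
  rewrite /line /=; case: he => ->; first by rewrite !mul1r; ring.
  by rewrite !mulN1r mulNr atanN; ring.
rewrite normrM (_ : `|eps| = 1) ?mul1r; last by case: he => ->; rewrite ?normrN normr1.
rewrite distrC; apply: HM.
by rewrite ltr_pdivlMr// mulrC; apply: lt_le_trans t2; rewrite ltr_pM2l// ltrDl.
Qed.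

Lemma cos_ge_on (c d : R) : - (pi / 2) < c -> d < pi / 2 ->
  exists2 m : R, 0 < m & forall x, c <= x <= d -> m <= cos x.
Proof.
move=> c1 d1; have [cd|dc] := leP c d; last first.
  by exists 1 => // x /andP[x1 x2]; lra.
have [x xcd xm] := @EVT_min R cos c d cd (continuous_subspaceT (@continuous_cos R)).
exists (cos x); last by move=> y hy; apply: xm; rewrite in_itv.
by move: xcd; rewrite in_itv/= => /andP[x1 x2]; apply: cos_gt0_pihalf; lra.
Qed.

(** The point lies on the line at distance [b = z.1 * cos (phi - z.2)] from the origin. On a closed
    range of angles inside the half-plane the cosine has a positive minimum [m], so distant points
    lie on distant lines. *)
Lemma ell_coordinates (phi c d : R) : phi - pi / 2 < c -> d < phi + pi / 2 ->
  exists2 m : R, 0 < m & forall z : R * R, 0 < z.1 -> c <= z.2 <= d ->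
    exists b t, [/\ 0 < b, m * z.1 <= b & z = ell_param phi b t].
Proof.
move=> c1 d1; have [||m m0 H] := @cos_ge_on (c - phi) (d - phi); [lra|lra|].
exists m => // z z0 /andP[z1 z2].
have hm : m <= cos (phi - z.2) by rewrite -cosN opprB; apply: H; lra.
have b0 : 0 < z.1 * cos (phi - z.2) by rewrite mulr_gt0// (lt_le_trans m0).
have : ell phi (z.1 * cos (phi - z.2)) z.
  split; first by rewrite /argument; lra.
  by rewrite /modulus mulfK// gt_eqF// (lt_le_trans m0).
rewrite -range_ell_param// => -[t _ zE].
exists (z.1 * cos (phi - z.2)), t; split => //.
by rewrite mulrC ler_pM2l.
Qed.

End ComplexExponential.

Lemma real_cauchy_limit {R : realType} (x : nat -> R) :
  (forall r : R, 0 < r ->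
     exists M, forall m m', (M <= m)%N -> (M <= m')%N -> `|x m - x m'| <= r) ->
  exists l, forall r : R, 0 < r -> exists M, forall m, (M <= m)%N -> `|l - x m| <= r.
Proof.
move=> H.
have : cvgn x.
  apply/cauchy_cvgP/cauchyP => r r0.
  have [M HM] := H (r / 2) (divr_gt0 r0 (ltr0Sn R 1)).
  exists (x M); exists M => // m /= Mm.
  rewrite /ball/=; apply: le_lt_trans (HM _ _ (leqnn M) Mm) _.
  by rewrite ltr_pdivrMr// ltr_pMr// ltr1n.
move=> /cvgrPdist_le cv; exists (limn x) => r r0.
by have [M _ HM] := cv r r0; exists M => m Mm; exact: HM.
Qed.

Lemma energy_complete {R : realType} n (v : nat -> 'I_n -> R[i]) :
  (forall r : R, 0 < r -> exists M, forall m m', (M <= m)%N -> (M <= m')%N ->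
     energy (fun i => v m i - v m' i) <= r) ->
  exists w : 'I_n -> R[i], forall r : R, 0 < r -> exists M, forall m, (M <= m)%N ->
     energy (fun i => w i - v m i) <= r.
Proof.
move=> H.
have lim (pr : R[i] -> R) i : (forall x, `|pr x| <= normc x) ->
    (forall x y, pr (x - y) = pr x - pr y) ->
    exists l, forall r : R, 0 < r -> exists M, forall m, (M <= m)%N ->
      `|l - pr (v m i)| <= r.
  move=> prn prB; apply: real_cauchy_limit => r r0.
  have [M HM] := H (r ^+ 2) (exprn_gt0 2 r0); exists M => m m' Mm Mm'.
  rewrite -prB; apply: le_trans (prn _) _.
  rewrite -(ler_pXn2r (_ : 0 < 2)%N) ?nnegrE ?normc_ge0 ?(ltW r0)//.
  exact: le_trans (energy_ge (fun i => v m i - v m' i) i) (HM m m' Mm Mm').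
have hR i : {l | forall r : R, 0 < r -> exists M, forall m, (M <= m)%N ->
      `|l - Re (v m i)| <= r}.
  by apply: cid; apply: lim; [exact: normr_Re|move=> x y; rewrite ReD ReN].
have hI i : {l | forall r : R, 0 < r -> exists M, forall m, (M <= m)%N ->
      `|l - Im (v m i)| <= r}.
  by apply: cid; apply: lim; [exact: normr_Im|move=> x y; rewrite ImD ImN].
exists (fun i => sval (hR i) +i* sval (hI i)) => r r0.
(* As [y <= 1], also [y ^+ 2 <= r / (2 * (n + 1))]; the real and imaginary parts of [n] coordinates
   then add up to at most [r]. *)
pose y := Num.min 1 (r / (2 * (n%:R + 1))).
have n0 : 0 < n%:R + 1 :> R by rewrite ltr_wpDl.
have y0 : 0 < y by rewrite lt_min ltr01/= divr_gt0// mulr_gt0.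
have ex i : {M : nat | forall m, (M <= m)%N ->
   `|sval (hR i) - Re (v m i)| <= y /\ `|sval (hI i) - Im (v m i)| <= y}.
  apply: cid; have [M1 H1] := svalP (hR i) y y0; have [M2 H2] := svalP (hI i) y y0.
  by exists (maxn M1 M2) => m; rewrite geq_max => /andP[/H1 ? /H2 ?].
exists (\max_i sval (ex i))%N => m Mm.
have yy : y ^+ 2 <= r / (2 * (n%:R + 1)).
  have h1 : y <= 1 by rewrite ge_min lexx.
  have h2 : y <= r / (2 * (n%:R + 1)) by rewrite ge_min lexx orbT.
  by apply: le_trans h2; rewrite expr2 ler_piMr// ltW.
apply: le_trans (_ : _ <= \sum_(i < n) r / (n%:R + 1)) _; last first.
  rewrite sumr_const card_ord -[leLHS]mulr_natl mulrCA ler_piMr ?(ltW r0)//.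
  by rewrite ler_pdivrMr// mul1r lerDl.
apply: ler_sum => i _.
have [h1 h2] : `|sval (hR i) - Re (v m i)| <= y /\ `|sval (hI i) - Im (v m i)| <= y.
  by apply: (svalP (ex i)); apply: leq_trans Mm; exact: leq_bigmax.
rewrite sqr_normc ReD ImD ReN ImN /=.
have sq (x : R) : `|x| <= y -> x ^+ 2 <= y ^+ 2.
  by move=> xy; rewrite -(real_normK (num_real x)) lerXn2r ?nnegrE ?normr_ge0 ?(ltW y0).
apply: le_trans (lerD (sq _ h1) (sq _ h2)) _.
have -> : r / (n%:R + 1) = r / (2 * (n%:R + 1)) + r / (2 * (n%:R + 1)).
  by field; rewrite gt_eqF.
exact: lerD.
Qed.

(** * Asymptotics of solutions in sectors *)

Section Sectors.
Context {R : realType}.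
Variables (a : R) (n l h : nat) (q : 'I_n -> 'I_l) (sigma : 'I_h.+1 -> R).
Variables (lam : 'I_l -> 'I_h.+1 -> R[i]) (jo : 'I_l) (e : 'I_n -> R[i]).
Variables (N : 'M[R[i]]_n -> R) (P : R * R -> 'M[R[i]]_n).
Hypothesis a0 : 0 < a.
Hypothesis sigma0 : sigma ord0 = 1.
Hypothesis sigma1 : forall k, k != ord0 -> sigma k < 1.
Hypothesis e_jo : forall i, q i != jo -> e i = 0.
Hypothesis e_le1 : forall i, normc (e i) <= 1.
Hypothesis HN : is_norm N.
Hypothesis P_pd : forall i j z, a < z.1 ->
  exists l, pd proj (fun z => P z i j) z l.
Hypothesis P_decay : forall I : set R, open I -> is_interval I ->
  good_decay N a P I.

Definition exponent j z := \sum_(k < h.+1) lam j k * zpow (sigma k) z.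
Definition exponent' j z :=
  \sum_(k < h.+1) (sigma k)%:C * lam j k * zpow (sigma k - 1) z.
Definition coef i j z : R[i] :=
  (if i == j then exponent' (q i) z else 0) + P z i j.

Definition good psi := forall j, j != jo ->
  0 < Re ((lam j ord0 - lam jo ord0) * cis psi).

Lemma coef_pd i j z : a < z.1 -> exists l, pd proj (coef i j) z l.
Proof.
move=> az; have [l2 H2] := P_pd i j az.
have : exists l1, pd proj (fun z => if i == j then exponent' (q i) z else 0) z l1.
  have [ij|_] := boolP (i == j); last by exists 0; exact: pd_cst.
  exists (\sum_k (0 * zpow (sigma k - 1) z + (sigma k)%:C * lam (q i) k *
    ((sigma k - 1)%:C * zpow (sigma k - 1 - 1) z))).
  apply: pd_sum => k.
  exact: (pdM (@proj_cont R) (pd_cst proj _ z) (zpow_pd _ a0 az)).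
by move=> [l1 H1]; exists (l1 + l2); exact: pdD.
Qed.

Let solution := cover_solution a coef.

Definition reduced (u : 'I_n -> R * R -> R[i]) z i := cexp (- exponent jo z) * u i z.

(** For [k = 1] this is the squared distance of the reduced solution to [e]; [k = 0] serves for
    differences of solutions, which tend to 0. *)
Definition defect (k : R) u z := energy (fun i => reduced u z i - k%:C * e i).

(** The leading term has the constant positive real part [c j]. The other terms carry the negative
    exponents [sigma k - 1], and their sum stays below [c j] once every power is at most
    [c j / M j]. Summing the finitely many thresholds gives a common one. *)
Lemma line_threshold psi : good psi -> exists2 b0 : R, a < b0 &
  forall z j, b0 <= z.1 -> 0 <= Re ((exponent' j z - exponent' jo z) * cis psi).
Proof.
move=> gpsi.
pose cf j k : R[i] := (sigma k)%:C * (lam j k - lam jo k).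
pose c j := Re ((lam j ord0 - lam jo ord0) * cis psi).
pose M j := \sum_k normc (cf j k) + 1.
have M0 j : 0 < M j by rewrite ltr_wpDl// sumr_ge0// => k _; exact: normc_ge0.
have H (jk : 'I_l * 'I_h.+1) : {X : R | 0 < X & jk.1 != jo -> jk.2 != ord0 ->
    forall r, X <= r -> r `^ (sigma jk.2 - 1) <= c jk.1 / M jk.1}.
  apply: cid2; case: jk => j k /=.
  have [jj|jj] := eqVneq j jo; first by exists 1.
  have [kk|kk] := eqVneq k ord0; first by exists 1.
  have s0 : 0 < 1 - sigma k by rewrite subr_gt0; exact: sigma1.
  have [X X0 HX] := powR_small s0 (divr_gt0 (gpsi j jj) (M0 j)).
  by exists X => // _ _ r /HX; rewrite opprB.
have X0 jk : 0 < s2val (H jk) by case: (H jk).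
exists (a + 1 + \sum_jk s2val (H jk)).
  have : 0 <= \sum_jk s2val (H jk) by apply: sumr_ge0 => jk _; exact: ltW.
  by lra.
move=> z j bz.
have [->|jj] := eqVneq j jo; first by rewrite subrr mul0r.
have zX k : s2val (H (j, k)) <= z.1.
  apply: le_trans bz; apply: le_trans (_ : _ <= \sum_jk s2val (H jk)) _.
    by rewrite (bigD1 (j, k))//= lerDl sumr_ge0// => jk _; exact: ltW.
  by rewrite lerDr addr_ge0// ltW.
have zk k : k != ord0 -> z.1 `^ (sigma k - 1) <= c j / M j.
  by move=> kk; have := zX k; case: (H (j, k)) => /= X _; apply.
have -> : exponent' j z - exponent' jo z = (lam j ord0 - lam jo ord0)
    + \sum_(k < h.+1 | k != ord0) cf j k * zpow (sigma k - 1) z.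
  rewrite /exponent' -sumrB (bigD1 ord0)//=; congr (_ + _).
    by rewrite sigma0 subrr /zpow powRr0 mul0r cis0; ring.
  by apply: eq_bigr => k _; rewrite /cf; ring.
rewrite mulrDl ReD -/(c j).
suff : `|Re ((\sum_(k < h.+1 | k != ord0) cf j k * zpow (sigma k - 1) z) * cis psi)| <= c j.
  by rewrite ler_norml; lra.
apply: le_trans (normr_Re _) _; rewrite normcM normc_cis mulr1.
apply: le_trans (normc_sum _ _ _) _.
apply: le_trans (_ : _ <= \sum_(k < h.+1 | k != ord0) normc (cf j k) * (c j / M j)) _.
  apply: ler_sum => k kk; rewrite normcM normc_zpow ler_wpM2l ?normc_ge0//.
  exact: zk.
rewrite -mulr_suml mulrA ler_pdivrMr// mulrC ler_pM2l; last exact: gpsi.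
rewrite /M [X in _ <= X + _](bigD1 ord0)//=.
by have := normc_ge0 (cf j ord0); lra.
Qed.

(** [energy_le] applied to [reduced u - k * e] along a line. The constant [C] comes from the size of
    the system and the comparison of [N] with the entries, hence is common to all directions and
    lines. *)
Lemma line_estimate : exists2 C : R, 0 <= C & forall psi eps,
  good psi -> eps = 1 \/ eps = -1 -> exists2 b0 : R, a < b0 &
  forall b, b0 <= b -> exists Th : R -> R,
    (forall t1 t2, t1 <= t2 -> 0 <= Th t2 - Th t1 <= ell_L1 N P (psi - eps * (pi / 2)) b) /\
    (forall u k t1 t2, solution u -> 0 <= k <= 1 -> t1 <= t2 ->
      defect k u (line psi eps b t1) + k <=
      (defect k u (line psi eps b t2) + k) * expR (C * (Th t2 - Th t1))).
Proof.
have [K K0 HK] := mxnorm_entry HN.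
exists (4 * n%:R ^+ 2 * K); first by rewrite mulr_ge0// mulr_ge0// exprn_ge0.
move=> psi eps gpsi he; have [b0 ab0 Hb0] := line_threshold gpsi.
exists b0 => // b b0b; have ab : a < b by exact: lt_le_trans b0b.
have bp : 0 < b by exact: lt_trans ab.
have [Th [H1 H2]] := @line_primitive R n a N P a0 HN P_pd P_decay psi eps b ab he.
exists Th; split => // u k t1 t2 Hu k01 t12.
pose g := line psi eps b.
have ag t : a < (g t).1 by apply: lt_le_trans ab _; exact: line_modulus.
have dexp t : cder (fun s => - exponent jo (g s)) t (- (exponent' jo (g t) * cis psi)).
  apply: cderN.
  have D k' := cderM (cder_cst (lam jo k') t) (line_zpow_cder psi t (sigma k') bp he).
  apply: cder_eq (cder_sum (index_enum 'I_h.+1) D).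
  by rewrite /exponent' mulr_suml; apply: eq_bigr => k' _; rewrite /g; ring.
have du i t : cder (fun s => u i (g s)) t ((\sum_j coef i j (g t) * u j (g t)) * cis psi).
  apply: (pd_path _ (line_proj_cder psi t bp he) (Hu _ (ag t) i)) => x x0.
  exact: line_cont.
have := @energy_le R n (fun i t => reduced u (g t) i - k%:C * e i) e k
  (fun i t => (exponent' (q i) (g t) - exponent' jo (g t)) * cis psi)
  (fun i j t => P (g t) i j * cis psi)
  (fun t => K * N (P (g t))) (fun t => K * Th t) t1 t2 t12 k01 e_le1.
rewrite -mulrBr [in X in X -> _]/= mulrA; apply => t _; split.
- move=> i.
  apply: cder_eq (cderB (cderM (cder_cexp (dexp t)) (du i t)) (cder_cst (k%:C * e i) t)).
  rewrite subr0 /reduced.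
  have -> : \sum_j coef i j (g t) * u j (g t) =
      exponent' (q i) (g t) * u i (g t) + \sum_j P (g t) i j * u j (g t).
    rewrite (eq_bigr (fun j => (if i == j then exponent' (q i) (g t) else 0) * u j (g t)
      + P (g t) i j * u j (g t))); last by move=> j _; rewrite /coef mulrDl.
    rewrite big_split/= (bigD1 i)//= eqxx big1 ?addr0// => j ji.
    by rewrite eq_sym (negbTE ji) mul0r.
  have -> : \sum_j P (g t) i j * cis psi * (cexp (- exponent jo (g t)) * u j (g t)
      - k%:C * e j + k%:C * e j) =
      cis psi * cexp (- exponent jo (g t)) * \sum_j P (g t) i j * u j (g t).
    by rewrite mulr_sumr; apply: eq_bigr => j _; rewrite subrK; ring.
  (* Subtracting [k * e] leaves the drift term unchanged: in block [jo] the drift is 0, and in the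
     other blocks [e] is 0. *)
  have [qi|qi] := eqVneq (q i) jo.
    by rewrite qi subrr !mul0r add0r; ring.
  by rewrite (e_jo qi) mulr0 subr0; ring.
- move=> i; apply: Hb0; apply: le_trans b0b _; exact: line_modulus.
- by move=> i j; rewrite normcM normc_cis mulr1; exact: HK.
- exact: (is_deriveZ K (H1 t)).
Qed.

Definition asymptotic u c d := forall x : R, 0 < x -> exists X : R,
  forall z : R * R, X <= z.1 -> c <= z.2 <= d -> defect 1 u z <= x.

Definition asymptotic_near u th := exists2 del : R, 0 < del &
  asymptotic u (th - del) (th + del).

Lemma asymptotic_cat u c m d :
  asymptotic u c m -> asymptotic u m d -> asymptotic u c d.
Proof.
move=> H1 H2 x x0; have [X1 {}H1] := H1 x x0; have [X2 {}H2] := H2 x x0.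
exists (Num.max X1 X2) => z; rewrite ge_max => /andP[z1 z2] /andP[z3 z4].
by have [zm|/ltW zm] := leP z.2 m; [apply: H1|apply: H2] => //; apply/andP.
Qed.

Lemma defect_ge0 k u z : 0 <= defect k u z. Proof. exact: energy_ge0. Qed.

Lemma asymptotic_line u psi eps b : 0 < b -> eps = 1 \/ eps = -1 ->
  asymptotic_near u psi -> forall x : R, 0 < x ->
  exists T : R, forall t, T <= t -> defect 1 u (line psi eps b t) <= x.
Proof.
move=> b0 he [del del0 H] x x0; have [X {}H] := H x x0.
have [T HT] := line_end psi X b0 he del0.
exists T => t /HT[h1 h2]; apply: H => //.
by move: h2; rewrite ler_norml; lra.
Qed.

Lemma small_exp (C x phi : R) : 0 <= C -> 0 < x -> exists2 b0 : R, a < b0 &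
  forall b, b0 <= b -> forall y, 0 <= y <= ell_L1 N P phi b -> expR (C * y) <= 1 + x.
Proof.
move=> C0 x0.
have [_ H] := @decay_at R n a N P P_decay phi.
have l0 : 0 < ln (1 + x) by rewrite ln_gt0// ltrDl.
have k0 : 0 < ln (1 + x) / (C + 1) by rewrite divr_gt0// ltr_wpDl.
have [b0 ab0 {}H] := H _ k0; exists b0 => // b /H hb y /andP[y0 y1].
rewrite -[1 + x]lnK ?posrE ?addr_gt0// ler_expR.
have : C * y <= (C + 1) * y by rewrite ler_wpM2r// lerDl.
have : (C + 1) * y <= (C + 1) * (ln (1 + x) / (C + 1)).
  by rewrite ler_pM2l ?ltr_wpDl//; apply: le_trans y1 hb.
by rewrite mulrCA divff ?mulr1; [lra|rewrite gt_eqF// ltr_wpDl].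
Qed.

(** Through a point [z] of the half-plane on the side given by [eps] runs a line in direction [psi].
    Its arguments tend to [psi], so the defect vanishes at its end, and going back to [z] costs only
    [expR] of the small L^1 norm. For [eps = 1] the arguments covered are those between [psi - pi]
    and [psi], for [eps = -1] those between [psi] and [psi + pi]. *)
Lemma propagate u psi eps c d : solution u -> good psi -> eps = 1 \/ eps = -1 ->
  asymptotic_near u psi ->
  psi - eps * (pi / 2) - pi / 2 < c -> d < psi - eps * (pi / 2) + pi / 2 ->
  asymptotic u c d.
Proof.
move=> Hu gpsi he Hn hc hd x x0.
have [C C0 HC] := line_estimate; have [b0 ab0 Hb0] := HC psi eps gpsi he.
have [b1 ab1 Hb1] := small_exp (psi - eps * (pi / 2)) C0 x0.
have [m m0 Hm] := ell_coordinates hc hd.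
exists (Num.max 1 (Num.max b0 b1 / m)) => z.
rewrite ge_max => /andP[z1 z2] zcd.
have zp : 0 < z.1 by lra.
have [b [t [bp mb zE]]] := Hm z zp zcd.
have : Num.max b0 b1 <= b.
  by apply: le_trans mb; rewrite mulrC -ler_pdivrMr.
rewrite ge_max => /andP[b0b b1b].
have [Th [HT1 HT2]] := Hb0 b b0b.
have zL : z = line psi eps b (eps * t).
  have ee : eps * (eps * t) = t by case: he => ->; ring.
  by rewrite zE /line ee.
have est y : 0 < y -> defect 1 u z + 1 <= (y + 1) * (1 + x).
  move=> y0; have [T HT] := asymptotic_line bp he Hn y0.
  pose t2 := Num.max T (eps * t).
  have tt : eps * t <= t2 by rewrite /t2 le_max lexx orbT.
  have k01 : 0 <= (1 : R) <= (1 : R) by rewrite ler01 lexx.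
  have := HT2 u 1 _ _ Hu k01 tt; rewrite -zL => h1; apply: le_trans h1 _.
  apply: ler_pM; rewrite ?expR_ge0 ?addr_ge0 ?defect_ge0//.
    by rewrite lerD2r; apply: HT; rewrite le_max lexx.
  by apply: (Hb1 b b1b); exact: HT1.
rewrite leNgt; apply/negP => hx.
(* Half of the supposed excess of the defect over [x], after multiplication by [1 + x]; [est] then
   bounds the excess by its half. *)
pose y := (defect 1 u z - x) / (2 * (1 + x)).
have y0 : 0 < y by rewrite divr_gt0 ?subr_gt0// mulr_gt0// addr_gt0.
have := est y y0.
have : y * (1 + x) = (defect 1 u z - x) / 2.
  by rewrite /y; field; rewrite gt_eqF// addr_gt0.
have : (y + 1) * (1 + x) = y * (1 + x) + (1 + x) by ring.
by lra.
Qed.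

(** Dividing the projections by [cis (psi0 - pi / 2)] leaves the equation
    [b0 + i T = cis del * (b + i t)], solved by [b = b0 cos del + T sin del] and
    [t = T cos del - b0 sin del]. *)
Lemma line_intersection (psi0 psi b0 b : R) : 0 < b0 -> 0 < b ->
  psi0 < psi < psi0 + pi ->
  line psi0 1 b0 ((b - b0 * cos (psi - psi0)) / sin (psi - psi0)) =
  line psi 1 b ((b - b0 * cos (psi - psi0)) / sin (psi - psi0) * cos (psi - psi0)
                - b0 * sin (psi - psi0)).
Proof.
move=> b00 bp /andP[p1 p2].
set del := psi - psi0; set T := _ / _; set t := T * cos del - _.
have s0 : sin del != 0 by rewrite gt_eqF//; apply: sin_gt0_pi; rewrite /del; lra.
have pE : proj (line psi0 1 b0 T) = proj (line psi 1 b t).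
  rewrite /line !mul1r !proj_ell_param//.
  have -> : psi - pi / 2 = (psi0 - pi / 2) + del by rewrite /del; ring.
  rewrite (cisD (psi0 - pi / 2) del) -mulrA; congr (_ * _).
  apply: complexP; rewrite ?ReM ?ImM /=.
  - have e1 : b = b0 * cos del + T * sin del by rewrite /T; field.
    rewrite {1}e1 /t; transitivity (b0 * (cos del ^+ 2 + sin del ^+ 2)); last by ring.
    by rewrite cos2Dsin2 mulr1.
  - have e1 : b = b0 * cos del + T * sin del by rewrite /T; field.
    rewrite {1}e1 /t; transitivity (T * (cos del ^+ 2 + sin del ^+ 2)); last by ring.
    by rewrite cos2Dsin2 mulr1.
have r1 : 0 < (line psi0 1 b0 T).1 by apply: lt_le_trans b00 (line_modulus _ _ _ b00).
have r2 : 0 < (line psi 1 b t).1 by apply: lt_le_trans bp (line_modulus _ _ _ bp).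
have rE : (line psi0 1 b0 T).1 = (line psi 1 b t).1.
  by rewrite -(normc_proj r1) pE normc_proj.
rewrite [LHS]surjective_pairing [RHS]surjective_pairing rE; congr (_, _).
(* Both arguments lie between [psi0 - pi] and [psi], an interval shorter than [2 * pi], so equality
   of the projections lifts to the cover. *)
apply: cis_inj.
  have rC : ((line psi 1 b t).1)%:C != 0 :> R[i].
    by rewrite -normc_gt0 normc_real normr_gt0 gt_eqF.
  by apply: (mulfI rC); rewrite -{1}rE; exact: pE.
rewrite /line /=.
have := atan_ltpi2 (1 * T / b0); have := atan_gtNpi2 (1 * T / b0).
have := atan_ltpi2 (1 * t / b); have := atan_gtNpi2 (1 * t / b).
by rewrite ltr_norml /del in s0 *; lra.
Qed.

(** Here the behaviour is known on a single line only, so [propagate] cannot start. The line through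
    [z] in the direction [psi] crosses the given line, the farther out the larger its distance [b]
    from the origin, and the estimate runs back to [z] from the crossing. *)
Lemma first_sector u psi0 psi b0 c d : solution u -> 0 < b0 ->
  (forall x : R, 0 < x -> exists T : R, forall t, T <= t ->
     defect 1 u (line psi0 1 b0 t) <= x) ->
  good psi -> psi0 < psi < psi0 + pi -> psi - pi < c -> d < psi0 ->
  asymptotic u c d.
Proof.
move=> Hu b00 H0 gpsi /andP[p1 p2] hc hd x x0.
have he : (1 : R) = 1 \/ (1 : R) = -1 by left.
pose y := Num.min 1 (x / 3).
have y0 : 0 < y by rewrite lt_min ltr01 divr_gt0.
have yx : (y + 1) * (1 + y) <= x + 1.
  have y1 : y <= 1 by rewrite ge_min lexx.
  have y3 : y <= x / 3 by rewrite ge_min lexx orbT.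
  by nra.
have [C C0 HC] := line_estimate; have [b1 ab1 Hb1] := HC psi 1 gpsi he.
have [b2 ab2 Hb2] := small_exp (psi - 1 * (pi / 2)) C0 y0.
have [T1 HT1] := H0 y y0.
have dd : 0 < psi0 - d by rewrite subr_gt0.
have [T2 HT2] := line_end psi0 0 b00 he dd.
have [|| m m0 Hm] := @ell_coordinates R (psi - 1 * (pi / 2)) c d; [lra|lra|].
set del := psi - psi0.
have s0 : 0 < sin del by apply: sin_gt0_pi; rewrite /del; lra.
pose T0 := Num.max T1 T2.
(* The second bound places the crossing at parameter [T0] or beyond on the given line. *)
pose B := Num.max (Num.max b1 b2) (T0 * sin del + b0 * cos del).
exists (Num.max 1 (B / m)) => z; rewrite ge_max => /andP[z1 z2] zcd.
have zp : 0 < z.1 by lra.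
have [b [t [bp mb zE]]] := Hm z zp zcd.
have : B <= b by apply: le_trans mb; rewrite mulrC -ler_pdivrMr.
rewrite ge_max => /andP[]; rewrite ge_max => /andP[b1b b2b] bT.
have [Th [HTh1 HTh2]] := Hb1 b b1b.
have zL : z = line psi 1 b t by rewrite zE /line [1 * t]mul1r.
have pp : psi0 < psi < psi0 + pi by rewrite p1.
have := line_intersection b00 bp pp; rewrite -/del.
set T := _ / _; set ts := T * cos del - _ => LE.
have T0T : T0 <= T by rewrite /T ler_pdivlMr// lerBrDr.
have [_ argT] : 0 <= (line psi0 1 b0 T).1 /\ `|(line psi0 1 b0 T).2 - psi0| <= psi0 - d.
  by apply: HT2; apply: le_trans T0T; rewrite le_max lexx orbT.
(* The argument increases along the line. At the crossing it is within [psi0 - d] of [psi0], hence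
   at least [d], while at [z] it is at most [d]; so [z] does not come after the crossing. *)
have tts : t <= ts.
  rewrite leNgt; apply/negP => tst.
  have : atan (ts / b) < atan (t / b) by apply: lt_atan; rewrite ltr_pM2r ?invr_gt0.
  move/andP: zcd => [_ zd]; move: argT; rewrite LE; move: zd; rewrite zL.
  by rewrite /line /= !mul1r ler_norml; lra.
have k01 : 0 <= (1 : R) <= (1 : R) by rewrite ler01 lexx.
have est := HTh2 u 1 _ _ Hu k01 tts.
rewrite -(lerD2r 1); apply: le_trans yx.
rewrite zL; apply: le_trans est _.
apply: ler_pM; rewrite ?expR_ge0 ?addr_ge0 ?defect_ge0//.
  rewrite lerD2r -LE; apply: HT1; apply: le_trans T0T.
  by rewrite le_max lexx.
by apply: (Hb2 b b2b); exact: HTh1.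
Qed.

Let dependence := cover_solution_dependence coef_pd.

Lemma solution_eq0 u z0 : solution u -> a < z0.1 -> (forall i, u i z0 = 0) ->
  forall z, a < z.1 -> forall i, u i z = 0.
Proof.
move=> Hu az0 u0 z az i; have [C C0 H] := dependence az0 az.
have E0 : energy (u^~ z0) = 0.
  by rewrite /energy big1// => j _; rewrite u0 normc0 expr0n.
have := H u Hu; rewrite E0 mulr0 => h0.
have := le_trans (energy_ge (u^~ z) i) h0.
by rewrite le_eqVlt ltNge sqr_ge0 orbF sqrf_eq0 normc_eq0 => /eqP.
Qed.

Lemma reduced0 u z i : u i z = cexp (exponent jo z) * reduced u z i.
Proof. by rewrite /reduced mulrA cexpN mul1r. Qed.

(** The reduced difference tends to 0 at the end of a line, and the backward estimate with [k = 0]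
    multiplies its energy by at most the constant [expR (C * L)]. So it vanishes at a point of the
    line, and then everywhere by [solution_eq0]. *)
Lemma solution_unique u v psi : good psi -> solution u -> solution v ->
  asymptotic_near u psi -> asymptotic_near v psi ->
  forall z, a < z.1 -> forall i, u i z = v i z.
Proof.
move=> gpsi Hu Hv Nu Nv.
pose d i z := u i z - v i z.
have Hd : solution d by exact: cover_solutionB.
have he : (1 : R) = 1 \/ (1 : R) = -1 by left.
have [C C0 HC] := line_estimate; have [b ab Hb] := HC psi 1 gpsi he.
have bp : 0 < b by exact: lt_trans ab.
have [Th [HT1 HT2]] := Hb b (lexx b).
set L := ell_L1 _ _ _ _ in HT1.
pose g := line psi 1 b.
have small x : 0 < x -> defect 0 d (g 0) <= 4 * x * expR (C * L).
  move=> x0; have [T1 H1] := asymptotic_line bp he Nu x0.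
  have [T2 H2] := asymptotic_line bp he Nv x0.
  pose T := Num.max 0 (Num.max T1 T2).
  have T0 : 0 <= T by rewrite le_max lexx.
  have k01 : 0 <= (0 : R) <= 1 by rewrite lexx ler01.
  have := HT2 d 0 0 T Hd k01 T0; rewrite !addr0 -/g => est.
  apply: le_trans est _; apply: ler_pM; rewrite ?expR_ge0 ?defect_ge0//; last first.
    by rewrite ler_expR ler_wpM2l//; case/andP: (HT1 0 T T0).
  have -> : defect 0 d (g T) = energy (fun i =>
      (reduced u (g T) i - 1%:C * e i) - (reduced v (g T) i - 1%:C * e i)).
    by congr energy; apply/funext => i; rewrite /reduced /d; ring.
  apply: le_trans (energyB_le _ _) _.
  have h1 : defect 1 u (g T) <= x by apply: H1; rewrite /T !le_max lexx !orbT.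
  have h2 : defect 1 v (g T) <= x by apply: H2; rewrite /T !le_max lexx !orbT.
  by rewrite /defect in h1 h2; lra.
have d0 : defect 0 d (g 0) = 0.
  apply/le_anti; rewrite defect_ge0 andbT leNgt; apply/negP => pos.
  have E0 := expR_gt0 (C * L).
  have := small (defect 0 d (g 0) / (8 * expR (C * L))).
  have p8 : 0 < 8 * expR (C * L) by rewrite mulr_gt0.
  rewrite divr_gt0// => /(_ isT).
  have -> : 4 * (defect 0 d (g 0) / (8 * expR (C * L))) * expR (C * L) =
    defect 0 d (g 0) / 2 by field; rewrite gt_eqF.
  by lra.
have az0 : a < (g 0).1 by apply: lt_le_trans ab _; exact: line_modulus.
have u0 i : d i (g 0) = 0.
  rewrite reduced0; have := energy_ge (fun i => reduced d (g 0) i - 0%:C * e i) i.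
  rewrite -/(defect 0 d (g 0)) d0 mul0r subr0 le_eqVlt ltNge sqr_ge0 orbF sqrf_eq0.
  by rewrite normc_eq0 => /eqP ->; rewrite mulr0.
move=> z az i; apply/eqP; rewrite -subr_eq0; apply/eqP.
exact: (solution_eq0 Hd az0 u0 az).
Qed.

(* The solution is the limit of the solutions [Y m] with [reduced (Y m) = e] at
   the point of parameter [m] of the line. *)
Lemma recessive_solution psi : good psi -> exists u b, [/\ solution u, 0 < b &
  forall x : R, 0 < x -> exists T : R, forall t, T <= t ->
    defect 1 u (line psi 1 b t) <= x].
Proof.
move=> gpsi.
have he : (1 : R) = 1 \/ (1 : R) = -1 by left.
have [C C0 HC] := line_estimate; have [b ab Hb] := HC psi 1 gpsi he.
have bp : 0 < b by exact: lt_trans ab.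
have [Th [HT1 HT2]] := Hb b (lexx b).
set L := ell_L1 _ _ _ _ in HT1.
pose g := line psi 1 b.
have ag t : a < (g t).1 by apply: lt_le_trans ab _; exact: line_modulus.
have ThM t1 t2 : t1 <= t2 -> Th t1 <= Th t2 by move=> /HT1 /andP[]; lra.
(* The limit of [Th], which is nondecreasing and bounded by the L^1 norm; [Tinf - Th t] measures the
   tail beyond [t]. *)
have [Tinf HTinf] : exists Tinf, (forall t, Th t <= Tinf) /\
    forall x : R, 0 < x -> exists T, 0 <= T /\ forall t, T <= t -> Tinf - Th t <= x.
  have bd t : Th t <= Th 0 + L.
    have [t0|/ltW t0] := leP 0 t; first by have /andP[] := HT1 _ _ t0; lra.
    by have := ThM _ _ t0; have /andP[] := HT1 _ _ (lexx 0); lra.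
  have hs : has_sup (range Th).
    by split; [exists (Th 0), 0|exists (Th 0 + L) => _ [t _ <-]].
  exists (sup (range Th)); split => [t|x x0].
    by apply: ub_le_sup; [case: hs|exists t].
  have [_ [t _ <-] ht] := sup_adherent x0 hs.
  exists (Num.max 0 t); rewrite le_max lexx; split => // t'; rewrite ge_max => /andP[_ tt].
  by have := ThM _ _ tt; lra.
case: HTinf => Thle Thcv.
have ex m : {Y | solution Y /\ forall i, Y i (g m%:R) = cexp (exponent jo (g m%:R)) * e i}.
  by apply: cid; exact: (cover_solution_exists a0 coef_pd).
pose Y m := sval (ex m).
have HY m : solution (Y m) by case: (svalP (ex m)).
have Ym m i : reduced (Y m) (g m%:R) i = e i.
  have [_ Ym] := svalP (ex m).
  rewrite /reduced -[Y m i _]/(sval (ex m) i (g m%:R)) Ym.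
  by rewrite mulrA [cexp (- _) * _]mulrC cexpN mul1r.
have k11 : 0 <= (1 : R) <= (1 : R) by rewrite ler01 lexx.
have k01 : 0 <= (0 : R) <= (1 : R) by rewrite lexx ler01.
(* The defect of [Y m] is 0 at parameter [m], so at earlier parameters the estimate leaves only the
   exponential of the tail, uniformly in [m]. *)
have D1 m t : t <= m%:R -> defect 1 (Y m) (g t) <= expR (C * (Tinf - Th t)) - 1.
  move=> tm; have := HT2 (Y m) 1 t m%:R (HY m) k11 tm.
  have -> : defect 1 (Y m) (line psi 1 b m%:R) = 0.
    rewrite /defect /energy big1// => i _.
    by rewrite -/g Ym mul1r subrr normc0 expr0n.
  rewrite add0r mul1r -/g => est.
  have : expR (C * (Th m%:R - Th t)) <= expR (C * (Tinf - Th t)).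
    by rewrite ler_expR ler_wpM2l// lerD2r.
  by lra.
pose Ed m m' t := energy (fun i => reduced (Y m) (g t) i - reduced (Y m') (g t) i).
have EdE m m' t : Ed m m' t = defect 0 (fun i z => Y m i z - Y m' i z) (g t).
  by rewrite /Ed /defect; congr energy; apply/funext => i; rewrite /reduced; ring.
(* At parameter [m] the difference of [Y m] and [Y m'] is the deviation of [Y m'] from [e], bounded
   by [D1]; carried back to parameter 0 with [k = 0] it yields a Cauchy sequence. *)
have D2 m m' : (m <= m')%N -> Ed m m' 0 <=
    (expR (C * (Tinf - Th m%:R)) - 1) * expR (C * (Tinf - Th 0)).
  move=> mm; have m0 : 0 <= m%:R :> R by exact: ler0n.
  have sol : solution (fun i z => Y m i z - Y m' i z).
    exact: cover_solutionB (HY m) (HY m').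
  have := HT2 _ 0 0 m%:R sol k01 m0; rewrite !addr0 -/g -!EdE => est.
  apply: le_trans est _; apply: ler_pM; rewrite ?energy_ge0 ?expR_ge0//; last first.
    by rewrite ler_expR ler_wpM2l// lerD2r.
  have mm' : m%:R <= m'%:R :> R by rewrite ler_nat.
  apply: le_trans (D1 m' m%:R mm'); rewrite le_eqVlt; apply/orP; left; apply/eqP.
  rewrite /Ed /defect /energy; apply: eq_bigr => i _.
  by rewrite Ym mul1r normcBC.
have expsmall x : 0 < x -> exists M : nat, forall t, M%:R <= t ->
    expR (C * (Tinf - Th t)) - 1 <= x.
  move=> x0; have l0 : 0 < ln (1 + x) by rewrite ln_gt0// ltrDl.
  have y0 : 0 < ln (1 + x) / (C + 1) by rewrite divr_gt0// ltr_wpDl.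
  have [T [T0 HT]] := Thcv _ y0; exists (Num.bound T) => t Mt.
  have Tt : T <= t by apply: le_trans (ltW (archi_boundP T0)) Mt.
  rewrite lerBlDl -[1 + x]lnK ?posrE ?addr_gt0// ler_expR.
  have h0 : 0 <= Tinf - Th t by rewrite subr_ge0.
  have : C * (Tinf - Th t) <= (C + 1) * (Tinf - Th t) by rewrite ler_wpM2r// lerDl.
  have : (C + 1) * (Tinf - Th t) <= (C + 1) * (ln (1 + x) / (C + 1)).
    by rewrite ler_pM2l ?ltr_wpDl//; exact: HT.
  by rewrite mulrCA divff ?mulr1; [lra|rewrite gt_eqF// ltr_wpDl].
have D3 x : 0 < x -> exists M, forall m m', (M <= m)%N -> (M <= m')%N -> Ed m m' 0 <= x.
  move=> x0; pose K := expR (C * (Tinf - Th 0)).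
  have K0 : 0 < K by exact: expR_gt0.
  have [M HM] := expsmall _ (divr_gt0 x0 K0); exists M.
  have half m m' : (M <= m)%N -> (m <= m')%N -> Ed m m' 0 <= x.
    move=> Mm mm; apply: le_trans (D2 m m' mm) _; rewrite -/K -ler_pdivlMr//.
    by apply: HM; rewrite ler_nat.
  move=> m m' Mm Mm'; have [mm|/ltnW mm] := leqP m m'; first exact: half.
  have -> : Ed m m' 0 = Ed m' m 0.
    by rewrite /Ed /energy; apply: eq_bigr => i _; rewrite normcBC.
  exact: half.
have [w Hw] : exists w : 'I_n -> R[i], forall x : R, 0 < x -> exists M, forall m, (M <= m)%N ->
    energy (fun i => w i - reduced (Y m) (g 0) i) <= x.
  exact: energy_complete D3.
have [u [Hu u0]] := cover_solution_exists a0 coef_pd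
  (fun i => cexp (exponent jo (g 0)) * w i) (ag 0).
exists u, b; split => // x x0; rewrite -/g.
have x4 : 0 < x / 4 by rewrite divr_gt0.
have [M HM] := expsmall _ x4; exists M%:R => t Mt.
have [K K0 HK] := dependence (ag 0) (ag t).
have nz (z : R * R) : 0 < normc (cexp (exponent jo z)) ^+ 2.
  rewrite exprn_gt0// normc_gt0; apply/eqP => c0.
  by have := cexpN (exponent jo z); rewrite c0 mul0r => /esym/eqP; rewrite oner_eq0.
have nz' (z : R * R) : 0 < normc (cexp (- exponent jo z)) ^+ 2.
  rewrite exprn_gt0// normc_gt0; apply/eqP => c0.
  by have := cexpN (exponent jo z); rewrite c0 mulr0 => /esym/eqP; rewrite oner_eq0.
have scale (f : 'I_n -> R[i]) c : energy (fun i => c * f i) = normc c ^+ 2 * energy f.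
  by rewrite /energy mulr_sumr; apply: eq_bigr => i _; rewrite normcM exprMn.
(* The factor by which closeness of [w] and [reduced (Y m)] at parameter 0 passes to parameter [t]:
   leave the reduced form, transport with [dependence], reduce again. *)
pose kap := normc (cexp (- exponent jo (g t))) ^+ 2 * (K + 1) *
  normc (cexp (exponent jo (g 0))) ^+ 2.
have kap0 : 0 < kap.
  by apply: mulr_gt0; [apply: mulr_gt0; [exact: nz'|rewrite ltr_wpDl]|exact: nz].
have [M' HM'] := Hw _ (divr_gt0 x4 kap0).
(* Since [kap] depends on [t], the index [m] is chosen after [t]; the bound [D1] for [Y m] at [t] is
   independent of that choice. Two errors of [x / 4] enter [energyB_le], whose factor is 2. *)
have [m [m1 m2]] : exists m, (M' <= m)%N /\ t <= m%:R.
  exists (maxn M' (Num.bound `|t|)); split; first exact: leq_maxl.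
  apply: le_trans (ler_norm t) _; apply: le_trans (ltW (archi_boundP (normr_ge0 t))) _.
  by rewrite ler_nat leq_maxr.
have h1 := D1 m t m2; have h2 := HM t Mt; have h3 := HM' m m1.
have sol : solution (fun i z => u i z - Y m i z).
  exact: cover_solutionB Hu (HY m).
have h4 : energy (fun i => reduced u (g t) i - reduced (Y m) (g t) i) <= x / 4.
  have -> : energy (fun i => reduced u (g t) i - reduced (Y m) (g t) i) =
     normc (cexp (- exponent jo (g t))) ^+ 2 * energy (fun i => u i (g t) - Y m i (g t)).
    by rewrite -scale; congr energy; apply/funext => i; rewrite /reduced mulrBr.
  have -> : x / 4 = normc (cexp (- exponent jo (g t))) ^+ 2 * ((K + 1) *
      (normc (cexp (exponent jo (g 0))) ^+ 2 * (x / 4 / kap))).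
    have K1 : K + 1 != 0 by rewrite gt_eqF// ltr_wpDl.
    rewrite /kap; move: (gt_eqF (nz' (g t))) (gt_eqF (nz (g 0))).
    move: (_ ^+ 2) (_ ^+ 2) => p r p0 r0.
    by field; rewrite p0 r0 K1.
  rewrite ler_pM2l//; apply: le_trans (HK _ sol) _.
  apply: (@le_trans _ _ ((K + 1) * energy (fun i => u i (g 0) - Y m i (g 0)))).
    by rewrite ler_wpM2r ?energy_ge0// lerDl.
  rewrite ler_pM2l ?ltr_wpDl//.
  have -> : energy (fun i => u i (g 0) - Y m i (g 0)) = normc (cexp (exponent jo (g 0))) ^+ 2
      * energy (fun i => w i - reduced (Y m) (g 0) i).
    rewrite -scale; congr energy; apply/funext => i.
    by rewrite u0 (reduced0 (Y m)) mulrBr.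
  by rewrite ler_pM2l.
have -> : defect 1 u (g t) = energy (fun i => (reduced u (g t) i - reduced (Y m) (g t) i)
     - (1%:C * e i - reduced (Y m) (g t) i)).
  by rewrite /defect; congr energy; apply/funext => i; ring.
apply: le_trans (energyB_le _ _) _.
have -> : energy (fun i => 1%:C * e i - reduced (Y m) (g t) i) = defect 1 (Y m) (g t).
  by rewrite /defect /energy; apply: eq_bigr => i _; rewrite normcBC.
by lra.
Qed.

(** The construction starts from the middle direction [m]. A half-plane with boundary direction [th]
    leaves out [th] itself, so the large sector is covered by the half-planes of two directions
    overlapping each other's gaps; [B <= A + pi] makes consecutive ones meet. *)
Theorem sector_solution (A B : R) : A < B -> B <= A + pi ->
  (forall psi, A < psi < B -> good psi) ->
  exists u, [/\ solution u,
    (forall c d, A - pi < c -> d < B + pi -> asymptotic u c d) &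
    forall v, solution v ->
      (forall c d, A - pi < c -> d < B + pi -> asymptotic v c d) ->
      forall z, a < z.1 -> forall i, v i z = u i z].
Proof.
move=> AB BA gAB.
have pi0 : 0 < pi :> R by exact: pi_gt0.
pose m := (A + B) / 2.
have gm : good m by apply: gAB; rewrite /m; lra.
have [u [b [Hu bp H0]]] := recessive_solution gm.
have l1 : (1 : R) = 1 \/ (1 : R) = -1 by left.
have r1 : (-1 : R) = 1 \/ (-1 : R) = -1 by right.
(* The crossing lines have direction halfway between [m] and [B], which is good and lies beyond
   [m]. *)
have S0 c d : (m + B) / 2 - pi < c -> d < m -> asymptotic u c d.
  move=> hc hd; apply: (first_sector Hu bp H0 _ _ hc hd).
    by apply: gAB; rewrite /m; lra.
  by rewrite /m; lra.
have near_of th c d : c < th < d ->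
    (forall c' d', c < c' -> d' < d -> asymptotic u c' d') -> asymptotic_near u th.
  move=> /andP[h1 h2] H; exists (Num.min (th - c) (d - th) / 2).
    by rewrite divr_gt0// lt_min !subr_gt0 h1.
  have : Num.min (th - c) (d - th) <= th - c by rewrite ge_min lexx.
  have : Num.min (th - c) (d - th) <= d - th by rewrite ge_min lexx orbT.
  have : 0 < Num.min (th - c) (d - th) by rewrite lt_min !subr_gt0 h1.
  by move=> *; apply: H; lra.
have left th c d : A < th < B -> asymptotic_near u th -> th - pi < c -> d < th ->
    asymptotic u c d.
  by move=> hth Hn hc hd; apply: (propagate Hu (gAB _ hth) l1 Hn); lra.
have right th c d : A < th < B -> asymptotic_near u th -> th < c -> d < th + pi ->
    asymptotic u c d.
  by move=> hth Hn hc hd; apply: (propagate Hu (gAB _ hth) r1 Hn); lra.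
have N0 th : A < th < m -> asymptotic_near u th.
  move=> hth; apply: (near_of th ((m + B) / 2 - pi) m) => //.
  by move: hth; rewrite /m; lra.
(* For [th >= m], the half-plane above a direction [th0 < m], already reached by [N0], extends past
   [B] because [B <= A + pi]. *)
have N1 th : A < th < B -> asymptotic_near u th.
  move=> /andP[h1 h2].
  have [hm|hm] := ltP th m; first by apply: N0; rewrite h1.
  pose th0 := (A + m) / 2.
  have hth0 : A < th0 < m by rewrite /th0 /m; lra.
  have hth0B : A < th0 < B by move: hth0; rewrite /m; lra.
  apply: (near_of th th0 (th0 + pi)).
    by move: hth0; rewrite /m in hm *; lra.
  by move=> c d hc hd; apply: (right th0) => //; exact: N0.
have N2 c d : A - pi < c -> d < B + pi -> asymptotic u c d.
  move=> hc hd.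
  (* [th1] is taken close enough to [A] that its left half-plane contains [c], and [th2] close
     enough to [B] that its right half-plane contains [d]. Between them the left half-plane of [th2]
     covers [th1], and the right half-plane of [th1] covers [th2]. *)
  have lc : A < Num.min B (c + pi) by rewrite lt_min AB; lra.
  have ld : Num.max A (d - pi) < B by rewrite gt_max AB; lra.
  pose th1 := Num.min ((A + Num.min B (c + pi)) / 2) m.
  pose th2 := Num.max ((Num.max A (d - pi) + B) / 2) ((m + B) / 2).
  have mAB : A < m < B by rewrite /m; lra.
  have th1A : A < th1 by rewrite lt_min; apply/andP; split; lra.
  have th1m : th1 <= m by rewrite ge_min lexx orbT.
  have th1c : th1 < c + pi.
    have : th1 <= (A + Num.min B (c + pi)) / 2 by rewrite ge_min lexx.
    have : Num.min B (c + pi) <= c + pi by rewrite ge_min lexx orbT.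
    by lra.
  have th2B : th2 < B by rewrite gt_max; apply/andP; split; lra.
  have th2m : m < th2 by rewrite lt_max; apply/orP; right; lra.
  have th2d : d < th2 + pi.
    have : (Num.max A (d - pi) + B) / 2 <= th2 by rewrite le_max lexx.
    have : d - pi <= Num.max A (d - pi) by rewrite le_max lexx orbT.
    by lra.
  have n1 : asymptotic_near u th1 by apply: N1; lra.
  have n2 : asymptotic_near u th2 by apply: N1; lra.
  have h1 : A < th1 < B by lra.
  have h2 : A < th2 < B by lra.
  apply: (@asymptotic_cat u c ((th2 - pi + th1) / 2)).
    by apply: (left th1) => //; lra.
  apply: (@asymptotic_cat u _ ((th1 + th2) / 2)).
    by apply: (left th2) => //; lra.
  apply: (@asymptotic_cat u _ ((th2 + th1 + pi) / 2)).
    by apply: (right th1) => //; lra.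
  by apply: (right th2) => //; lra.
exists u; split => // v Hv N3 z az i.
apply: (solution_unique gm Hv Hu) => //; last by apply: N1; rewrite /m; lra.
exists (pi / 2); first by rewrite divr_gt0.
by apply: N3; rewrite /m; lra.
Qed.

End Sectors.

(** * Stokes directions *)

(** Pigeonhole: an enumeration of [C] turns [F] into an injective, hence surjective, self-map of
    ['I_mu]. *)
Lemma card_II_onto (T : Type) (C : set T) mu (F : 'I_mu -> T) :
  (C #= `I_mu)%card -> (forall r, C (F r)) -> injective F ->
  forall c, C c -> exists r, F r = c.
Proof.
move=> /card_eqPle[/card_leP[f] _] CF Finj.
pose rk c (Cc : C c) : 'I_mu := Ordinal (set_mem (valP (f (SigSub (mem_set Cc))))).
have rk_inj c (Cc : C c) c' (Cc' : C c') : rk c Cc = rk c' Cc' -> c = c'.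
  move=> /(congr1 val)/= /val_inj/(@inj _ _ _ f).
  by rewrite !in_setT => /(_ isT isT)/(congr1 val).
have hinj : injective (fun r => rk (F r) (CF r)) by move=> r r' /rk_inj/Finj.
move=> c Cc; have /codomP[r Er] := injF_onto hinj (rk c Cc).
by exists r; apply/esym; exact: rk_inj Er.
Qed.

Section Stokes.
Context {R : realType}.

Lemma polar (x : R[i]) : exists t : R, x = (normc x)%:C * cis t.
Proof.
have [->|x0] := eqVneq x 0; first by exists 0; rewrite normc0 mul0r.
have n0 : 0 < normc x by rewrite normc_gt0.
set r := normc x in n0 *.
have r2 : Re x ^+ 2 + Im x ^+ 2 = r ^+ 2 by rewrite -sqr_normc.
pose u := Re x / r; pose v := Im x / r.
have uv : u ^+ 2 + v ^+ 2 = 1.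
  by rewrite !expr_div_n -mulrDl r2 divff// expf_neq0// gt_eqF.
have u1 : -1 <= u <= 1.
  by rewrite -ler_norml -(@ler_pXn2r _ 2)// ?nnegrE// expr1n real_normK ?num_real//; 
    have := sqr_ge0 v; lra.
have sv : sin (acos u) = `|v|.
  by rewrite sin_acos// -uv addrAC subrr add0r sqrtr_sqr.
have [v0|v0] := leP 0 v.
- exists (acos u); apply: complexP; rewrite !(ReM, ImM)/= mul0r.
  + by rewrite acosK// subr0 /u mulrC divfK// gt_eqF.
  + by rewrite sv ger0_norm// addr0 /v mulrC divfK// gt_eqF.
- exists (- acos u); apply: complexP; rewrite !(ReM, ImM)/= mul0r ?cosN ?sinN.
  + by rewrite acosK// subr0 /u mulrC divfK// gt_eqF.
  + by rewrite sv ltr0_norm// opprK addr0 /v mulrC divfK// gt_eqF.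
Qed.

Lemma cis_period (k : int) : cis (2 * pi * k%:~R) = 1 :> R[i].
Proof.
have nat_case (m : nat) : cis (2 * pi * m%:R) = 1 :> R[i].
  elim: m => [|m IH]; first by rewrite mulr0 cis0.
  rewrite -[m.+1%:R]natr1 mulrDr cisD IH mul1r mulr1.
  have -> : 2 * pi = pi + pi :> R by ring.
  by rewrite cisD /cis cospi sinpi; apply: complexP; rewrite !(ReM, ImM)/=; ring.
case: k => m; first exact: nat_case.
have H := cisN (2 * pi * m.+1%:R : R).
by rewrite nat_case mul1r in H; rewrite NegzE rmorphN mulrN.
Qed.

Variables (l : nat) (lam0 : 'I_l -> R[i]) (jo : 'I_l) (mu : nat) (tau : nat -> R).
Let T := stokes_directions lam0 jo.
Hypothesis lam_neq : forall i j, i != j -> lam0 i != lam0 j.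
Hypothesis T_card : ([set class_mod2pi t | t in T] #= `I_mu)%card.
Hypothesis tau_consecutive : consecutive T mu tau.
Hypothesis tau_span : tau mu.-1 - tau 0%N < pi.

Lemma tau_mono r r' : (r <= r')%N -> (r' < mu)%N -> tau r <= tau r'.
Proof.
have [_ H _] := tau_consecutive.
rewrite leq_eqVlt => /orP[/eqP->//|rr] r'mu; apply/ltW/H; by rewrite rr.
Qed.

(** The [tau r] lie within a span less than [pi], so they are pairwise inequivalent modulo [2 * pi].
    There being exactly [mu] classes, every class contains one of them. *)
Lemma stokes_class t : T t -> exists r (m : int), (r < mu)%N /\ t = tau r + 2 * pi * m%:~R.
Proof.
move=> Tt; have [T1 H _] := tau_consecutive.
have pi0 : 0 < pi :> R by exact: pi_gt0.
have cl (u : R) : class_mod2pi u u by exists 0 => //; rewrite mulr0 addr0.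
pose F (r : 'I_mu) : set R := class_mod2pi (tau r).
have CF r : [set class_mod2pi t | t in T] (F r) by exists (tau r) => //; exact: T1.
have Finj : injective F.
  move=> r r' E; have := cl (tau r); rewrite -/(F r) E => -[m _ mE].
  have bd : `|tau r - tau r'| < pi.
    have le1 (x : 'I_mu) : tau 0%N <= tau x <= tau mu.-1.
      have m0 : (0 < mu)%N by apply: leq_ltn_trans (ltn_ord x).
      by rewrite !tau_mono// ?prednK// -ltnS prednK.
    have /andP[q1 q2] := le1 r; have /andP[q3 q4] := le1 r'.
    by have sp := tau_span; rewrite ltr_norml; apply/andP; split; lra.
  have E0 : tau r = tau r'.
    move: bd; rewrite -mE addrAC subrr add0r => bd.
    have m0 : m = 0.
      apply/eqP; rewrite -[_ == _]negbK; apply/negP => mn0.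
      have : 1 <= `|m%:~R| :> R.
        by rewrite -intr_norm ler1z -gtz0_ge1 normr_gt0.
      move: bd; rewrite normrM gtr0_norm ?mulr_gt0// => bd m1.
      have : 2 * pi * 1 <= 2 * pi * `|m%:~R| :> R by rewrite ler_pM2l// mulr_gt0.
      by lra.
    by rewrite m0 mulr0 addr0.
  apply: val_inj => /=; have [rr|rr|//] := ltngtP r r'.
  - by have := H r r'; rewrite rr ltn_ord => /(_ isT); rewrite E0 ltxx.
  - by have := H r' r; rewrite rr ltn_ord => /(_ isT); rewrite E0 ltxx.
have Ct : [set class_mod2pi t | t in T] (class_mod2pi t) by exists t.
have [r Er] := card_II_onto T_card CF Finj Ct.
by have := cl t; rewrite -Er => -[m _ mt]; exists r, m.
Qed.

(** With [al] an argument of the difference of eigenvalues, [- pi / 2 - al] is one determination of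
    the Stokes direction [3 pi / 2 - al]. *)
Lemma stokes_direction j : j != jo -> exists2 th, T th &
  (lam0 j - lam0 jo) * cis th = (normc (lam0 j - lam0 jo))%:C * - 'i.
Proof.
move=> jj; set x := lam0 j - lam0 jo.
have x0 : x != 0 by rewrite subr_eq0; exact: lam_neq.
have n0 : 0 < normc x by rewrite normc_gt0.
have [al xE] := polar x.
pose th := - (pi / 2) - al.
have xth : x * cis th = (normc x)%:C * (- 'i).
  rewrite {1}xE -mulrA -cisD; congr (_ * _).
  rewrite /th subrKC /cis cosN sinN cos_pihalf sin_pihalf.
  by apply: complexP; rewrite ?ReN ?ImN/= ?oppr0.
exists th => //; exists j => //; exists (1, th) => //.
rewrite /stokes_ray /= -/x /Defs.proj /modulus /argument /=.
rewrite mul1r xth; split; first exact: ltr01.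
- by rewrite ReM/=; ring.
- by rewrite ImM/= mul0r addr0 mulrN1 oppr_lt0.
Qed.

(** Modulo [2 * pi], [psi] exceeds the Stokes direction of the pair [(j, jo)] by some [d] between 0
    and [pi]. There the product is [- i] times the modulus, so turning by [d] gives the real part
    [normc x * sin d]. *)
Lemma stokes_dominance (k : int) psi j : j != jo ->
  tau mu.-1 + 2 * pi * k%:~R < psi < tau 0%N + pi + 2 * pi * k%:~R ->
  0 < Re ((lam0 j - lam0 jo) * cis psi).
Proof.
move=> jj /andP[p1 p2].
set x := lam0 j - lam0 jo.
have x0 : x != 0 by rewrite subr_eq0; exact: lam_neq.
have n0 : 0 < normc x by rewrite normc_gt0.
have [th Tth xth] := stokes_direction jj; rewrite -/x in xth.
have [r [m [rmu thE]]] := stokes_class Tth.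
pose d := psi - 2 * pi * k%:~R - tau r.
have m0 : (0 < mu)%N by apply: leq_ltn_trans rmu.
have d1 : 0 < d < pi.
  have : tau r <= tau mu.-1 by rewrite tau_mono// -ltnS prednK.
  have : tau 0%N <= tau r by rewrite tau_mono.
  by rewrite /d; lra.
have cE : cis psi = cis th * cis d.
  have -> : psi = tau r + d + 2 * pi * k%:~R by rewrite /d; ring.
  by rewrite thE !cisD !cis_period !mulr1.
rewrite cE mulrA xth ReM !(ReM, ImM)/=.
have sd : 0 < sin d by apply: sin_gt0_pi.
have -> : (normc x * - 0 - 0 * - 1) * cos d - (normc x * - 1 + 0 * - 0) * sin d =
  normc x * sin d by ring.
exact: mulr_gt0.
Qed.

End Stokes.

(** * From coordinates to block matrices and vector solutions *)

Lemma mxdiag_scalar (K : nzSemiRingType) l (s : 'I_l -> nat) (c : 'I_l -> K) i j :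
  (\mxdiag_(x < l) ((c x)%:M : 'M[K]_(s x))) i j = if i == j then c (tagnat.sig1 i) else 0.
Proof.
have key x y (u : 'I_(s x)) (v : 'I_(s y)) :
    (if x == y then conform_mx 0 ((c x)%:M : 'M[K]_(s x)) else 0) u v =
    if tagnat.Rank x u == tagnat.Rank y v then c x else 0.
  have -> : (tagnat.Rank x u == tagnat.Rank y v) = (x == y) && (u == v :> nat).
    by rewrite -val_eqE/= tagnat.eq_Rank.
  have [E|_] /= := eqVneq x y; last by rewrite mxE.
  by subst y; rewrite conform_mx_id mxE -val_eqE; case: eqP => _; rewrite ?mulr1n ?mulr0n.
by rewrite mxE key !tagnat.sig2K.
Qed.

Section SolutionsAsVectors.
Context {R : realType}.
Variables (a : R) (l h : nat) (s : 'I_l -> nat) (sigma : 'I_h.+1 -> R).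
Variables (lam : 'I_l -> 'I_h.+1 -> R[i]) (jo : 'I_l) (m : 'I_(s jo)).
Variable P : ucover R -> 'M[R[i]]_(\sum_i s i).
Hypothesis a0 : 0 < a.

Let n := (\sum_i s i)%N.
Let q : 'I_n -> 'I_l := tagnat.sig1.
Let e : 'cV[R[i]]_n := delta_mx (tagnat.Rank jo m) ord0.
Let A z := Lambda s sigma lam z + P z.
Let ent (u : ucover R -> 'cV[R[i]]_n) i z := u z i ord0.

Lemma LambdaE i j z : A z i j = coef q sigma lam P i j z.
Proof. by rewrite /A /coef mxE /Lambda mxdiag_scalar. Qed.

Lemma is_solutionE u :
  is_solution a A u <-> cover_solution a (coef q sigma lam P) (ent u).
Proof.
have E z i (k : 'I_1) :
    (A z *m u z) i k = \sum_j coef q sigma lam P i j z * ent u j z.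
  by rewrite mxE; apply: eq_bigr => j _; rewrite LambdaE (ord1 k).
split=> H z az.
- move=> i; have /(is_zderiveP _ _ (lt_trans a0 az))/(_ i ord0) := H z az.
  by rewrite E.
- apply/(is_zderiveP _ _ (lt_trans a0 az)) => i k.
  by rewrite E (ord1 k); exact: H.
Qed.

(** The remainder [g] is forced to be the reduced solution minus [e], so both sides say that its
    coordinates tend to 0 uniformly in the argument, once entrywise and once through the energy. *)
Lemma asymptotic_inE u (A0 B0 : R) (S : set (ucover R)) :
  (forall z, S z <-> a < z.1 /\ A0 < z.2 < B0) ->
  asymptotic_in a S u e (fun z => \sum_(k < h.+1) lam jo k * zpow (sigma k) z) <->
  forall c d, A0 < c -> d < B0 ->
    asymptotic sigma lam jo (fun i => e i ord0) (ent u) c d.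
Proof.
move=> SE.
have cnz (x : R[i]) : cexp (- x) * cexp x = 1 by rewrite mulrC cexpN.
split=> H c d.
- move=> hc hd x x0.
  have [|g [gE gcv]] := H c d.
    move=> z [az /andP[z1 z2]]; apply/SE; split => //.
    by rewrite (lt_le_trans hc)// (le_lt_trans _ hd).
  pose y := Num.min 1 (x / (n%:R + 1)).
  have n0 : 0 < n%:R + 1 :> R by rewrite ltr_wpDl.
  have y0 : 0 < y by rewrite lt_min ltr01/= divr_gt0.
  have yy : y ^+ 2 <= x / (n%:R + 1).
    have h1 : y <= 1 by rewrite ge_min lexx.
    have h2 : y <= x / (n%:R + 1) by rewrite ge_min lexx orbT.
    by apply: le_trans h2; rewrite expr2 ler_piMr// ltW.
  have /mx_cvgP/(_ y y0)[[Q1 Q2] /= [[M [_ HM]] HQ2] HQ] := gcv.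
  exists (Num.max (a + 1) (M + 1)) => z; rewrite ge_max => /andP[z1 z2] zcd.
  have az : a < z.1 by lra.
  have zg : forall i j, normc (g z i j - (0 : 'cV[R[i]]_n) i j) <= y.
    apply: (HQ z); split => /=; first by apply: HM; lra.
    by apply: HQ2; rewrite /= in_itv.
  rewrite /defect; apply: le_trans (_ : _ <= \sum_(i < n) y ^+ 2) _.
    apply: ler_sum => i _; rewrite /reduced /ent gE; last by split.
    have -> : cexp (- exponent sigma lam jo z) *
        (cexp (\sum_(k < h.+1) lam jo k * zpow (sigma k) z) *: (e + g z)) i ord0
        - 1%:C * e i ord0 = g z i ord0.
      rewrite mxE mulrA cnz [(e + g z) _ _]mxE.
      by move: (e i ord0) => ei; ring.
    by have := zg i ord0; rewrite mxE subr0 => zi; rewrite lerXn2r ?nnegrE ?normc_ge0 ?(ltW y0).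
  rewrite sumr_const card_ord -[leLHS]mulr_natl.
  apply: le_trans (ler_wpM2l _ yy) _ => //.
  rewrite mulrCA ler_piMr ?(ltW x0)// ler_pdivrMr// mul1r lerDl.
  exact: ler01.
- move=> cdS.
  have Hcd : asymptotic sigma lam jo (fun i => e i ord0) (ent u) c d.
    (* For [d < c] the closed sector is empty and its inclusion in [S] carries no information on [c]
       and [d]. Otherwise the points of modulus [a + 1] on the two boundary rays give [A0 < c] and
       [d < B0]. *)
    have [cd|dc] := leP c d; last first.
      by move=> x x0; exists 0 => z _ /andP[z1 z2]; lra.
    have [|_ /andP[hc _]] := (SE (a + 1, c)).1.
      by apply: cdS; split; rewrite /modulus /argument /= ?ltrDl// lexx cd.
    have [|_ /andP[_ hd]] := (SE (a + 1, d)).1.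
      by apply: cdS; split; rewrite /modulus /argument /= ?ltrDl// lexx cd.
    exact: H.
  exists (fun z => cexp (- exponent sigma lam jo z) *: u z - e); split.
    by move=> z _; rewrite subrKC scalerA -/(exponent sigma lam jo z) cexpN scale1r.
  apply/mx_cvgP => x x0; have [X HX] := Hcd _ (exprn_gt0 2 x0).
  exists ([set r | X < r], `[c, d]%classic) => /=.
    by split; [exists X; split => //; exact: num_real|].
  move=> [r th] [/= Xr]; rewrite in_itv/= => cd i j.
  have := HX (r, th) (ltW Xr) cd; rewrite /defect => hx.
  have := le_trans (energy_ge _ i) hx; rewrite /= (ord1 j) => hi.
  rewrite -(@ler_pXn2r _ 2)// ?nnegrE ?normc_ge0 ?(ltW x0)//.
  apply: le_trans hi; rewrite le_eqVlt; apply/orP; left; apply/eqP.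
  by rewrite !mxE subr0 mul1r /reduced /ent.
Qed.

End SolutionsAsVectors.

Theorem theorem3p19 (R : realType) (a : R) (l h : nat)
    (s : 'I_l -> nat) (sigma : 'I_h.+1 -> R)
    (lam : 'I_l -> 'I_h.+1 -> R[i])
    (N : 'M[R[i]]_(\sum_i s i) -> R)
    (P : ucover R -> 'M[R[i]]_(\sum_i s i))
    (jo : 'I_l) (mu : nat) (tau : nat -> R) :
  0 < a ->
  (2 <= l)%N ->
  (forall i, (0 < s i)%N) ->
  sigma ord0 = 1 ->
  (forall k k' : 'I_h.+1, (k < k')%N -> sigma k' < sigma k) ->
  0 < sigma ord_max ->
  (forall i j, i != j -> lam i ord0 != lam j ord0) ->
  is_norm N ->
  holomorphic_on (cover_gt a) P ->
  (forall I : set R, open I -> is_interval I -> good_decay N a P I) ->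
  let T := stokes_directions (fun i => lam i ord0) jo in
  ([set class_mod2pi t | t in T] #= `I_mu)%card ->
  consecutive T mu tau ->
  tau mu.-1 - tau 0%N < pi ->
  forall k : int,
  exists y : 'I_(s jo) -> ucover R -> 'cV[R[i]]_(\sum_i s i),
  forall m : 'I_(s jo),
  (* [tagnat.Rank jo m] is s_1 + ... + s_(jo-1) + m (see [tagnat.RankEsum]). *)
  let sol_asymp (u : ucover R -> 'cV[R[i]]_(\sum_i s i)) :=
    [/\ holomorphic_on (cover_gt a) u,
        is_solution a (fun z => Lambda s sigma lam z + P z) u &
        asymptotic_in a (sector_k a (tau 0%N) (tau mu.-1) k) u
          (delta_mx (tagnat.Rank jo m) ord0)
          (fun z => \sum_(q < h.+1) lam jo q * zpow (sigma q) z)] in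
  sol_asymp (y m) /\
  (forall u, sol_asymp u -> forall z, cover_gt a z -> u z = y m z).
Proof.
move=> a0 l2 s0 sigma0 sigma_dec sigma_pos lam_neq HN HP Pdec T Tcard Tcons span k.
have P_pd i j z : a < z.1 -> exists x, pd Defs.proj (fun z => P z i j) z x.
  move=> az; have [x] := HP z az.
  by move/(is_zderiveP _ _ (lt_trans a0 az))/(_ i j); exists (x i j).
have sigma1 i : i != ord0 -> sigma i < 1.
  by move=> i0; rewrite -sigma0; apply: sigma_dec; rewrite lt0n.
(* As there are at least two blocks, a Stokes direction exists, so [mu.-1] is a genuine index and
   [tau 0 <= tau mu.-1]. *)
have mu0 : (0 < mu)%N.
  have [j jj] : exists j, j != jo.
    pose z0 : 'I_l := Ordinal (ltnW l2); pose z1 : 'I_l := Ordinal l2.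
    have [->|] := eqVneq jo z0; [by exists z1|by exists z0; rewrite eq_sym].
  have [t Tt _] := stokes_direction lam_neq jj.
  have [r [_ [rmu _]]] := stokes_class Tcard Tcons span Tt.
  exact: leq_ltn_trans rmu.
(* The interval of good directions in sheet [k]; widened by [pi] on both sides it is the range of
   arguments of [sector_k]. *)
pose A := tau mu.-1 + 2 * pi * k%:~R.
pose B := tau 0%N + pi + 2 * pi * k%:~R.
have AB : A < B by move: span; rewrite /A /B; lra.
have BA : B <= A + pi.
  have : tau 0%N <= tau mu.-1 by apply: (tau_mono Tcons) => //; rewrite ltn_predL.
  by rewrite /A /B; lra.
have good_AB psi : A < psi < B -> good lam jo psi.
  by move=> hpsi j jj; exact: (stokes_dominance lam_neq Tcard Tcons span jj hpsi).
have SE z : sector_k a (tau 0%N) (tau mu.-1) k z <->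
    a < z.1 /\ A - pi < z.2 < B + pi.
  rewrite /sector_k /cover_gt /modulus /argument /A /B /=.
  by split=> -[h1 h2]; split=> //; lra.
have main (m : 'I_(s jo)) : {y : ucover R -> 'cV[R[i]]_(\sum_i s i) |
    let sol_asymp (u : ucover R -> 'cV[R[i]]_(\sum_i s i)) :=
    [/\ holomorphic_on (cover_gt a) u,
        is_solution a (fun z => Lambda s sigma lam z + P z) u &
        asymptotic_in a (sector_k a (tau 0%N) (tau mu.-1) k) u
          (delta_mx (tagnat.Rank jo m) ord0)
          (fun z => \sum_(q < h.+1) lam jo q * zpow (sigma q) z)] in
    sol_asymp y /\ (forall u, sol_asymp u -> forall z, cover_gt a z -> u z = y z)}.
  apply: cid; pose e : 'cV[R[i]]_(\sum_i s i) := delta_mx (tagnat.Rank jo m) ord0.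
  have e_jo i : tagnat.sig1 i != jo -> e i ord0 = 0.
    move=> ij; rewrite mxE; case: eqP => // iE.
    by move: ij; rewrite iE tagnat.Rank1K eqxx.
  have e_le1 i : Normc.normc (e i ord0) <= 1.
    by rewrite mxE andbT; case: eqP => _; rewrite ?Normc.normc1 ?Normc.normc0.
  have [u [Hu Au Uu]] := sector_solution a0 sigma0 sigma1 e_jo e_le1 HN P_pd Pdec
    AB BA good_AB.
  pose y z : 'cV[R[i]]_(\sum_i s i) := \col_i u i z.
  have yE : (fun i z => y z i ord0) = u.
    by apply/funext => i; apply/funext => z; rewrite mxE.
  have Hy : is_solution a (fun z => Lambda s sigma lam z + P z) y.
    by apply/(is_solutionE sigma lam P a0); rewrite yE.
  exists y; split.
    split => //; first by move=> z az; eexists; exact: Hy.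
    by apply/(@asymptotic_inE R a l h s sigma lam jo m y (A - pi) (B + pi) _ SE); rewrite yE.
  move=> v [_ /(is_solutionE sigma lam P a0) Hv].
  move=> /(@asymptotic_inE R a l h s sigma lam jo m v (A - pi) (B + pi) _ SE) Av z az.
  apply/colP => i; rewrite [RHS]mxE; exact: (Uu _ Hv Av z az i).
exists (fun m => sval (main m)) => m; exact: svalP (main m).
Qed.
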